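(* Let $F$ be the limit set of a conformal iterated function system (CIFS) $\{S_i:X\to X\}_{i\in I}$, let $h=\dim_{\mathrm H}F$, and let $P$ be a subset of $\bigcup_{i\in I}S_i(X)$ intersecting $S_i(X)$ in exactly one point for each $i\in I$. For $\theta\in(0,1)$, $\phi\in[\theta,1]$ put $$f(\theta,\phi)=\frac{(\phi^{-1}-1)\,\overline{\dim}_{\mathrm A}^{\phi}P+(\theta^{-1}-\phi^{-1})\,\overline{\dim}_{\mathrm B}F}{\theta^{-1}-1}.$$ Assume that the Assouad spectrum $\theta\mapsto\dim_{\mathrm A}^\theta P$ is non-constant and has the three-parameter form. Then for all $\theta\in(0,1)$, $$\dim_{\mathrm A}^\theta F\le\max_{\phi\in[\theta,1]}f(\theta,\phi)=\min\left\{\overline{\dim}_{\mathrm B}F+\frac{(1-\rho_F)\theta}{(1-\theta)\rho_F}\left(\dim_{\mathrm{qA}}F-\overline{\dim}_{\mathrm B}F\right),\ \dim_{\mathrm{qA}}F\right\},$$ where the right-hand side is read as $\dim_{\mathrm{qA}}F$ if $\overline{\dim}_{\mathrm B}F=\dim_{\mathrm{qA}}F$. In particular, if $h\le\overline{\dim}_{\mathrm B}P$ then $\max\{h,\overline{\dim}_{\mathrm A}^\theta P\}=\max_{\phi\in[\theta,1]}f(\theta,\phi)$ for all $\theta\in(0,1)$, and $\dim_{\mathrm A}^\theta F=\dim_{\mathrm A}^\theta P$ for all $\theta\in[0,1]$. If, on the other hand, $\overline{\dim}_{\mathrm B}P<h<\dim_{\mathrm{qA}}P$, then $\max\{h,\overline{\dim}_{\mathrm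 A}^\theta P\}\ne\max_{\phi\in[\theta,1]}f(\theta,\phi)$ for all $\theta\in(0,\rho_P)$.
   Context: Notation: $\mathbb{N}=\{1,2,3,\dots\}$; $B(x,r)$ is the open Euclidean ball; $\mathcal{L}^d$ is Lebesgue measure; $N_r(E)$ is the smallest number of balls of radius $r$ needed to cover $E$; $\dim_{\mathrm H}$ and $\overline{\dim}_{\mathrm B}$ are Hausdorff and upper box dimension. CIFS: Let $d\in\mathbb{N}$, let $X$ be a compact connected subset of $\mathbb{R}^d$, let $I$ be a (non-empty) countable index set (finite or infinite), and let $S_i:X\to X$, $i\in I$. Put $I^*=\bigcup_{n\ge1}I^n$ (finite words), and for $w=w_1\cdots w_n\in I^n$ put $S_w=S_{w_1}\circ\cdots\circ S_{w_n}$. The system is a CIFS if: (1) (Open Set Condition) $U:=\mathrm{Int}_{\mathbb{R}^d}X\neq\varnothing$, $S_i(U)\subset U$ for all $i$, and $S_i(U)\cap S_j(U)=\varnothing$ for $i\ne j$; (2) (Cone condition) $\inf_{x\in X}\inf_{r\in(0,1)}\mathcal{L}^d(B(x,r)\cap \mathrm{Int}_{\mathbb{R}^d}X)/r^d>0$; (3) (Conformality) there is an open, bounded, connected $V\subset\mathbb{R}^d$ with $X\subset V$ and $\epsilon>0$ such that each $S_i$ extends to a $C^{1+\epsilon}$ diffeomorphism $\overline{S_i}$ from $V$ onto an open subset of $V$, which is conformal on $V$: for all $x\in V$ the differential $\overline{S_i}'|_x$ exists, is non-zero, is a similarity map ($\|\overline{S_i}'|_x(y)\|=\|\overline{S_i}'|_x\|\,\|y\|$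 for all $y\in\mathbb{R}^d$), and is $\epsilon$-Hölder continuous in $x$. Moreover there is $\xi\in(0,1)$ with $\|\overline{S_i}'\|<\xi$ for all $i\in I$, where $\|\cdot\|$ is the supremum norm over $V$; (4) (Bounded distortion) there is $K>0$ with $\|S_w'|_y\|\le K\|S_w'|_x\|$ for all $x,y\in V$, $w\in I^*$ (derivatives of the composed extensions). The limit set is $F=\bigcup_{w\in I^{\mathbb{N}}}\bigcap_{n\ge1}S_{w|_n}(X)$, where $w|_n=w_1\cdots w_n$. Dimensions: for a non-empty bounded set $E\subset\mathbb{R}^d$ and $\theta\in(0,1)$, the Assouad spectrum is $\dim_{\mathrm A}^\theta E=\inf\{\alpha:\exists C>0\ \forall x\in E\ \forall\,0<R\le1,\ N_{R^{1/\theta}}(B(x,R)\cap E)\le CR^{\alpha(1-1/\theta)}\}$ and the upper Assouad spectrum is $\overline{\dim}_{\mathrm A}^\theta E=\inf\{\alpha:\exists C>0\ \forall x\in E\ \forall\,0<r\le R^{1/\theta}\le R\le1,\ N_r(B(x,R)\cap E)\le C(R/r)^\alpha\}$. The quasi-Assouad dimension is $\dim_{\mathrm{qA}}E=\lim_{\theta\to1^-}\dim_{\mathrm A}^\theta E$. Conventions: $\dim_{\mathrm A}^1E=\overline{\dim}_{\mathrm A}^1E=\dim_{\mathrm{qA}}E$ and $\dim_{\mathrm A}^0E=\overline{\dim}_{\mathrm A}^0E=\overline{\dim}_{\mathrm B}E$. Put $\rho_E=\inf\{\theta\in[0,1]:\dim_{\mathrm A}^\theta E=\dim_{\mathrm{qA}}E\}$.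 Three-parameter form: the Assouad spectrum of a non-empty bounded set $G\subset\mathbb{R}^d$ has the three-parameter form if either $\overline{\dim}_{\mathrm B}G=\dim_{\mathrm{qA}}G$, or else $\dim_{\mathrm A}^\theta G=\min\left\{\overline{\dim}_{\mathrm B}G+\frac{(1-\rho_G)\theta}{(1-\theta)\rho_G}(\dim_{\mathrm{qA}}G-\overline{\dim}_{\mathrm B}G),\ \dim_{\mathrm{qA}}G\right\}$ for all $\theta\in[0,1)$. *)

(* Defs.v *)
From HB Require Import structures.
From mathcomp Require Import all_boot all_order all_algebra.
From mathcomp Require Import all_classical all_reals all_analysis.

Set Implicit Arguments.
Unset Strict Implicit.
Unset Printing Implicit Defensive.

Import Order.TTheory GRing.Theory Num.Theory.
Import numFieldNormedType.Exports.

Local Open Scope classical_set_scope.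
Local Open Scope ring_scope.

(* The library norm on 'rV[R]_d is the sup norm: it induces the usual topology,
   bounded sets and differentials of R^d, but metric quantities need the
   Euclidean norm. *)
Definition enorm (R : realType) (d : nat) (v : 'rV[R]_d) : R :=
  Num.sqrt (\sum_(j < d) v ord0 j ^+ 2).

Definition eball (R : realType) (d : nat) (x : 'rV[R]_d) (r : R) :
  set 'rV[R]_d := [set y | enorm (y - x) < r].

(* Meaningful for linear maps, where the set below is bounded. *)
Definition opnorm (R : realType) (d : nat) (A : 'rV[R]_d -> 'rV[R]_d) : R :=
  sup [set enorm (A v) | v in [set v | enorm v <= 1]].

(* Half-open boxes; empty, with volume 0, as soon as b_j <= a_j for some j
   (when 0 < d). *)
Definition box (R : realType) (d : nat) (a b : 'rV[R]_d) : set 'rV[R]_d :=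
  [set x | forall j, a ord0 j < x ord0 j <= b ord0 j].

Definition box_vol (R : realType) (d : nat) (a b : 'rV[R]_d) : R :=
  \prod_(j < d) Num.max 0 (b ord0 j - a ord0 j).

(* d-dimensional Lebesgue outer measure, which is Lebesgue measure on
   measurable (in particular, on open) sets. *)
Definition lebesgue_d (R : realType) (d : nat) (A : set 'rV[R]_d) : \bar R :=
  ereal_inf [set (\sum_(0 <= k <oo) (box_vol (ab k).1 (ab k).2)%:E)%E
    | ab in [set ab : nat -> 'rV[R]_d * 'rV[R]_d |
              A `<=` \bigcup_k box (ab k).1 (ab k).2]].

Definition diam (R : realType) (d : nat) (U : set 'rV[R]_d) : R :=
  sup [set enorm (xy.1 - xy.2) | xy in U `*` U].

(* |U|^s with the empty set contributing 0 also when s = 0 *)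
Definition diam_pow (R : realType) (d : nat) (s : R) (U : set 'rV[R]_d) : R :=
  if U == set0 then 0 else diam U `^ s.

(* The diameter bound is imposed pointwise because diam, being a real-valued
   sup, is only meaningful on bounded sets. *)
Definition delta_cover (R : realType) (d : nat) (delta : R)
    (E : set 'rV[R]_d) (U : nat -> set 'rV[R]_d) : Prop :=
  E `<=` \bigcup_k U k /\
  forall k x y, U k x -> U k y -> enorm (x - y) <= delta.

Definition hausdorff_premeasure (R : realType) (d : nat) (s delta : R)
    (E : set 'rV[R]_d) : \bar R :=
  ereal_inf [set (\sum_(0 <= k <oo) (diam_pow s (U k))%:E)%E
    | U in delta_cover delta E].

Definition hausdorff_measure (R : realType) (d : nat) (s : R)
    (E : set 'rV[R]_d) : \bar R :=
  ereal_sup [set hausdorff_premeasure s delta E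
    | delta in [set delta : R | 0 < delta]].

Definition dimH (R : realType) (d : nat) (E : set 'rV[R]_d) : R :=
  inf [set s : R | 0 <= s /\ hausdorff_measure s E = 0%E].

(* N_r(E); +oo if E has no finite cover by r-balls *)
Definition covnum (R : realType) (d : nat) (r : R) (E : set 'rV[R]_d) :
    \bar R :=
  ereal_inf [set (n%:R)%:E
    | n in [set n : nat | exists c : 'I_n -> 'rV[R]_d,
                            E `<=` \bigcup_i eball (c i) r]].

(* limsup_{r -> 0+} log N_r(E) / - log r *)
Definition dimB (R : realType) (d : nat) (E : set 'rV[R]_d) : R :=
  fine (limf_esup (fun r : R => (ln (fine (covnum r E)) / - ln r)%:E) 0^'+).

(* The next two are the formulas for theta in (0,1). *)
Definition assouad_spec (R : realType) (d : nat) (theta : R)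
    (E : set 'rV[R]_d) : R :=
  inf [set alpha : R | exists2 C : R, 0 < C &
    forall (x : 'rV[R]_d) (r : R), E x -> 0 < r <= 1 ->
      (covnum (r `^ theta^-1) (eball x r `&` E)
        <= (C * r `^ (alpha * (1 - theta^-1)))%:E)%E].

Definition upper_assouad_spec (R : realType) (d : nat) (theta : R)
    (E : set 'rV[R]_d) : R :=
  inf [set alpha : R | exists2 C : R, 0 < C &
    forall (x : 'rV[R]_d) (r1 r2 : R), E x ->
      0 < r1 -> 0 < r2 -> r1 <= r2 `^ theta^-1 -> r2 `^ theta^-1 <= r2 ->
      r2 <= 1 ->
      (covnum r1 (eball x r2 `&` E) <= (C * (r2 / r1) `^ alpha)%:E)%E].

Definition dimqA (R : realType) (d : nat) (E : set 'rV[R]_d) : R :=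
  lim (assouad_spec theta E @[theta --> (1 : R)^'-]).

(* The two spectra on [0,1], including the conventions at the endpoints *)
Definition dimA (R : realType) (d : nat) (theta : R) (E : set 'rV[R]_d) : R :=
  if theta == 0 then dimB E
  else if theta == 1 then dimqA E
  else assouad_spec theta E.

Definition upper_dimA (R : realType) (d : nat) (theta : R)
    (E : set 'rV[R]_d) : R :=
  if theta == 0 then dimB E
  else if theta == 1 then dimqA E
  else upper_assouad_spec theta E.

Definition rho (R : realType) (d : nat) (E : set 'rV[R]_d) : R :=
  inf [set theta : R | 0 <= theta <= 1 /\ dimA theta E = dimqA E].

Definition three_param (R : realType) (d : nat) (theta : R)
    (E : set 'rV[R]_d) : R :=
  Num.min (dimB E + (1 - rho E) * theta / ((1 - theta) * rho E)
                      * (dimqA E - dimB E))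
          (dimqA E).

Definition three_param_form (R : realType) (d : nat) (E : set 'rV[R]_d) :
    Prop :=
  dimB E = dimqA E \/
  forall theta : R, 0 <= theta < 1 -> dimA theta E = three_param theta E.

(* S_w = S_{w_1} o ... o S_{w_n}, with the identity for the empty word *)
Definition word_map (I T : Type) (S : I -> T -> T) (w : seq I) : T -> T :=
  foldr (fun i g => S i \o g) id w.

Definition limit_set (T I : Type) (X : set T) (S : I -> T -> T) : set T :=
  \bigcup_(w in [set: nat -> I])
    \bigcap_(n in [set n | (1 <= n)%N]) (word_map S (mkseq w n) @` X).

(* Class C^{1+eps} is read locally, so that the inverse of a diffeomorphism can
   be C^{1+eps} too; Hoelder continuity over all of V is in conformal_on. *)
Definition C1holder (R : realType) (d : nat) (eps : R) (V : set 'rV[R]_d)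
    (f : 'rV[R]_d -> 'rV[R]_d) : Prop :=
  (forall x, V x -> differentiable f x) /\
  (forall x, V x -> exists C : R, exists2 W, nbhs x W &
    forall y z, W y -> W z ->
      opnorm ('d f y \- 'd f z) <= C * enorm (y - z) `^ eps).

Definition C1holder_diffeo (R : realType) (d : nat) (eps : R)
    (V : set 'rV[R]_d) (f : 'rV[R]_d -> 'rV[R]_d) : Prop :=
  [/\ f @` V `<=` V, open (f @` V), C1holder eps V f &
      exists2 g : 'rV[R]_d -> 'rV[R]_d,
        (forall x, V x -> g (f x) = x) & C1holder eps (f @` V) g].

Definition conformal_on (R : realType) (d : nat) (eps : R)
    (V : set 'rV[R]_d) (f : 'rV[R]_d -> 'rV[R]_d) : Prop :=
  [/\ forall x, V x -> differentiable f x,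
      forall x, V x -> exists v, 'd f x v != 0,
      forall x v, V x -> enorm ('d f x v) = opnorm ('d f x) * enorm v &
      exists C : R, forall x y, V x -> V y ->
        opnorm ('d f x \- 'd f y) <= C * enorm (x - y) `^ eps].

Definition open_set_condition (R : realType) (d : nat) (I : Type)
    (X : set 'rV[R]_d) (S : I -> 'rV[R]_d -> 'rV[R]_d) : Prop :=
  [/\ X° !=set0, forall i, S i @` X° `<=` X° &
      forall i j, i <> j -> (S i @` X°) `&` (S j @` X°) = set0].

Definition cone_condition (R : realType) (d : nat) (X : set 'rV[R]_d) : Prop :=
  (0 < ereal_inf [set lebesgue_d (eball xr.1 xr.2 `&` X°)
                        * ((xr.2 ^+ d)^-1)%:E
         | xr in X `*` [set r : R | (0 < r < 1)%R]])%E.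

(* T i is the extension of S i to V; only its values on V matter. *)
Definition conformality (R : realType) (d : nat) (I : Type)
    (X : set 'rV[R]_d) (S : I -> 'rV[R]_d -> 'rV[R]_d)
    (V : set 'rV[R]_d) (T : I -> 'rV[R]_d -> 'rV[R]_d) : Prop :=
  [/\ [/\ open V, bounded_set V, connected V & X `<=` V],
      forall i x, X x -> T i x = S i x,
      exists2 eps : R, 0 < eps &
        forall i, C1holder_diffeo eps V (T i) /\ conformal_on eps V (T i) &
      exists2 xi : R, 0 < xi < 1 &
        forall i, (ereal_sup [set (opnorm ('d (T i) x))%:E | x in V]
                     < xi%:E)%E].

Definition bounded_distortion (R : realType) (d : nat) (I : Type)
    (V : set 'rV[R]_d) (T : I -> 'rV[R]_d -> 'rV[R]_d) : Prop :=
  exists2 K : R, 0 < K & forall (w : seq I) x y, w <> [::] -> V x -> V y ->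
    opnorm ('d (word_map T w) y) <= K * opnorm ('d (word_map T w) x).

Definition cifs (R : realType) (d : nat) (I : Type)
    (X : set 'rV[R]_d) (S : I -> 'rV[R]_d -> 'rV[R]_d) : Prop :=
  [/\ compact X /\ connected X,
      forall i x, X x -> X (S i x),
      open_set_condition X S,
      cone_condition X &
      exists (V : set 'rV[R]_d) (T : I -> 'rV[R]_d -> 'rV[R]_d),
        conformality X S V T /\ bounded_distortion V T].

Definition f_bound (R : realType) (d : nat) (P F : set 'rV[R]_d)
    (theta phi : R) : R :=
  ((phi^-1 - 1) * upper_dimA phi P + (theta^-1 - phi^-1) * dimB F)
    / (theta^-1 - 1).

Definition is_max (R : realType) (A : set R) (m : R) : Prop :=
  A m /\ ubound A m.

(* Main.v *)
(** Only three features of the CIFS matter: the derivatives lam w of the S_w at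
    a base point are almost multiplicative, S_w is bi-Lipschitz on X with
    constants comparable to lam w, and boundedly many cylinders of a given
    length with lam w >= r meet a ball of radius r (a volume count based on the
    open set and cone conditions).  For t > dim_H F the sums of lam w ^ t over
    words of a fixed length are bounded, since otherwise a Bernoulli measure on
    F would satisfy the mass distribution principle with an exponent above
    dim_H F.  Covering F by cylinders that are stopped when lam w drops below r,
    bounds N_r(B(x,R) `&` E) <= C r ^ (- a - e) R ^ (- b) with a >= dim_B F pass
    from P to F, and dim_B F = max (dim_H F) (dim_B P).

    With kappa = 1 / rho_P - 1, the three-parameter form of P amounts to two such
    bounds, (a, b) = (dim_qA P, - dim_qA P) and
    (dim_B P, kappa (dim_qA P - dim_B P) - dim_B P); their convex combination
    with a = dim_B F is what F inherits, and it is optimal for the maximum of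
    f(theta, phi), which is attained at phi = max theta rho_P. *)

Require Import Defs.
From HB Require Import structures.
From mathcomp Require Import all_boot all_order all_algebra.
From mathcomp Require Import all_classical all_reals all_analysis.
From mathcomp Require Import ring lra zify.

Import Order.TTheory GRing.Theory Num.Theory.
Import numFieldNormedType.Exports.

Set Implicit Arguments.
Unset Strict Implicit.
Unset Printing Implicit Defensive.

Local Open Scope classical_set_scope.
Local Open Scope ring_scope.

(** * Coverings and separated sets *)

(** The index set may be infinite, so a cylinder of size at least r can have infinitely many
    children of arbitrary smaller sizes. Covers are therefore organised by the parents w with
    [lam w] >= r: rescaled by [lam w], the small children of one parent lie near points of P, and
    counting bounds for P apply. Children still larger than the target scale are copies of F;
    covering them is what forces a >= dim_B F. Rescaling multiplies a bound (a, b) by [lam w] to the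
    power a + b, which is harmless once a + b >= 0. Radii are written expR (- u) and expR (- v), so
    that exponents are linear in (u, v). A bound (a, b) says that the spectrum times 1 / theta - 1
    is at most a / theta + b, and two such lines make up the minimum in the three-parameter form.
    The loss e in the exponent absorbs every factor linear in u, such as the number of word lengths
    or of size classes. *)

Lemma exists_maximal_seq (T : Type) (Q : seq T -> Prop) (M : nat) :
  Q [::] -> (forall s, Q s -> (size s <= M)%N) ->
  exists2 s, Q s & forall x, ~ Q (x :: s).
Proof.
move=> Q0 QM.
pose P n := `[< exists2 s, Q s & size s = n >].
have P0 : exists n, P n by exists 0%N; apply/asboolP; exists [::].
have PM n : P n -> (n <= M)%N by move=> /asboolP[s Qs <-]; exact: QM.
case: (ex_maxnP P0 PM) => n /asboolP[s Qs sn] nmax.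
exists s => // x Qxs.
have := nmax (size (x :: s)) _; rewrite /= sn ltnn => /(_ _)/wrap[]//.
by rewrite -sn; apply/asboolP; exists (x :: s).
Qed.

Lemma finite_set_of_bound (T : eqType) (A : set T) (M : nat) :
  (forall s, uniq s -> {in s, forall x, A x} -> (size s <= M)%N) ->
  exists s, [/\ uniq s, (size s <= M)%N & forall x, A x <-> x \in s].
Proof.
move=> AM.
have [||s [us sA] smax] := @exists_maximal_seq T
  (fun s => uniq s /\ {in s, forall x, A x}) M.
- by split.
- by move=> s [us sA]; exact: AM.
exists s; split => //; first exact: AM.
move=> x; split => [Ax|/sA//].
apply/negPn/negP => xs; apply: (smax x); split; first by rewrite /= xs.
by move=> y; rewrite inE => /orP[/eqP->//|/sA].
Qed.

Section Euclid.
Variables (R : realType) (d : nat).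
Implicit Types u v w x y : 'rV[R]_d.

Definition dot u v : R := \sum_(j < d) u ord0 j * v ord0 j.

Lemma sumsq_ge0 v : 0 <= \sum_(j < d) v ord0 j ^+ 2.
Proof. by apply: sumr_ge0 => j _; exact: sqr_ge0. Qed.

Lemma enorm_ge0 v : 0 <= enorm v.
Proof. exact: sqrtr_ge0. Qed.

Lemma sqr_enorm v : enorm v ^+ 2 = \sum_(j < d) v ord0 j ^+ 2.
Proof. by rewrite sqr_sqrtr // sumsq_ge0. Qed.

Lemma dotvv v : dot v v = enorm v ^+ 2.
Proof. by rewrite sqr_enorm; apply: eq_bigr => j _; rewrite expr2. Qed.

Lemma enorm0 : enorm (0 : 'rV[R]_d) = 0.
Proof.
by rewrite /enorm big1 ?sqrtr0// => j _; rewrite mxE expr0n.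
Qed.

Lemma enormZ a v : enorm (a *: v) = `|a| * enorm v.
Proof.
apply/eqP; rewrite -(@eqrXn2 _ 2) ?mulr_ge0 ?enorm_ge0//.
rewrite exprMn !sqr_enorm real_normK ?num_real// mulr_sumr.
by apply/eqP/eq_bigr => j _; rewrite mxE exprMn.
Qed.

Lemma enormN v : enorm (- v) = enorm v.
Proof. by rewrite -scaleN1r enormZ normrN1 mul1r. Qed.

Lemma enormBC u v : enorm (u - v) = enorm (v - u).
Proof. by rewrite -enormN opprB. Qed.

Lemma coord_le_enorm v j : `|v ord0 j| <= enorm v.
Proof.
rewrite -(@ler_pXn2r _ 2) ?nnegrE ?enorm_ge0// sqr_enorm real_normK ?num_real//.
by rewrite (bigD1 j)//= lerDl sumr_ge0// => i _; exact: sqr_ge0.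
Qed.

Lemma enorm_eq0 v : enorm v = 0 -> v = 0.
Proof.
move=> v0; apply/rowP => j; rewrite mxE; apply/eqP; rewrite -normr_le0 -v0.
exact: coord_le_enorm.
Qed.

(** Cauchy-Schwarz: the squared length of a u - b v with a = |v|^2 and b = u . v is non-negative and
    equals a (a |u|^2 - b^2). *)
Lemma dot_le_enorm u v : dot u v <= enorm u * enorm v.
Proof.
have [->|v0] := eqVneq v 0.
  by rewrite enorm0 mulr0 /dot big1// => j _; rewrite mxE mulr0.
set b := dot u v; set a := enorm v ^+ 2.
have a_gt0 : 0 < a.
  rewrite exprn_gt0// lt_neqAle enorm_ge0 andbT eq_sym.
  by apply: contra v0 => /eqP/enorm_eq0->.
have : 0 <= \sum_(j < d) (a * u ord0 j - b * v ord0 j) ^+ 2.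
  by apply: sumr_ge0 => j _; exact: sqr_ge0.
have -> (a' b' : R) : \sum_(j < d) (a' * u ord0 j - b' * v ord0 j) ^+ 2 =
    a' ^+ 2 * (\sum_(j < d) u ord0 j ^+ 2) - 2 * a' * b' * dot u v
    + b' ^+ 2 * (\sum_(j < d) v ord0 j ^+ 2).
  rewrite /dot !mulr_sumr -sumrN -!big_split/=.
  by apply: eq_bigr => j _; ring.
rewrite -!sqr_enorm -/a -/b.
have -> : a ^+ 2 * enorm u ^+ 2 - 2 * a * b * b + b ^+ 2 * a =
    a * (a * enorm u ^+ 2 - b ^+ 2) by ring.
rewrite pmulr_rge0// subr_ge0 /a -exprMn => bE.
apply: le_trans (ler_norm _) _.
rewrite -(@ler_pXn2r _ 2) ?nnegrE ?mulr_ge0 ?enorm_ge0// real_normK ?num_real//.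
by rewrite mulrC.
Qed.

Lemma ler_enormD u v : enorm (u + v) <= enorm u + enorm v.
Proof.
rewrite -(@ler_pXn2r _ 2) ?nnegrE ?addr_ge0 ?enorm_ge0//.
have -> : enorm (u + v) ^+ 2 = enorm u ^+ 2 + 2 * dot u v + enorm v ^+ 2.
  rewrite !sqr_enorm /dot mulr_sumr -!big_split/=.
  by apply: eq_bigr => j _; rewrite mxE; ring.
have := dot_le_enorm u v; nra.
Qed.

Lemma enorm_tri x y w : enorm (x - y) <= enorm (x - w) + enorm (w - y).
Proof. by rewrite -[x - y](subrKA w); exact: ler_enormD. Qed.

Lemma enorm_le_coord v (a : R) :
  (forall j, `|v ord0 j| <= a) -> enorm v <= d%:R * a.
Proof.
move=> va; have da0 : 0 <= d%:R * a.
  case: (posnP d) => [->|d0]; first by rewrite mul0r.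
  by rewrite mulr_ge0//; apply: le_trans (va (Ordinal d0)).
rewrite -(@ler_pXn2r _ 2) ?nnegrE ?enorm_ge0// sqr_enorm.
apply: (@le_trans _ _ (\sum_(j < d) a ^+ 2)).
  by apply: ler_sum => j _; rewrite -[leLHS]real_normK ?num_real// lerXn2r ?nnegrE//; apply: le_trans (va j).
rewrite sumr_const card_ord exprMn -[leLHS]mulr_natl ler_wpM2r ?sqr_ge0//.
rewrite -natrX ler_nat; case: (d) => // n; rewrite expnS expn1 leq_pmulr//.
Qed.

End Euclid.

Section Covering.
Variables (R : realType) (d : nat).
Implicit Types x y z c : 'rV[R]_d.

(** The bound m is real, so that estimates such as C expR (t u) enter without rounding; [covnum_leP]
    shows that this means [covnum] at most m. Centres may lie outside E. *)
Definition covby (E : set 'rV[R]_d) (r m : R) : Prop :=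
  exists2 s : seq 'rV[R]_d, (size s)%:R <= m &
    forall x, E x -> exists2 c, c \in s & enorm (x - c) < r.

Definition eseparated (eta : R) (Y : seq 'rV[R]_d) : Prop :=
  {in Y &, forall y y', y != y' -> eta <= enorm (y - y')}.

(** With cells of side eta / (d + 1), a ball of radius rho spans at most 2 (d + 1) rho / eta + 1
    cells per axis, which is at most [packc] times rho / eta when eta <= rho. *)
Definition packc : R := (2 * d.+1%:R + 1).

Lemma packc_ge1 : 1 <= packc.
Proof. rewrite /packc; have := ler0n R d.+1; lra. Qed.

(** Pigeonhole on a grid of mesh eta / (d + 1): two points in one cell are at distance at most d eta
    / (d + 1) < eta, so separated points occupy distinct cells. *)
Lemma separated_card z (rho eta : R) (Y : seq 'rV[R]_d) :
  0 < eta <= rho -> uniq Y -> {in Y, forall y, enorm (y - z) < rho} ->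
  eseparated eta Y -> (size Y)%:R <= (packc * (rho / eta)) ^+ d.
Proof.
move=> /andP[eta0 etarho] uY Yz sepY.
have rho0 : 0 < rho by exact: lt_le_trans etarho.
pose k : R := d.+1%:R / eta.
have k0 : 0 < k by rewrite divr_gt0// ltr0Sn.
pose N := Num.truncn (2 * rho * k).
pose cell y := [ffun j : 'I_d => @inord N (Num.truncn ((y ord0 j - z ord0 j + rho) * k))].
have cellY y : y \in Y -> forall j, 0 <= (y ord0 j - z ord0 j + rho) * k < 2 * rho * k.
  move=> yY j; have := le_lt_trans (coord_le_enorm (y - z) j) (Yz _ yY).
  rewrite !mxE ltr_norml => /andP[h1 h2].
  rewrite mulr_ge0 ?(ltW k0)//; last lra.
  by rewrite ltr_pM2r//; lra.
have cell_inj : {in Y &, injective cell}.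
  move=> y y' yY y'Y yy'; apply/eqP/negPn/negP => /(sepY _ _ yY y'Y).
  apply/negP; rewrite -ltNge.
  have: forall j, `|(y - y') ord0 j| <= eta / d.+1%:R.
    move=> j; have /andP[h1 h2] := cellY _ yY j; have /andP[h3 h4] := cellY _ y'Y j.
    have tN (a : R) : 0 <= a < 2 * rho * k -> (Num.truncn a < N.+1)%N.
      by move=> /andP[a0 aN]; rewrite ltnS; exact/le_truncn/ltW.
    have /(congr1 (@nat_of_ord _)) : cell y j = cell y' j by rewrite yy'.
    rewrite !ffunE !inordK ?tN ?cellY// => tE.
    have /andP[t1 t2] := truncn_itv h1; have /andP[t3 t4] := truncn_itv h3.
    rewrite tE in t1 t2; rewrite !mxE.
    have : `|(y ord0 j - y' ord0 j) * k| <= 1.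
      by rewrite ler_norml; move: t2 t4; rewrite -natr1; move=> t2 t4; apply/andP; split; lra.
    rewrite normrM (gtr0_norm k0) /k -ler_pdivlMr ?divr_gt0 ?ltr0Sn//.
    by rewrite div1r invf_div.
  move=> /enorm_le_coord/le_lt_trans; apply.
  by rewrite mulrCA gtr_pMr// ltr_pdivrMr ?ltr0Sn// mul1r ltr_nat.
have : (size Y <= #|{ffun 'I_d -> 'I_N.+1}|)%N.
  rewrite -(size_map cell); set s := map cell Y.
  have /card_uniqP <- : uniq s by rewrite map_inj_in_uniq.
  exact: max_card.
rewrite card_ffun !card_ord -(ler_nat R) => /le_trans; apply.
have re1 : 1 <= rho / eta by rewrite ler_pdivlMr// mul1r.
have := packc_ge1; move=> p1.
rewrite natrX lerXn2r ?nnegrE ?ler0n//; first by apply: mulr_ge0; lra.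
rewrite -natr1.
have /andP[N1 _] : N%:R <= 2 * rho * k < N.+1%:R by apply: truncn_itv; rewrite ltW// (pmulr_lgt0 _ k0); lra.
move: N1; rewrite /packc.
have -> : 2 * rho * k = 2 * d.+1%:R * (rho / eta) by rewrite /k; field; rewrite gt_eqF.
nra.
Qed.

Lemma separated_net (E : set 'rV[R]_d) z (rho eta : R) :
  0 < eta <= rho -> E `<=` eball z rho ->
  exists Y, [/\ uniq Y, eseparated eta Y, {in Y, forall y, E y},
    forall x, E x -> exists2 y, y \in Y & enorm (x - y) < eta &
    (size Y)%:R <= (packc * (rho / eta)) ^+ d].
Proof.
move=> er Ez; have /andP[eta0 etarho] := er.
pose Q Y := [/\ uniq Y, eseparated eta Y & {in Y, forall y, E y}].
have QY Y : Q Y -> (size Y)%:R <= (packc * (rho / eta)) ^+ d.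
  by move=> [uY sY YE]; apply: (@separated_card z) => // y /YE/Ez.
have [||Y [uY sY YE] Ymax] := @exists_maximal_seq _ Q
    (Num.truncn ((packc * (rho / eta)) ^+ d)).
- by split.
- move=> s /QY Qs; rewrite truncn_ge_nat// exprn_ge0// mulr_ge0//.
    by have := packc_ge1; lra.
  by rewrite divr_ge0// ltW// (lt_le_trans eta0).
exists Y; split => //; last exact: QY.
move=> x Ex; apply: contrapT => h.
have xY y : y \in Y -> eta <= enorm (x - y).
  by move=> yY; rewrite leNgt; apply/negP => xy; apply: h; exists y.
apply: (Ymax x); split.
- rewrite /= uY andbT; apply/negP => /xY; rewrite subrr enorm0.
  by rewrite leNgt eta0.
- move=> y y'; rewrite !inE => /predU1P[->|yY] /predU1P[->|y'Y] //.
  + by rewrite eqxx.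
  + by move=> _; exact: xY.
  + by move=> _; rewrite enormBC; exact: xY.
  + exact: sY.
- by move=> y; rewrite inE => /predU1P[->|/YE].
Qed.

Lemma covby_sub (E E' : set 'rV[R]_d) (r r' m m' : R) :
  E `<=` E' -> r' <= r -> m' <= m -> covby E' r' m' -> covby E r m.
Proof.
move=> EE' rr' mm' [s sm h]; exists s; first exact: le_trans mm'.
by move=> x /EE'/h[c cs xc]; exists c => //; exact: lt_le_trans rr'.
Qed.

Lemma covby_ge1 (E : set 'rV[R]_d) (r m : R) : E !=set0 -> covby E r m -> 1 <= m.
Proof.
move=> [x Ex] [s sm /(_ _ Ex)[c cs _]]; apply: le_trans sm.
by rewrite ler1n; case: s cs.
Qed.

Lemma covby_eball x (r : R) : covby (eball x r) r 1.
Proof. by exists [:: x] => // y yx; exists x => //; exact: mem_head. Qed.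

Lemma covbyU (E E' : set 'rV[R]_d) (r m m' : R) :
  covby E r m -> covby E' r m' -> covby (E `|` E') r (m + m').
Proof.
move=> [s sm h] [s' sm' h']; exists (s ++ s').
  by rewrite size_cat natrD lerD.
move=> x [/h|/h'] [c cs xc]; exists c => //; rewrite mem_cat cs ?orbT//.
Qed.

Lemma covby_bigcup (T : eqType) (s : seq T) (E : T -> set 'rV[R]_d) (r : R)
    (m : T -> R) :
  {in s, forall i, covby (E i) r (m i)} ->
  covby [set x | exists2 i, i \in s & E i x] r (\sum_(i <- s) m i).
Proof.
elim: s => [|i s ih] h.
  by rewrite big_nil; exists [::] => // x [].
rewrite big_cons; apply: (@covby_sub _ (E i `|` [set x | exists2 i, i \in s & E i x]) r r _ (m i + \sum_(i <- s) m i)) => //.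
  by move=> x [j]; rewrite inE => /predU1P[->|js] Ejx; [left|right; exists j].
apply: covbyU; first by apply: h; exact: mem_head.
by apply: ih => j js; apply: h; rewrite inE js orbT.
Qed.

Lemma covby_bigcup_const (T : eqType) (s : seq T) (E : T -> set 'rV[R]_d)
    (r m : R) :
  {in s, forall i, covby (E i) r m} ->
  covby [set x | exists2 i, i \in s & E i x] r ((size s)%:R * m).
Proof.
move=> h; apply: covby_sub (covby_bigcup h) => //.
by rewrite big_const_seq count_predT -Monoid.iteropE /= -[X in X <= _]/(m *+ size s) mulr_natl.
Qed.

Lemma covby_bounded (E : set 'rV[R]_d) z (rho eta : R) :
  0 < eta <= rho -> E `<=` eball z rho ->
  covby E eta ((packc * (rho / eta)) ^+ d).
Proof. by move=> er /(separated_net er)[Y [_ _ _ h sY]]; exists Y. Qed.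

Lemma covby_refine (E : set 'rV[R]_d) (k r m : R) :
  1 <= k -> 0 < r -> covby E (k * r) m -> covby E r ((packc * k) ^+ d * m).
Proof.
move=> k1 r0 [s sm h].
apply: (@covby_sub _ [set x | exists2 c, c \in s & eball c (k * r) x] r r _ ((size s)%:R * (packc * k) ^+ d)) => //.
- by rewrite mulrC ler_wpM2l// exprn_ge0// mulr_ge0//; have := packc_ge1; lra.
apply: covby_bigcup_const => c cs.
have := @covby_bounded (eball c (k * r)) c (k * r) r.
by rewrite mulfK ?gt_eqF//; apply => //; rewrite r0/= ler_peMl// ltW.
Qed.

(** Local counting bounds and Lipschitz estimates are available only at points of E, so centres have
    to be moved into E; this doubles the radius. *)
Lemma covby_centers (E : set 'rV[R]_d) (r m : R) : covby E r m ->
  exists2 s : seq 'rV[R]_d, (size s)%:R <= m /\ {in s, forall c, E c} &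
    forall x, E x -> exists2 c, c \in s & enorm (x - c) < 2 * r.
Proof.
move=> [s sm h].
pose g c := xget c [set y | E y /\ enorm (y - c) < r].
have gP c y : E y -> enorm (y - c) < r -> E (g c) /\ enorm (g c - c) < r.
  by move=> Ey yc; rewrite /g; case: xgetP => [_ -> []//|/(_ y)[]].
exists [seq g c | c <- s & `[< E (g c) >]].
  split; last by move=> c /mapP[c']; rewrite mem_filter => /andP[/asboolP ? _ ->].
  by apply: le_trans sm; rewrite size_map ler_nat size_filter count_size.
move=> x Ex; have [c cs xc] := h x Ex; have [Eg gc] := gP c x Ex xc.
exists (g c); first by apply: map_f; rewrite mem_filter cs andbT; apply/asboolP.
by apply: le_lt_trans (enorm_tri _ _ c) _; rewrite (enormBC c); lra.
Qed.

Lemma covby_image (E : set 'rV[R]_d) (f : 'rV[R]_d -> 'rV[R]_d) (L r m : R) :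
  0 < L -> (forall x y, E x -> E y -> enorm (f x - f y) <= L * enorm (x - y)) ->
  covby E r m -> covby (f @` E) (2 * L * r) m.
Proof.
move=> L0 fL /covby_centers[s [sm sE] h]; exists (map f s); first by rewrite size_map.
move=> _ [x Ex <-]; have [c cs xc] := h x Ex; exists (f c); first exact: map_f.
by apply: le_lt_trans (fL _ _ Ex (sE _ cs)) _; rewrite (mulrC 2) -mulrA ltr_pM2l.
Qed.

Lemma covnum_leP (E : set 'rV[R]_d) (r m : R) :
  (covnum r E <= m%:E)%E <-> covby E r m.
Proof.
split=> [h|[s sm h]].
  have m0 : 0 <= m.
    rewrite -lee_fin; apply: le_trans h; apply: le_ereal_inf_tmp => _ [n _ <-].
    by rewrite lee_fin.
  have : (covnum r E < ((Num.truncn m).+1%:R)%:E)%E.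
    apply: le_lt_trans h _; rewrite lte_fin.
    by have /andP[] := truncn_itv m0.
  move=> /ereal_inf_lt[_ [n [c Ec] <-]]; rewrite lte_fin ltr_nat ltnS => nm.
  exists [seq c i | i <- enum 'I_n].
    rewrite size_map size_enum_ord.
    by apply: le_trans (_ : (Num.truncn m)%:R <= m); rewrite ?ler_nat// truncn_le.
  move=> x /Ec[i _ xi]; exists (c i) => //.
  by apply: map_f; rewrite mem_enum.
apply: le_trans (_ : ((size s)%:R%:E <= _)%E); last by rewrite lee_fin.
apply: ereal_inf_lbound; exists (size s) => //.
exists (fun i : 'I_(size s) => tnth (in_tuple s) i) => x /h[c /seq_tnthP[i ->] xc].
by exists i.
Qed.

End Covering.

(** * Counting exponents and dimensions *)

Section Dimensions.
Variables (R : realType) (d : nat).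
Implicit Types (x z : 'rV[R]_d) (E : set 'rV[R]_d).

Definition ebounded E := exists2 z, True & exists2 rho : R, 0 < rho & E `<=` eball z rho.

Lemma covby_radius E (k r m : R) : 1 <= k -> 0 < r -> covby E r m ->
  covby E (r / k) ((packc R d * k) ^+ d * m).
Proof.
move=> k1 r0 h; apply: covby_refine => //; first by rewrite divr_gt0//; lra.
by rewrite mulrC divfK// gt_eqF//; lra.
Qed.

Lemma packck_ge1 (k : R) : 1 <= k -> 1 <= (packc R d * k) ^+ d.
Proof.
move=> k1; apply: exprn_ege1; have := packc_ge1 R d => p1; nra.
Qed.

Lemma covby_centers_same E (r m : R) : 0 < r -> covby E r m ->
  exists2 s : seq 'rV[R]_d, (size s)%:R <= (packc R d * 2) ^+ d * m /\ {in s, forall c, E c} &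
    forall x, E x -> exists2 c, c \in s & enorm (x - c) < r.
Proof.
move=> r0 /(@covby_radius _ 2 _ _ _ r0) h.
have /covby_centers[s hs sE] := h (ler1n _ 2).
by exists s => // x /sE[c cs xc]; exists c => //; move: xc; rewrite mulrC divfK.
Qed.

Lemma ler_of_forall_gt (a b : R) : (forall c, b < c -> a <= c) -> a <= b.
Proof.
by move=> h; rewrite leNgt; apply/negP => ba; have := h ((a + b) / 2); lra.
Qed.

Lemma exponent_le (a b C : R) :
  (forall v, 0 <= v -> expR (a * v) <= C * expR (b * v)) -> a <= b.
Proof.
move=> h; rewrite leNgt; apply/negP => ba.
have C0 : 0 < C.
  by have := h 0 (lexx _); rewrite !mulr0 expR0 mulr1; lra.
(* At this v the hypothesis would give expR C <= C, against expR C >= 1 + C. *)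
pose v := C / (a - b).
have v0 : 0 <= v by rewrite divr_ge0//; lra.
have := h v v0; rewrite -ler_pdivrMr ?expR_gt0// -expRN -expRD.
have -> : a * v - b * v = C by rewrite -mulrBl mulrC divfK// gt_eqF//; lra.
have := expR_ge1Dx C; lra.
Qed.

Definition boxbnd E (t : R) := exists2 C : R, 0 < C &
  forall u, 0 <= u -> covby E (expR (- u)) (C * expR (t * u)).

Definition specbnd (theta : R) E (alpha : R) := exists2 C : R, 0 < C &
  forall x v, E x -> 0 <= v ->
    covby (eball x (expR (- v)) `&` E) (expR (- (theta^-1 * v)))
      (C * expR (alpha * (theta^-1 - 1) * v)).

Definition upspecbnd (phi : R) E (alpha : R) := exists2 C : R, 0 < C &
  forall x u v, E x -> 0 <= v -> phi^-1 * v <= u ->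
    covby (eball x (expR (- v)) `&` E) (expR (- u)) (C * expR (alpha * (u - v))).

(* With r = expR (- u) and R = expR (- v), this is
   N_r(B(x,R) `&` E) <= C r^(-a-e) R^(-b) for all 0 < r <= R <= 1. *)
Definition expbnd E (a b : R) := forall e : R, 0 < e -> exists2 C : R, 0 < C &
  forall x u v, E x -> 0 <= v <= u ->
    covby (eball x (expR (- v)) `&` E) (expR (- u)) (C * expR ((a + e) * u + b * v)).

Lemma powR_expRN (v y : R) : expR (- v) `^ y = expR (- (y * v)).
Proof. by rewrite -expRM mulNr mulrC. Qed.

Lemma assouad_specE (theta : R) E :
  assouad_spec theta E = inf [set alpha | specbnd theta E alpha].
Proof.
rewrite /assouad_spec; congr inf; apply/seteqP; split=> alpha [C C0 h]; exists C => //.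
  move=> x v Ex v0; have := h x (expR (- v)) Ex.
  rewrite expR_gt0/= -[leRHS]expR0 ler_expR oppr_le0 => /(_ v0)/covnum_leP.
  by rewrite !powR_expRN; congr covby; congr (_ * expR _); ring.
move=> x r Ex /andP[r0 r1]; apply/covnum_leP.
have := h x (- ln r) Ex; rewrite oppr_ge0 ln_le0// => /(_ isT).
rewrite opprK lnK//.
have rE : r = expR (- - ln r) by rewrite opprK lnK.
by congr covby; rewrite {2}rE powR_expRN //; congr (_ * expR _); ring.
Qed.

Lemma upper_assouad_specE (phi : R) E : 0 < phi < 1 ->
  upper_assouad_spec phi E = inf [set alpha | upspecbnd phi E alpha].
Proof.
move=> /andP[phi0 phi1].
rewrite /upper_assouad_spec; congr inf; apply/seteqP; split=> alpha [C C0 h]; exists C => //.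
  move=> x u v Ex v0 vu; have := h x (expR (- u)) (expR (- v)) Ex (expR_gt0 _) (expR_gt0 _).
  rewrite !powR_expRN !ler_expR lerN2 => /(_ vu) h1; apply/covnum_leP.
  rewrite mulrC; have -> : expR (alpha * (u - v)) = (expR (- v) / expR (- u)) `^ alpha.
    by rewrite -expRN -expRD -expRM; congr expR; ring.
  rewrite mulrC; apply: h1; last by rewrite -[leRHS]expR0 ler_expR oppr_le0.
  by rewrite lerN2 ler_peMl// invf_ge1// ltW.
move=> x r1 r2 Ex r10 r20 r12 _ r21; apply/covnum_leP.
have r1E : r1 = expR (- - ln r1) by rewrite opprK lnK.
have r2E : r2 = expR (- - ln r2) by rewrite opprK lnK.
have := h x (- ln r1) (- ln r2) Ex; rewrite oppr_ge0 ln_le0// => /(_ isT).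
move: r12; rewrite {1}r1E {1}r2E powR_expRN ler_expR lerN2 => r12 /(_ r12).
rewrite -r1E -r2E; congr covby; congr (_ * _).
by rewrite {2}r1E {2}r2E -expRN -expRD -expRM; congr expR; ring.
Qed.

Lemma ebounded_box E : ebounded E -> boxbnd E d%:R.
Proof.
move=> [z _ [rho rho0 Ez]].
exists ((packc R d * (rho + 1)) ^+ d).
  by rewrite exprn_gt0// mulr_gt0//; have := packc_ge1 R d; lra.
move=> u u0; apply: (@covby_sub _ _ _ (eball z (rho + 1)) (expR (- u)) (expR (- u))
   _ ((packc R d * ((rho + 1) / expR (- u))) ^+ d)) => //.
- by move=> x /Ez; rewrite /eball/=; lra.
- rewrite -expRN opprK mulrA exprMn (_ : expR u ^+ d = expR (d%:R * u))//.
  by rewrite mulrC expRM_natr.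
apply: (@covby_bounded _ _ _ z) => //; rewrite expR_gt0/=.
by apply: (@le_trans _ _ 1); [rewrite -expR0 ler_expR; lra|lra].
Qed.

Lemma expbnd_dim E : expbnd E d%:R (- d%:R).
Proof.
move=> e e0; exists (packc R d ^+ d).
  by rewrite exprn_gt0//; have := packc_ge1 R d; lra.
move=> x u v Ex /andP[v0 vu].
apply: (@covby_sub _ _ _ (eball x (expR (- v))) (expR (- u)) (expR (- u))
   _ ((packc R d * (expR (- v) / expR (- u))) ^+ d)) => //.
- rewrite exprMn ler_wpM2l ?exprn_ge0//; first by have := packc_ge1 R d; lra.
  rewrite -expRN -expRD -expRM_natr ler_expR; nra.
by apply: (@covby_bounded _ _ _ x) => //; rewrite expR_gt0/= ler_expR lerN2.
Qed.

Lemma specbnd_of_expbnd (theta : R) E (a b alpha : R) : 0 < theta < 1 ->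
  expbnd E a b -> (a * theta^-1 + b) / (theta^-1 - 1) < alpha ->
  specbnd theta E alpha.
Proof.
move=> /andP[t0 t1] Eab; have ti : 1 < theta^-1 by rewrite invf_gt1.
rewrite ltr_pdivrMr ?subr_gt0// => al.
(* This e makes the two exponents agree exactly at u = v / theta. *)
have [|C C0 h] := Eab ((alpha * (theta^-1 - 1) - (a * theta^-1 + b)) * theta).
  by rewrite mulr_gt0// subr_gt0.
exists C => // x v Ex v0.
have := h x (theta^-1 * v) v Ex; rewrite v0/= ler_peMl ?(ltW ti)// => /(_ isT).
congr covby; congr (_ * expR _).
by field; rewrite gt_eqF.
Qed.

(** The slack e is chosen for equality on the line u = v / phi. Beyond it alpha (u - v) grows at
    least as fast in u as soon as a + e <= alpha, which is where a + b >= 0 enters. *)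
Lemma upspecbnd_of_expbnd (phi : R) E (a b alpha : R) : 0 < phi < 1 ->
  0 <= a + b ->
  expbnd E a b -> (a * phi^-1 + b) / (phi^-1 - 1) < alpha ->
  upspecbnd phi E alpha.
Proof.
move=> /andP[t0 t1] ab Eab; have ti : 1 < phi^-1 by rewrite invf_gt1.
rewrite ltr_pdivrMr ?subr_gt0// => al.
set e := (alpha * (phi^-1 - 1) - (a * phi^-1 + b)) * phi.
have e0 : 0 < e by rewrite mulr_gt0// subr_gt0.
have [C C0 h] := Eab e e0.
exists C => // x u v Ex v0 vu.
have vv : v <= phi^-1 * v by rewrite ler_peMl ?(ltW ti).
have /h/(_ _) := Ex; move=> /(_ u v); rewrite v0 (le_trans vv vu) => /(_ isT).
apply: covby_sub => //; rewrite ler_wpM2l ?(ltW C0)// ler_expR.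
have -> : b = alpha * (phi^-1 - 1) - (a + e) * phi^-1.
  by rewrite /e; field; rewrite gt_eqF.
have ae : a + e <= alpha.
  have : (a + e + b) = (alpha - (a + e)) * (phi^-1 - 1).
    by rewrite /e; field; rewrite gt_eqF.
  move=> H; have : 0 <= (alpha - (a + e)) * (phi^-1 - 1) by rewrite -H; lra.
  by rewrite pmulr_lge0 ?subr_gt0// subr_ge0.
have -> : (a + e) * u + (alpha * (phi^-1 - 1) - (a + e) * phi^-1) * v =
  alpha * (u - v) - (alpha - (a + e)) * (u - phi^-1 * v) by ring.
by rewrite gerBl mulr_ge0// subr_ge0.
Qed.

Lemma specbnd_of_upspecbnd (theta : R) E (alpha : R) :
  upspecbnd theta E alpha -> specbnd theta E alpha.
Proof.
move=> [C C0 h]; exists C => // x v Ex v0.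
have := h x (theta^-1 * v) v Ex v0 (lexx _).
by congr covby; congr (_ * expR _); ring.
Qed.

Lemma specbnd_mono (theta : R) E (alpha beta : R) : 0 < theta < 1 ->
  alpha <= beta -> specbnd theta E alpha -> specbnd theta E beta.
Proof.
move=> /andP[t0 t1] ab [C C0 h]; exists C => // x v Ex v0.
have := h x v Ex v0; apply: covby_sub => //.
rewrite ler_wpM2l ?(ltW C0)// ler_expR ler_wpM2r// ler_wpM2r// subr_ge0.
by rewrite invf_ge1// ltW.
Qed.

Lemma specbnd_ge0 (theta : R) E (alpha : R) : 0 < theta < 1 -> E !=set0 ->
  specbnd theta E alpha -> 0 <= alpha.
Proof.
move=> /andP[t0 t1] [x Ex] [C C0 h].
have ti : 0 < theta^-1 - 1 by rewrite subr_gt0 invf_gt1.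
rewrite -(pmulr_lge0 _ ti); apply: (@exponent_le _ _ C) => v v0.
rewrite mul0r expR0; apply: covby_ge1 (h x v Ex v0).
by exists x; split => //; rewrite /eball/= subrr enorm0 expR_gt0.
Qed.

Section Spec.
Variables (theta : R) (E : set 'rV[R]_d).
Hypotheses (theta01 : 0 < theta < 1) (E0 : E !=set0).

Lemma specbnd_dim : specbnd theta E (d%:R + 1).
Proof.
apply: (specbnd_of_expbnd theta01 (@expbnd_dim E)).
have /andP[t0 t1] := theta01.
have ti : 0 < theta^-1 - 1 by rewrite subr_gt0 invf_gt1.
by rewrite -[- d%:R]mulrN1 -mulrDr mulfK ?gt_eqF// ltrDl.
Qed.

Lemma spec_has_inf : has_inf [set alpha | specbnd theta E alpha].
Proof.
split; first by exists (d%:R + 1); exact: specbnd_dim.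
by exists 0 => alpha; exact: specbnd_ge0.
Qed.

Lemma spec_le (alpha : R) : specbnd theta E alpha -> assouad_spec theta E <= alpha.
Proof. by move=> h; rewrite assouad_specE; apply: ge_inf => //; case: spec_has_inf. Qed.

Lemma spec_lt (alpha : R) : assouad_spec theta E < alpha -> specbnd theta E alpha.
Proof.
rewrite assouad_specE => /(inf_lt spec_has_inf.1)[beta h /ltW].
by move=> /specbnd_mono; apply.
Qed.

Lemma spec_ge0 : 0 <= assouad_spec theta E.
Proof.
rewrite assouad_specE; apply: lb_le_inf; first by case: spec_has_inf.
by move=> alpha; exact: specbnd_ge0.
Qed.

Lemma spec_le_dim : assouad_spec theta E <= d%:R + 1.
Proof. exact/spec_le/specbnd_dim. Qed.

Lemma spec_le_expbnd (a b : R) : expbnd E a b ->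
  assouad_spec theta E <= (a * theta^-1 + b) / (theta^-1 - 1).
Proof.
by move=> h; apply: ler_of_forall_gt => alpha /(specbnd_of_expbnd theta01 h)/spec_le.
Qed.

Lemma upspec_has_inf : has_inf [set alpha | upspecbnd theta E alpha].
Proof.
split; last by exists 0 => alpha /specbnd_of_upspecbnd; exact: specbnd_ge0.
exists ((d%:R * theta^-1 - d%:R) / (theta^-1 - 1) + 1).
by apply: (upspecbnd_of_expbnd theta01 _ (@expbnd_dim E)); rewrite ?subrr ?ltrDl.
Qed.

Lemma upspec_le_expbnd (a b : R) : 0 <= a + b -> expbnd E a b ->
  upper_assouad_spec theta E <= (a * theta^-1 + b) / (theta^-1 - 1).
Proof.
move=> ab h; rewrite upper_assouad_specE//.
apply: ler_of_forall_gt => alpha /(upspecbnd_of_expbnd theta01 ab h) ha.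
by apply: ge_inf => //; case: upspec_has_inf.
Qed.

Lemma spec_le_upspec : assouad_spec theta E <= upper_assouad_spec theta E.
Proof.
rewrite upper_assouad_specE//; apply: lb_le_inf; first by case: upspec_has_inf.
by move=> alpha /specbnd_of_upspecbnd/spec_le.
Qed.

End Spec.

Lemma boxbnd_mono E (s t : R) : s <= t -> boxbnd E s -> boxbnd E t.
Proof.
move=> st [C C0 h]; exists C => // u u0; apply: covby_sub (h u u0) => //.
by rewrite ler_wpM2l ?(ltW C0)// ler_expR ler_wpM2r.
Qed.

Section Box.
Variable (E : set 'rV[R]_d).
Hypotheses (E0 : E !=set0) (Eb : ebounded E).

Let ratio (r : R) : \bar R := (ln (fine (covnum r E)) / - ln r)%:E.

Let covnumE u : 0 <= u -> exists2 N : R, covnum (expR (- u)) E = N%:E & 1 <= N.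
Proof.
move=> u0; have [C C0 /(_ u u0) h] := ebounded_box Eb.
have /covnum_leP := h.
case H : (covnum (expR (- u)) E) => [N| |] //= NC.
- by exists N => //; apply: (@covby_ge1 _ _ E (expR (- u)) _ E0); apply/covnum_leP; rewrite H.
- have /covnum_leP/(covby_ge1 E0) : (covnum (expR (- u)) E <= 0%:E)%E by rewrite H leNye.
  by rewrite ler10.
Qed.

Let ratioE u N : covnum (expR (- u)) E = N%:E -> ratio (expR (- u)) = (ln N / u)%:E.
Proof. by move=> h; rewrite /ratio h/= expRK opprK. Qed.

Let dimB_ge (V : set R) : 0^'+ V -> (0 <= ereal_sup [set ratio x | x in V])%E.
Proof.
move=> V0.
have [r [Vr r0 r1]] : exists r : R, [/\ V r, 0 < r & r < 1].
  have : \forall r \near 0^'+, [/\ V r, 0 < r & r < 1 :> R].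
    near=> r; split; near: r => //; first exact: nbhs_right_gt.
    exact: nbhs_right_lt.
  by move=> /(@filter_ex _ (0^'+ : set_system R) _)[r rP]; exists r.
apply: (@le_trans _ _ (ratio r)); last by apply: ereal_sup_ubound; exists r.
have [|N NE N1] := @covnumE (- ln r); first by rewrite oppr_ge0 ln_le0 ?ltW.
have -> : r = expR (- - ln r) by rewrite opprK lnK.
by rewrite (ratioE NE) lee_fin divr_ge0// ?ln_ge0// oppr_ge0 ln_le0 ?ltW.
Unshelve. all: by end_near.
Qed.

Let limsup := limf_esup ratio (0^'+).

Let limsup_ge0 : (0 <= limsup)%E.
Proof.
rewrite /limsup limf_esupE; apply: le_ereal_inf_tmp => _ [V V0 <-].
exact: dimB_ge.
Qed.

Let limsup_le (t : R) : (forall t', t < t' -> boxbnd E t') -> (limsup <= t%:E)%E.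
Proof.
move=> h; apply/lee_addgt0Pr => e e0; rewrite -EFinD.
have [|C C0 hC] := h (t + e / 2); first by lra.
(* Beyond U the constant C is invisible: |ln C| / u <= e / 2. *)
pose U := 2 * `|ln C| / e + 1.
have U0 : 0 < U.
  by apply: ltr_wpDl => //; rewrite divr_ge0 ?(ltW e0)// mulr_ge0.
rewrite /limsup limf_esupE; apply: ge_ereal_inf.
exists (ereal_sup [set ratio r | r in [set r : R | 0 < r < expR (- U)]]).
  exists [set r : R | 0 < r < expR (- U)] => //=.
  near=> r; apply/andP; split; near: r; first exact: nbhs_right_gt.
  by apply: nbhs_right_lt; exact: expR_gt0.
apply: ge_ereal_sup => _ [r /= /andP[r0 rU] <-].
have rE : r = expR (- - ln r) by rewrite opprK lnK.
set u := - ln r in rE.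
have uU : U < u by move: rU; rewrite rE ltr_expR ltrN2.
have u0 : 0 < u by exact: lt_trans uU.
have [N NE N1] := @covnumE u (ltW u0).
rewrite rE (ratioE NE) lee_fin ler_pdivrMr//.
have /covnum_leP := hC u (ltW u0); rewrite NE lee_fin => NC.
apply: (@le_trans _ _ (ln (C * expR ((t + e / 2) * u)))).
  rewrite ler_ln ?posrE//; last by rewrite mulr_gt0 ?expR_gt0.
  exact: lt_le_trans N1.
rewrite lnM ?posrE ?expR_gt0// expRK.
have : `|ln C| <= e / 2 * u.
  have : 2 * `|ln C| / e <= u by move: uU; rewrite /U; lra.
  by rewrite ler_pdivrMr//; lra.
have := ler_norm (ln C); lra.
Unshelve. all: by end_near.
Qed.

(** [dimB] takes [fine] of an upper limit; the crude exponent d of bounded sets makes that limit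
    finite, so nothing is lost. *)
Let limsup_fin : limsup = (dimB E)%:E.
Proof.
rewrite /dimB -/limsup fineK// ge0_fin_numE//.
apply: le_lt_trans (limsup_le _) (ltry d%:R) => t' /ltW /boxbnd_mono; apply.
exact: ebounded_box.
Qed.

Lemma dimB_ge0 : 0 <= dimB E.
Proof. by rewrite -lee_fin -limsup_fin. Qed.

Lemma dimB_le (t : R) : (forall t', t < t' -> boxbnd E t') -> dimB E <= t.
Proof. by move=> /limsup_le; rewrite limsup_fin lee_fin. Qed.

(** For small radii the upper limit gives the bound with constant 1; for u below the threshold U the
    cover at scale U is reused, at the price of the constant expR (t U). *)
Lemma dimB_lt (t : R) : dimB E < t -> boxbnd E t.
Proof.
move=> Bt; have t0 : 0 < t by apply: le_lt_trans Bt; exact: dimB_ge0.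
have : (limsup < t%:E)%E by rewrite limsup_fin lte_fin.
rewrite /limsup limf_esupE => /ereal_inf_lt[_ [V V0 <-] Vt].
have [del del0 Vdel] : exists2 del : R, 0 < del & forall r, 0 < r < del -> V r.
  have [del /= del0 Vd] := V0; exists del => // r /andP[r0 rd]; apply: Vd => //=.
  by rewrite sub0r normrN gtr0_norm.
pose U := Num.max 1 (1 - ln del).
have U1 : 1 <= U by rewrite le_max lexx.
have bnd u : U <= u -> covby E (expR (- u)) (1 * expR (t * u)).
  move=> Uu; have u0 : 0 < u by lra.
  have [N NE N1] := @covnumE u (ltW u0).
  apply/covnum_leP; rewrite NE lee_fin mul1r.
  have : (ratio (expR (- u)) <= ereal_sup [set ratio x | x in V])%E.
    apply: ereal_sup_ubound; exists (expR (- u)) => //; apply: Vdel.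
    rewrite expR_gt0/= -[ltRHS]lnK ?posrE// ltr_expR.
    have : 1 - ln del <= U by rewrite le_max lexx orbT.
    lra.
  move=> /le_lt_trans /(_ Vt); rewrite (ratioE NE) lte_fin ltr_pdivrMr// => h.
  by rewrite -[leLHS]lnK ?posrE; [rewrite ler_expR ltW|lra].
exists (expR (t * U)); first exact: expR_gt0.
move=> u u0; have [Uu|uU] := leP U u.
  apply: covby_sub (bnd u Uu) => //.
  rewrite ler_wpM2r ?expR_ge0// -[leLHS]expR0 ler_expR; nra.
apply: covby_sub (bnd U (lexx _)) => //; first by rewrite ler_expR; lra.
rewrite mul1r ler_peMr ?expR_ge0// -[leLHS]expR0 ler_expR; nra.
Qed.

End Box.

(** The smaller of two exponents is at most any convex combination of them; C1 + C2 serves as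
    constant in both cases. *)
Lemma expbnd_convex E (a1 b1 a2 b2 t : R) : 0 <= t <= 1 ->
  expbnd E a1 b1 -> expbnd E a2 b2 ->
  expbnd E (t * a1 + (1 - t) * a2) (t * b1 + (1 - t) * b2).
Proof.
move=> /andP[t0 t1] h1 h2 e e0; have [C1 C10 H1] := h1 e e0.
have [C2 C20 H2] := h2 e e0; exists (C1 + C2); first by lra.
move=> x u v Ex uv; have := H1 x u v Ex uv; have := H2 x u v Ex uv.
have uv' := uv; move: uv' => /andP[v0 vu].
have [le12|lt21] := leP ((a1 + e) * u + b1 * v) ((a2 + e) * u + b2 * v).
  move=> _; apply: covby_sub => //; apply: ler_pM; rewrite ?expR_ge0// ?(ltW C10)//; first by lra.
  by rewrite ler_expR; nra.
move=> + _; apply: covby_sub => //; apply: ler_pM; rewrite ?expR_ge0// ?(ltW C20)//; first by lra.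
by rewrite ler_expR; nra.
Qed.

Lemma expbnd_raise E (a a' : R) : a <= a' -> expbnd E a (- a) -> expbnd E a' (- a').
Proof.
move=> aa' h e e0; have [C C0 H] := h e e0; exists C => // x u v Ex uv.
apply: covby_sub (H x u v Ex uv) => //; rewrite ler_wpM2l ?(ltW C0)// ler_expR.
have /andP[v0 vu] := uv; nra.
Qed.

(** Two-scale covering: recentring the r-balls in E costs the factor (2 packc)^d, then each of them
    is covered at scale rho by the local bound. *)
Lemma covby_localize E (F : 'rV[R]_d -> set 'rV[R]_d) (r rho m k : R) :
  0 < r -> 0 <= k -> covby E r m ->
  (forall c, E c -> covby (eball c r `&` E) rho k) ->
  covby E rho ((packc R d * 2) ^+ d * m * k).
Proof.
move=> r0 k0 /(covby_centers_same r0)[s [sm sE] h] H.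
apply: (@covby_sub _ _ _ [set x | exists2 c, c \in s & (eball c r `&` E) x] rho rho
  _ ((size s)%:R * k)) => //.
- by move=> x Ex; have [c cs xc] := h x Ex; exists c.
- by rewrite ler_wpM2r.
by apply: covby_bigcup_const => c /sE; exact: H.
Qed.

(** Covering E at scale r^theta and then locally at scale r improves a box exponent t to t theta + s
    (1 - theta). Letting t tend to dim_B E gives dim_B E <= theta dim_B E + (1 - theta) s. *)
Lemma dimB_le_spec (theta : R) E : 0 < theta < 1 -> E !=set0 -> ebounded E ->
  dimB E <= assouad_spec theta E.
Proof.
move=> th E0 Eb; have /andP[t0 t1] := th.
apply: ler_of_forall_gt => s /(spec_lt th E0)[C C0 hs].
have key t : dimB E < t -> dimB E <= t * theta + s * (1 - theta).
  move=> /(dimB_lt E0 Eb)[C' C'0 ht]; apply: (dimB_le E0 Eb) => t' tt'.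
  apply: boxbnd_mono (ltW tt') _.
  exists ((packc R d * 2) ^+ d * C' * C).
    by rewrite !mulr_gt0 ?exprn_gt0// mulr_gt0//; have := packc_ge1 R d; lra.
  move=> u u0; have v0 : 0 <= theta * u by rewrite mulr_ge0// ltW.
  have := @covby_localize E (fun=> E) (expR (- (theta * u))) (expR (- u))
    (C' * expR (t * (theta * u))) (C * expR (s * (theta^-1 - 1) * (theta * u))).
  rewrite expR_gt0 mulr_ge0 ?expR_ge0 ?(ltW C0)// => /(_ isT isT (ht _ v0)) H.
  apply: covby_sub (H _) => //.
    have -> : (t * theta + s * (1 - theta)) * u =
        t * (theta * u) + s * (theta^-1 - 1) * (theta * u).
      by field; rewrite gt_eqF.
    by rewrite expRD le_eqVlt; apply/orP; left; apply/eqP; ring.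
  move=> c Ec; have := hs c (theta * u) Ec v0.
  by rewrite mulKf ?gt_eqF//.
suff : dimB E * (1 - theta) <= s * (1 - theta) by rewrite ler_pM2r// subr_gt0.
suff : dimB E <= dimB E * theta + s * (1 - theta) by lra.
apply: ler_of_forall_gt => c hc.
pose t := dimB E + (c - (dimB E * theta + s * (1 - theta))) / theta.
apply: le_trans (key t _) _.
  by rewrite ltrDl divr_gt0// subr_gt0.
by rewrite /t mulrDl divfK ?gt_eqF//; lra.
Qed.

(** Passing n times from a radius to its power 1 / theta multiplies the bounds; the exponents
    (theta^-1 - 1) theta^-k telescope. *)
Lemma specbnd_iter (theta : R) E (s : R) (n : nat) : 0 < theta < 1 ->
  specbnd theta E s -> exists2 C : R, 0 < C &
  forall x v, E x -> 0 <= v ->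
    covby (eball x (expR (- v)) `&` E) (expR (- (theta^-1 ^+ n * v)))
      (C * expR (s * (theta^-1 ^+ n - 1) * v)).
Proof.
move=> /andP[t0 t1] [C C0 h]; elim: n => [|n [D D0 ih]].
  exists 1 => // x v Ex v0.
  rewrite expr0 subrr mulr0 mul0r expR0 !mul1r.
  by apply: (covby_sub _ _ _ (covby_eball x _)) => // y [].
exists ((packc R d * 2) ^+ d * D * C).
  by rewrite !mulr_gt0 ?exprn_gt0// mulr_gt0//; have := packc_ge1 R d; lra.
move=> x v Ex v0; have w0 : 0 <= theta^-1 ^+ n * v.
  by rewrite mulr_ge0// exprn_ge0// invr_ge0 ltW.
have := @covby_localize (eball x (expR (- v)) `&` E) (fun=> E) _
   (expR (- (theta^-1 ^+ n.+1 * v))) _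
   (C * expR (s * (theta^-1 - 1) * (theta^-1 ^+ n * v)))
   (expR_gt0 _) _ (ih x v Ex v0).
rewrite mulr_ge0 ?expR_ge0 ?(ltW C0)// => /(_ isT) H.
apply: covby_sub (H _) => //.
  rewrite (_ : s * (theta^-1 ^+ n.+1 - 1) * v =
      s * (theta^-1 ^+ n - 1) * v + s * (theta^-1 - 1) * (theta^-1 ^+ n * v)).
    by rewrite expRD le_eqVlt; apply/orP; left; apply/eqP; ring.
  by rewrite exprS; ring.
move=> c [_ Ec]; apply: covby_sub (h c _ Ec w0) => //.
  by move=> y [yc [_ Ey]].
by rewrite exprS mulrA.
Qed.

Lemma ler_exp1D (x : R) n : 0 <= x -> 1 + x *+ n <= (1 + x) ^+ n.
Proof.
move=> x0; elim: n => [|n ih]; first by rewrite mulr0n addr0 expr0.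
rewrite exprS mulrSr; apply: (@le_trans _ _ ((1 + x) * (1 + x *+ n))).
  by rewrite mulrDl mul1r; have : 0 <= x * (x *+ n); [rewrite mulr_ge0// mulrn_wge0|lra].
by rewrite ler_wpM2l//; lra.
Qed.

(** Iterating the bound for theta reaches the scale ratio of theta0 with little waste when theta is
    near 1: the factor on the left tends to 1. This takes the part of monotonicity in theta. *)
Lemma spec_compare (theta0 theta : R) E : 0 < theta0 < 1 -> 0 < theta < 1 -> E !=set0 ->
  assouad_spec theta0 E * (1 - (1 - theta) / (1 - theta0)) <= assouad_spec theta E.
Proof.
move=> th0 th E0; have /andP[p0 p1] := th0; have /andP[t0 t1] := th.
apply: ler_of_forall_gt => s /(spec_lt th E0) hs.
have s0 := specbnd_ge0 th E0 hs.
have ti1 : 1 < theta^-1 by rewrite invf_gt1.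
have pi1 : 1 < theta0^-1 by rewrite invf_gt1.
(* The least n with theta^-n >= 1 / theta0 overshoots by at most one factor 1 / theta. *)
have [n [hn1 hn2]] : exists n, theta0^-1 <= theta^-1 ^+ n /\ theta^-1 ^+ n <= (theta0 * theta)^-1.
  have ex : exists n, theta0^-1 <= theta^-1 ^+ n.
    exists (Num.truncn (theta0^-1 / (theta^-1 - 1))).+1.
    have : 1 + (theta^-1 - 1) *+ (Num.truncn (theta0^-1 / (theta^-1 - 1))).+1 <= theta^-1 ^+ (Num.truncn (theta0^-1 / (theta^-1 - 1))).+1.
      rewrite -[X in _ <= X ^+ _](subrKC 1 theta^-1).
      by apply: ler_exp1D; lra.
    apply: le_trans; rewrite -mulr_natr.
    have := truncnS_gt (theta0^-1 / (theta^-1 - 1)).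
    rewrite ltr_pdivrMr; last by lra.
    lra.
  case: (ex_minnP ex) => n hn nmin; exists n; split => //.
  case: n hn nmin => [|n] hn nmin.
    by rewrite expr0 invf_ge1 ?mulr_gt0// mulr_ile1// ltW.
  have : theta^-1 ^+ n < theta0^-1.
    by rewrite ltNge; apply/negP => /nmin; rewrite ltnn.
  by move=> /ltW h; rewrite exprS invfM mulrC ler_wpM2r// invr_ge0 ltW.
have [C C0 h] := specbnd_iter n th hs.
have k0 : 0 < theta0^-1 - 1 by lra.
have : specbnd theta0 E (s * ((theta0 * theta)^-1 - 1) / (theta0^-1 - 1)).
  exists C => // x v Ex v0; apply: covby_sub (h x v Ex v0) => //.
    by rewrite ler_expR lerN2 ler_wpM2r.
  rewrite ler_wpM2l ?(ltW C0)// ler_expR ler_wpM2r// divfK ?gt_eqF//.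
  by rewrite ler_wpM2l// lerB.
move=> /(spec_le th0 E0); rewrite ler_pdivlMr// => H.
have a0 := spec_ge0 th0 E0.
set a := assouad_spec theta0 E in H a0 *.
have H' : a * ((1 - theta0) * theta) <= s * (1 - theta0 * theta).
  have -> : a * ((1 - theta0) * theta) = a * (theta0^-1 - 1) * (theta0 * theta).
    by field; rewrite gt_eqF.
  have -> : s * (1 - theta0 * theta) = s * ((theta0 * theta)^-1 - 1) * (theta0 * theta).
    by field; rewrite !gt_eqF.
  by rewrite ler_wpM2r// mulr_ge0 ?ltW.
have -> : a * (1 - (1 - theta) / (1 - theta0)) = a * (theta - theta0) / (1 - theta0).
  by field; rewrite subr_eq0 gt_eqF.
rewrite ler_pdivrMr ?subr_gt0//.
rewrite -(@ler_pM2r _ (1 - theta0 * theta)); last by rewrite subr_gt0 mulr_ilt1 ?ltW.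
have q0 : 0 < theta0 * theta by rewrite mulr_gt0.
have q1 : theta0 * theta < 1 by rewrite mulr_ilt1 ?ltW.
apply: (@le_trans _ _ (a * ((1 - theta0) * theta) * (1 - theta0))); last first.
  by rewrite [X in _ <= X]mulrAC ler_wpM2r//; lra.
rewrite -!mulrA ler_wpM2l//.
(* Indeed theta (1 - theta0)^2 - (theta - theta0) (1 - theta0 theta) = theta0 (1 - theta)^2. *)
suff : 0 <= theta0 * (1 - theta) ^+ 2 by nra.
by rewrite mulr_ge0 ?sqr_ge0// ltW.
Qed.

(** The limit defining [dimqA] exists and is the supremum of the spectrum over (0, 1): by
    [spec_compare] the spectrum near 1 stays above any value it has taken, up to an arbitrarily
    small error. *)
Lemma spec_le_dimqA (theta : R) E : 0 < theta < 1 -> E !=set0 ->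
  assouad_spec theta E <= dimqA E.
Proof.
move=> th E0.
pose A := [set assouad_spec t E | t in [set t : R | 0 < t < 1]].
have supA : has_sup A.
  split; first by exists (assouad_spec theta E), theta.
  by exists (d%:R + 1) => _ [t ht <-]; exact: spec_le_dim.
suff -> : dimqA E = sup A by apply: sup_upper_bound => //; exists theta.
apply/cvg_lim => //; apply/cvgrPdist_le => e e0.
have [|_ [t0 /= ht0 <-] h0] := @sup_adherent _ A (e / 2) _ supA; first by lra.
have /andP[p0 p1] := ht0.
pose D : R := d%:R + 1.
have D0 : 0 < D by rewrite ltr_wpDl.
near=> t.
have ht : 0 < t < 1.
  apply/andP; split; near: t; first by apply: nbhs_left_gt.
  exact: nbhs_left_lt.
have tn : 1 - (1 - t0) * (e / 2) / D < t.
  near: t; apply: nbhs_left_gt.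
  by rewrite ltrBlDr ltrDl divr_gt0// mulr_gt0//; lra.
have uA : assouad_spec t E <= sup A by apply: sup_upper_bound => //; exists t.
rewrite ger0_norm ?subr_ge0//.
have := spec_compare ht0 ht E0.
have h0' := h0; have a0 := spec_ge0 ht0 E0; have aD := spec_le_dim ht0 E0.
move: (assouad_spec t0 E) h0' a0 aD => a h0' a0 aD.
have : a * ((1 - t) / (1 - t0)) <= e / 2.
  rewrite mulrA ler_pdivrMr ?subr_gt0//.
  apply: (@le_trans _ _ (D * (1 - t))).
    by rewrite ler_wpM2r// subr_ge0; case/andP: ht => _ /ltW.
  rewrite mulrC -ler_pdivlMr// mulrC; lra.
rewrite mulrBr mulr1; lra.
Unshelve. all: by end_near.
Qed.

(** Each theta comes with its own constant, while [expbnd] asks for one constant for all u >= v. The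
    ratio u / v is discretised with mesh eta up to a large bound; beyond that bound v is negligible
    against u and the box exponent takes over. *)
Lemma expbnd_of_spec E (a b : R) : E !=set0 -> ebounded E ->
  (forall theta, 0 < theta < 1 ->
    assouad_spec theta E * (theta^-1 - 1) <= a * theta^-1 + b) ->
  dimB E <= a -> expbnd E a b.
Proof.
move=> E0 Eb hs hB e e0.
have a0 : 0 <= a by apply: le_trans (dimB_ge0 E0 Eb) hB.
(* Rounding u / v up to the grid costs a eta v in the exponent and the strict inequality for the
   spectrum another eta v; together this is e v / 2. *)
pose eta := e / (2 * (a + 1)).
have eta0 : 0 < eta by rewrite divr_gt0// mulr_gt0//; lra.
have etaE : eta * (a + 1) = e / 2 by rewrite /eta; field; rewrite gt_eqF//; lra.
have grid J : exists2 C : R, 0 < C & forall x u v, E x -> 0 <= v <= u ->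
    u < (1 + eta *+ J) * v ->
    covby (eball x (expR (- v)) `&` E) (expR (- u)) (C * expR ((a + e) * u + b * v)).
  elim: J => [|J [C C0 ih]].
    by exists 1 => // x u v _ /andP[_ vu]; rewrite mulr0n addr0 mul1r ltNge vu.
  pose tau := 1 + eta *+ J.+1.
  have tau1 : 1 < tau by rewrite /tau ltrDl mulrn_wgt0.
  have th : 0 < tau^-1 < 1 by rewrite invr_gt0 invf_lt1 ?tau1 ?andbT ?(lt_trans _ tau1).
  have [|D D0 hD] := @spec_lt tau^-1 E th E0 ((a * tau + b + eta) / (tau - 1)).
    by rewrite ltr_pdivlMr ?subr_gt0//; have := hs _ th; rewrite !invrK; lra.
  exists (C + D); first by lra.
  move=> x u v Ex uv utau; have [uJ|Ju] := ltP u ((1 + eta *+ J) * v).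
    apply: covby_sub (ih x u v Ex uv uJ) => //.
    by rewrite ler_wpM2r ?expR_ge0//; lra.
  have /andP[v0 vu] := uv.
  apply: covby_sub (hD x v Ex v0) => //; rewrite invrK.
    by rewrite ler_expR lerN2 ltW.
  apply: ler_pM; rewrite ?expR_ge0 ?(ltW D0)//; first by lra.
  rewrite ler_expR divfK ?gt_eqF ?subr_gt0//.
  have : tau * v <= u + eta * v by move: Ju; rewrite /tau mulrSr; lra.
  move: etaE; nra.
have [|D D0 hD] := @dimB_lt E E0 Eb (a + eta); first by lra.
(* Past the last grid ratio, |b| v <= e u / 2. *)
pose J := (Num.truncn (2 * `|b| / e / eta)).+1.
have [C C0 hC] := grid J.
exists (C + D); first by lra.
move=> x u v Ex uv; have [uJ|Ju] := ltP u ((1 + eta *+ J) * v).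
  apply: covby_sub (hC x u v Ex uv uJ) => //.
  by rewrite ler_wpM2r ?expR_ge0//; lra.
have /andP[v0 vu] := uv; have u0 : 0 <= u by exact: le_trans vu.
apply: covby_sub (hD u u0) => //.
apply: ler_pM; rewrite ?expR_ge0 ?(ltW D0)//; first by lra.
rewrite ler_expR.
have : `|b| * v <= e / 2 * u.
  have : 2 * `|b| / e <= eta *+ J.
    have := truncnS_gt (2 * `|b| / e / eta); rewrite -/J.
    by rewrite ltr_pdivrMr// (mulr_natl eta) => /ltW.
  rewrite ler_pdivrMr// => H.
  have Jv : eta *+ J * v <= u by move: Ju; rewrite mulrDl mul1r; lra.
  have := ler_wpM2r v0 H; have := ler_wpM2l (ltW e0) Jv; lra.
have : eta <= e / 2 by rewrite -etaE; nra.
have := ler_norm (- b); rewrite normrN; nra.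
Qed.

End Dimensions.

(** * Hausdorff null sets and Bernoulli measures *)

Section Hausdorff.
Variables (R : realType) (d : nat).
Implicit Types (E U : set 'rV[R]_d).

Lemma diam_le U (r : R) : U !=set0 ->
  (forall x y, U x -> U y -> enorm (x - y) <= r) -> diam U <= r.
Proof.
move=> [z Uz] h; apply: ge_sup; first by exists (enorm (z - z)), (z, z).
by move=> _ [[x y] [/= Ux Uy] <-]; exact: h.
Qed.

Lemma le_diam U (r : R) x y : (forall x y, U x -> U y -> enorm (x - y) <= r) ->
  U x -> U y -> enorm (x - y) <= diam U.
Proof.
move=> h Ux Uy; apply: ub_le_sup; last by exists (x, y).
by exists r => _ [[x' y'] [/= Ux' Uy'] <-]; exact: h.
Qed.

Lemma diam_pow_ge0 (s : R) U : 0 <= diam_pow s U.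
Proof. by rewrite /diam_pow; case: ifPn => // _; exact: powR_ge0. Qed.

Lemma hausdorff_premeasure_ge0 (s delta : R) E :
  (0 <= hausdorff_premeasure s delta E)%E.
Proof.
apply: le_ereal_inf_tmp => _ [U _ <-]; apply: nneseries_ge0 => k _ _.
by rewrite lee_fin diam_pow_ge0.
Qed.

Lemma hausdorff_measure_boxbnd E (s t : R) : 0 <= t < s -> boxbnd E t ->
  hausdorff_measure s E = 0%E.
Proof.
move=> /andP[t0 ts] [C C0 hC].
apply/eqP; rewrite eq_le; apply/andP; split; last first.
  apply: le_trans (hausdorff_premeasure_ge0 s 1 E) _.
  by apply: ereal_sup_ubound; exists 1 => //=; exact: ltr01.
apply: ge_ereal_sup => _ [delta /= delta0 <-].
apply/lee_addgt0Pr => e e0; rewrite add0e.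
(* The radius expR (- u) is so small that all diameters are at most delta and the total C expR (t u)
   (2 expR (- u))^s is at most e. *)
pose u := Num.max 0 (Num.max (ln (2 / delta)) (ln (C * 2 `^ s / e) / (s - t))).
have u0 : 0 <= u by rewrite le_max lexx.
have u1 : 2 * expR (- u) <= delta.
  rewrite expRN ler_pdivrMr ?expR_gt0// mulrC -ler_pdivrMr//.
  rewrite -[leLHS]lnK ?posrE ?divr_gt0// ler_expR.
  by rewrite /u le_max le_max lexx orbT.
have u2 : C * expR (t * u) * (2 * expR (- u)) `^ s <= e.
  rewrite powRM ?expR_ge0// powR_expRN.
  have -> : C * expR (t * u) * (2 `^ s * expR (- (s * u))) =
      (C * 2 `^ s) * expR (- ((s - t) * u)).
    have -> : - ((s - t) * u) = t * u + - (s * u) by ring.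
    by rewrite expRD; ring.
  rewrite expRN ler_pdivrMr ?expR_gt0// [leRHS]mulrC -ler_pdivrMr//.
  rewrite -[leLHS]lnK ?posrE ?divr_gt0 ?mulr_gt0 ?powR_gt0// ler_expR.
  rewrite [leRHS]mulrC -ler_pdivrMr ?subr_gt0//.
  by rewrite /u !le_max lexx !orbT.
have [sq sqC hsq] := hC u u0.
pose r := expR (- u).
(* The finite cover is padded with empty sets, on which [diam_pow] is 0. *)
pose U k : set 'rV[R]_d := if (k < size sq)%N then eball (nth 0 sq k) r else set0.
have Ud k x y : U k x -> U k y -> enorm (x - y) <= 2 * r.
  rewrite /U; case: ifP => // _; rewrite /eball/= => h1 h2.
  apply: le_trans (enorm_tri _ _ (nth 0 sq k)) _.
  by rewrite (enormBC _ y); lra.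
apply: le_trans (_ : (\sum_(0 <= k <oo) (diam_pow s (U k))%:E <= _)%E).
  apply: ereal_inf_lbound; exists U => //; split.
    move=> x /hsq[c cs xc]; exists (index c sq) => //.
    by rewrite /U index_mem cs nth_index.
  by move=> k x y Ux Uy; apply: le_trans (Ud k x y Ux Uy) _.
rewrite (nneseries_split _ (size sq)); last by move=> k _; rewrite lee_fin diam_pow_ge0.
rewrite (@eseries0 _ _ (0 + size sq)); last first.
  move=> i; rewrite add0n => si _; rewrite /U ltnNge si/= /diam_pow.
  by rewrite eqxx.
rewrite adde0 add0n sumEFin lee_fin; apply: le_trans u2.
apply: (@le_trans _ _ (\sum_(0 <= i < size sq) (2 * r) `^ s)); last first.
  by rewrite big_const_nat subn0 iter_addr_0 -[_ *+ size sq]mulr_natl ler_wpM2r// powR_ge0.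
apply: ler_sum => k _; rewrite /diam_pow; case: ifPn => [_|/set0P U0].
  exact: powR_ge0.
have dU := diam_le U0 (Ud k).
apply: ge0_ler_powR; rewrite ?nnegrE//; first lra.
  have [x Ux] := U0; apply: le_trans (le_diam (Ud k) Ux Ux).
  by rewrite subrr enorm0.
by rewrite mulr_ge0 ?expR_ge0.
Qed.

Lemma dimH_le_dimB E : E !=set0 -> ebounded E -> dimH E <= dimB E.
Proof.
move=> E0 Eb; have B0 := dimB_ge0 E0 Eb.
apply: ler_of_forall_gt => s Bs; apply: ge_inf.
  by exists 0 => x [].
split; first exact: le_trans (ltW Bs).
apply: (@hausdorff_measure_boxbnd _ _ ((dimB E + s) / 2)); first by apply/andP; split; lra.
by apply: dimB_lt => //; lra.
Qed.

Lemma dimH_lt E (t : R) : E !=set0 -> ebounded E -> dimH E < t ->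
  exists2 s, 0 <= s < t & hausdorff_measure s E = 0%E.
Proof.
move=> E0 Eb; rewrite /dimH => /inf_lt[|s [s0 hs] st]; last by exists s; rewrite ?s0.
exists (d%:R + 1); split; first by rewrite addr_ge0.
by apply: hausdorff_measure_boxbnd (ebounded_box Eb); rewrite ler0n/= ltrDl.
Qed.

Lemma dimH_ge0 E : E !=set0 -> ebounded E -> 0 <= dimH E.
Proof.
move=> E0 Eb; apply: lb_le_inf; last by move=> s [].
exists (d%:R + 1); split; first by rewrite addr_ge0.
by apply: hausdorff_measure_boxbnd (ebounded_box Eb); rewrite ler0n/= ltrDl.
Qed.

(* Covers are replaced by balls whose radii may be raised slightly, so that
   singletons cost nothing. *)
Lemma hausdorff_null_balls E (s t e : R) : 0 <= s < t -> 0 < e ->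
  hausdorff_measure s E = 0%E ->
  exists u : nat -> 'rV[R]_d * R,
    [/\ forall k, 0 <= (u k).2,
        E `<=` \bigcup_k eball (u k).1 (expR (- (u k).2)) &
        (\sum_(0 <= k <oo) (expR (- (t * (u k).2)))%:E <= e%:E)%E].
Proof.
move=> /andP[s0 st] e0 E0; have t0 : 0 < t by lra.
have p2 : 0 < 2 `^ t :> R by rewrite powR_gt0.
pose e1 : R := e / (2 `^ t + 1).
have e10 : 0 < e1 by rewrite divr_gt0//; lra.
have : (hausdorff_premeasure s 2^-1 E < e1%:E)%E.
  apply: le_lt_trans (_ : (0%:E < _)%E); last by rewrite lte_fin.
  by rewrite (_ : 0%:E = hausdorff_measure s E)//; apply: ereal_sup_ubound; exists 2^-1 => //=; lra.
move=> /ereal_inf_lt[_ [U [EU Ud] <-] /ltW Ue].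
pose eps k : R := Num.min 1 (e1 / (2 ^ k.+1)%:R).
have eps0 k : 0 < eps k by rewrite lt_min ltr01/= divr_gt0// ltr0n expn_gt0.
(* A ball of radius twice the diameter around a point of [U k] contains [U k]. For zero diameter the
   radius is chosen with t-th power [eps k], and these are summable. *)
pose rad k : R := if 0 < diam (U k) then 2 * diam (U k) else eps k `^ t^-1.
have rad0 k : 0 < rad k.
  by rewrite /rad; case: ifP => [?|_]; [rewrite mulr_gt0|exact: powR_gt0].
have rad1 k : U k !=set0 -> rad k <= 1.
  move=> Uk0; rewrite /rad; case: ifP => _.
    by have := diam_le Uk0 (Ud k); lra.
  rewrite /powR gt_eqF// -[leRHS]expR0 ler_expR mulr_ge0_le0 ?invr_ge0 ?(ltW t0)//.
  by rewrite ln_le0// ge_min lexx.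
exists (fun k => if `[< U k !=set0 >] then (xget 0 (U k), - ln (rad k)) else
  (0, - ln (eps k) / t)); split.
- move=> k; case: asboolP => [Uk0|_]/=; first by rewrite oppr_ge0 ln_le0 ?rad1.
  by rewrite divr_ge0 ?(ltW t0)// oppr_ge0 ln_le0// ge_min lexx.
- move=> x /EU[k _ Ukx]; exists k => //=.
  have Uk0 : U k !=set0 by exists x.
  case: asboolP => // _ /=; rewrite opprK lnK ?posrE// /eball/=.
  have := le_diam (Ud k) Ukx (xgetI 0 Ukx).
  rewrite /rad; case: (ltP 0 (diam (U k))) => d0 dx; first by lra.
  by apply: le_lt_trans (le_trans dx d0) _; exact: powR_gt0.
- apply: (@le_trans _ _ (\sum_(0 <= k <oo) ((2 `^ t * diam_pow s (U k))%:E + (e1 / (2 ^ k.+1)%:R)%:E))%E).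
    apply: lee_nneseries => [k _ _|k _]; first by rewrite lee_fin expR_ge0.
    rewrite -EFinD lee_fin.
    have E1 (x : R) : 0 < x -> expR (- (t * - ln x)) = x `^ t.
      by move=> x0; rewrite mulrN opprK /powR gt_eqF.
    have E2 : 0 <= 2 `^ t * diam_pow s (U k) by rewrite mulr_ge0 ?diam_pow_ge0 ?ltW.
    have E3 : eps k <= e1 / (2 ^ k.+1)%:R by rewrite ge_min lexx orbT.
    case: asboolP => [Uk0|_]/=; last first.
      by rewrite mulrC divfK ?gt_eqF// opprK lnK ?posrE//; lra.
    rewrite E1// /rad; case: (ltP 0 (diam (U k))) => [d0|_]; last first.
      by rewrite -powRrM mulVf ?gt_eqF// powRr1 ?(ltW (eps0 k))//; apply: le_trans E3 _; rewrite lerDr.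
    apply: (@le_trans _ _ (2 `^ t * diam_pow s (U k))); last first.
      by rewrite lerDl; apply: le_trans E3; exact: ltW.
    rewrite powRM ?(ltW d0)// ler_wpM2l ?(ltW p2)// /diam_pow.
    case: ifPn => [/eqP U0|_]; first by case: Uk0 => z; rewrite U0.
    have [d1|d1] := leP (diam (U k)) 1; last by have := diam_le Uk0 (Ud k); lra.
    by rewrite /powR gt_eqF// ler_expR ler_wnM2r// ?ln_le0// ltW.
  apply: le_trans (epsilon_trick _ _ (ltW e10)) _.
    by move=> k; rewrite lee_fin mulr_ge0 ?diam_pow_ge0 ?ltW.
  under eq_eseriesr do rewrite EFinM.
  rewrite nneseriesZl; last by move=> k _; rewrite lee_fin diam_pow_ge0.
  apply: (@le_trans _ _ ((2 `^ t)%:E * e1%:E + e1%:E)%E).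
    by rewrite leeD2r// lee_wpmul2l// lee_fin ltW.
  by rewrite -EFinM -EFinD lee_fin /e1 -[X in _ + X]mul1r -mulrDl mulrC divfK// gt_eqF//; lra.
Qed.

End Hausdorff.

Section Avoid.
Variables (R : realType) (T : choiceType) (J : seq T) (q : T -> R).
Hypotheses (uJ : uniq J) (q0 : forall j, 0 <= q j) (q1 : \sum_(j <- J) q j = 1).

Let p (v : seq T) : R := \prod_(j <- v) q j.

Let p_ge0 v : 0 <= p v.
Proof. exact: prodr_ge0. Qed.

(** Two distinct letters cannot both extend v to a prefix of a. *)
Lemma prefix_rcons_sum (v a : seq T) (x : R) : 0 <= x ->
  \sum_(j <- J) (if prefix (rcons v j) a then x else 0) <=
  if prefix v a then x else 0.
Proof.
move=> x0; have pre j : prefix (rcons v j) a -> prefix v a.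
  by apply: prefix_trans; exact: prefix_rcons.
case: (boolP (has (fun j => prefix (rcons v j) a) J)) => [/hasP[j jJ ja]|].
  rewrite (bigD1_seq j)//= ja (pre _ ja) big1 ?addr0// => i ij.
  case: ifP => // ia; move: ij; apply: contraNeq => _.
  have /prefixP[s1 e1] := ja; have /prefixP[s2 e2] := ia.
  have := e2; rewrite e1 !cat_rcons => /eqP; rewrite eqseq_cat// eqxx/=.
  by move=> /eqP[->].
move=> /hasPn h; rewrite big1_seq; first by case: ifP.
by move=> j /= jJ; rewrite (negPf (h j jJ)).
Qed.

(* The hypothesis bounds the total mass of the cylinders for the Bernoulli
   measure with weights q. *)
Lemma avoid_cylinders (A : nat -> seq (seq T)) :
  (\sum_(0 <= k <oo) (\sum_(a <- A k) \prod_(j <- a) q j)%:E < 1%:E)%E ->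
  exists2 w : nat -> T, forall k, w k \in J & forall n k, mkseq w n \notin A k.
Proof.
move=> A1.
(* [mu v] is the mass of the listed cylinders below v, and [G v] says that it does not exhaust the
   mass of v. If no child of v satisfied G, summing over the children would refute [G v]. Following
   good children gives the sequence, without building a measure on sequences. *)
pose mu v : \bar R :=
  (\sum_(0 <= k <oo) (\sum_(a <- A k) (if prefix v a then p a else 0))%:E)%E.
pose G v := (mu v < (p v)%:E)%E.
have term_ge0 v k : 0 <= \sum_(a <- A k) (if prefix v a then p a else 0).
  by apply: sumr_ge0 => a _; case: ifP.
have G0 : G [::].
  rewrite /G (_ : p [::] = 1) ?/p ?big_nil//; apply: le_lt_trans A1.
  apply: lee_nneseries => k _; first by rewrite lee_fin.
  by rewrite lee_fin; apply: ler_sum => a _; rewrite prefix0s.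
have GS v : G v -> exists2 j, j \in J & G (rcons v j).
  move=> Gv; apply: contrapT => h.
  have hJ j : j \in J -> ((p v * q j)%:E <= mu (rcons v j))%E.
    move=> jJ; rewrite leNgt; apply/negP => lt_; apply: h; exists j => //.
    by rewrite /G (_ : p (rcons v j) = p v * q j)// /p big_rcons/=.
  have : ((p v)%:E <= mu v)%E.
    rewrite -[p v]mulr1 -q1 mulr_sumr -sumEFin.
    apply: le_trans (_ : (\sum_(j <- J) mu (rcons v j) <= _)%E).
      by rewrite big_seq [leRHS]big_seq; apply: lee_sum => j /hJ.
    rewrite -nneseries_sum; last by move=> *; rewrite lee_fin.
    apply: lee_nneseries => k _; first move=> _.
      by apply: sume_ge0 => j _; rewrite lee_fin.
    rewrite sumEFin lee_fin exchange_big/=; apply: ler_sum => a _.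
    exact: prefix_rcons_sum.
  by rewrite leNgt; move/negP; apply.
have GA v k : G v -> v \notin A k.
  move=> Gv; apply/negP => vA; have : ((p v)%:E <= mu v)%E.
    apply: le_trans (_ : ((\sum_(a <- A k) (if prefix v a then p a else 0))%:E <= _)%E).
      rewrite lee_fin (big_rem v)//= prefix_refl lerDl.
      by apply: sumr_ge0 => a _; case: ifP.
    rewrite /mu; apply: le_trans (@nneseries_lim_ge _ _ xpredT 0 k.+1 _); last first.
      by move=> n _ _; rewrite lee_fin.
    by rewrite big_nat_recr//= leeDr// sume_ge0// => i _; rewrite lee_fin.
  by rewrite leNgt; move/negP; apply.
have [j0 j0J _] := GS _ G0.
pose nx v := xget j0 [set j | j \in J /\ G (rcons v j)].
have nxP v : G v -> nx v \in J /\ G (rcons v (nx v)).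
  by move=> /GS[j jJ Gj]; rewrite /nx; case: xgetP => [_ -> []|/(_ j)[]].
pose pre := fix pre n := if n is n'.+1 then rcons (pre n') (nx (pre n')) else [::].
have Gpre n : G (pre n) by elim: n => //= n /nxP[].
exists (fun n => nx (pre n)) => [k|n k]; first by have [] := nxP _ (Gpre k).
suff -> : mkseq (fun n => nx (pre n)) n = pre n by exact: GA.
by elim: n => // n ih; rewrite mkseqS ih.
Qed.

End Avoid.

(** * Cylinders and their sizes *)

Lemma word_map_cat (T J : Type) (S : J -> T -> T) u v x :
  word_map S (u ++ v) x = word_map S u (word_map S v x).
Proof. by rewrite /word_map; elim: u => //= i u ->. Qed.

Lemma mkseqD (T : Type) (f : nat -> T) m n :
  mkseq f (m + n) = mkseq f m ++ mkseq (fun k => f (m + k)%N) n.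
Proof.
rewrite /mkseq iotaD map_cat add0n; congr cat.
by rewrite -[in iota m n](addn0 m) iotaDl -map_comp.
Qed.

(** Turns the number of possible word lengths, linear in u, into an arbitrarily small exponential
    loss. *)
Lemma linear_le_expR (R : realType) (e L u : R) : 0 < e -> 0 < L -> 0 <= u ->
  u / L + 1 <= ((L * e)^-1 + 1) * expR (e * u).
Proof.
move=> e0 L0 u0; rewrite mulrDl mul1r; apply: lerD; last first.
  by rewrite -[leLHS]expR0 ler_expR mulr_ge0// ltW.
have -> : u / L = (L * e)^-1 * (e * u) by field; rewrite !gt_eqF.
rewrite ler_wpM2l ?invr_ge0 ?mulr_ge0 ?ltW//.
by have := expR_ge1Dx (e * u); lra.
Qed.

(** [ig_count] compares words of one length only, because cylinders of different lengths may be
    nested. [ig_code] is what remains of compactness: every code has a point in all its cylinders.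
    One constant K serves for the diameter of X, the distortion and both Lipschitz bounds. *)
Record ifs_geometry (R : realType) (d : nat) (I : countType) (X : set 'rV[R]_d)
    (S : I -> 'rV[R]_d -> 'rV[R]_d) (lam : seq I -> R) (xi K : R) (M : nat) :
    Prop := IfsGeometry {
  ig_X0 : X !=set0;
  ig_K1 : 1 <= K;
  ig_diam : forall x y, X x -> X y -> enorm (x - y) <= K;
  ig_SX : forall i x, X x -> X (S i x);
  ig_xi : 0 < xi < 1;
  ig_lam_nil : lam [::] = 1;
  ig_lam_gt0 : forall w, 0 < lam w;
  ig_lam_le : forall w, lam w <= xi ^+ size w;
  ig_lam_cat_ge : forall u v, lam u * lam v <= K * lam (u ++ v);
  ig_lip : forall w x y, X x -> X y ->
    enorm (word_map S w x - word_map S w y) <= K * lam w * enorm (x - y);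
  ig_colip : forall w x y, X x -> X y ->
    lam w * enorm (x - y) <= K * enorm (word_map S w x - word_map S w y);
  ig_count : forall n z r (W : seq (seq I)), 0 < r -> uniq W ->
    {in W, forall w, [/\ size w = n, r <= lam w &
       (word_map S w @` X) `&` eball z r !=set0]} -> (size W <= M)%N;
  ig_code : forall om : nat -> I, exists p,
    forall n, (word_map S (mkseq om n) @` X) p }.

Section System.
Variables (R : realType) (d : nat) (I : countType) (X : set 'rV[R]_d).
Variables (S : I -> 'rV[R]_d -> 'rV[R]_d) (lam : seq I -> R) (xi K : R) (M : nat).
Hypothesis H : ifs_geometry X S lam xi K M.
Variable i0 : I.

Let F := limit_set X S.
Let K1 := ig_K1 H.
Let K0 : 0 < K := lt_le_trans ltr01 K1.
Let lam0 := ig_lam_gt0 H.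
Let L : R := - ln xi.

Let L0 : 0 < L.
Proof. by have /andP[x0 x1] := ig_xi H; rewrite oppr_gt0 ln_lt0// x0. Qed.

Lemma word_map_sub w x : X x -> X (word_map S w x).
Proof. by move=> Xx; elim: w => //= i w; exact: (ig_SX H). Qed.

Lemma lam_le1 w : lam w <= 1.
Proof.
apply: le_trans (ig_lam_le H w) _; have /andP[x0 x1] := ig_xi H.
by rewrite exprn_ile1// ltW.
Qed.

Lemma word_map_inj w x y : X x -> X y -> word_map S w x = word_map S w y -> x = y.
Proof.
move=> Xx Xy e; have := ig_colip H w Xx Xy; rewrite e subrr enorm0 mulr0.
rewrite pmulr_rle0// => h; apply/eqP; rewrite -subr_eq0; apply/eqP/enorm_eq0.
by apply/eqP; rewrite eq_le h enorm_ge0.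
Qed.

Lemma word_map_diam w x y : X x -> X y ->
  enorm (word_map S w x - word_map S w y) <= K ^+ 2 * lam w.
Proof.
move=> Xx Xy; apply: le_trans (ig_lip H w Xx Xy) _.
rewrite expr2 -!mulrA ler_wpM2l ?(ltW K0)// mulrC ler_wpM2r ?(ltW (lam0 w))//.
exact: (ig_diam H).
Qed.

(** The definition intersects over n >= 1; level 0, which is X itself, comes for free. *)
Lemma limit_set_code x : F x ->
  exists om : nat -> I, forall n, (word_map S (mkseq om n) @` X) x.
Proof.
move=> [om _ h]; exists om => -[|n]; last exact: h.
have [z Xz <-] := h 1%N isT; exists (word_map S (mkseq om 1) z) => //.
exact: word_map_sub.
Qed.

Lemma code_limit_set x (om : nat -> I) :
  (forall n, (word_map S (mkseq om n) @` X) x) -> F x.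
Proof. by move=> h; exists om => // n _; exact: h. Qed.

Lemma limit_set_sub x : F x -> X x.
Proof. by move=> /limit_set_code[om /(_ 0%N)[z Xz <-]]. Qed.

Lemma limit_set0 : F !=set0.
Proof. by have [p /code_limit_set Fp] := ig_code H (fun=> i0); exists p. Qed.

Lemma limit_set_bounded : ebounded F.
Proof.
have [z Xz] := ig_X0 H; exists z => //; exists (K + 1); first by rewrite addr_gt0.
move=> x /limit_set_sub Xx; apply: le_lt_trans (ig_diam H Xx Xz) _.
by rewrite ltrDl.
Qed.

Lemma limit_set_map i x : F x -> F (S i x).
Proof.
move=> /limit_set_code[om h]; apply: (@code_limit_set _ (fun n => if n is n'.+1 then om n' else i)).
move=> [|n].
  exists (S i x) => //; apply: (ig_SX H); have [z Xz <-] := h 0%N; exact: Xz.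
have [z Xz zx] := h n; exists z => //.
by rewrite /mkseq/= -[iota 1 n]/(iota (1 + 0) n) iotaDl -map_comp/= -zx.
Qed.

(** A point z of X with x = S_w z lies in all cylinders of the shifted code because S_w is injective
    on X. *)
Lemma limit_set_shift x om n : (forall n, (word_map S (mkseq om n) @` X) x) ->
  exists2 z, F z & x = word_map S (mkseq om n) z.
Proof.
move=> h; have [z Xz zx] := h n; exists z => //.
apply: (@code_limit_set _ (fun k => om (n + k)%N)) => m.
have [y Xy yx] := h (n + m)%N; exists y => //.
apply: (@word_map_inj (mkseq om n)) => //; first exact: word_map_sub.
by rewrite -word_map_cat -mkseqD yx.
Qed.

Lemma expn_ratio_lt (r : R) : 0 < r -> exists n, xi ^+ n < r.
Proof.
move=> r0; have /andP[x0 x1] := ig_xi H.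
pose y := xi^-1 - 1; have y0 : 0 < y by rewrite subr_gt0 invf_gt1.
pose n := (Num.truncn (r^-1 / y)).+1; exists n.
rewrite -[ltRHS]invrK -[ltLHS]invrK ltf_pV2 ?posrE ?invr_gt0 ?exprn_gt0//.
rewrite -exprVn; apply: lt_le_trans (_ : 1 + y *+ n <= _); last first.
  have -> : xi^-1 = 1 + y by rewrite /y subrKC.
  by apply: ler_exp1D; exact: ltW.
have := truncnS_gt (r^-1 / y); rewrite -/n ltr_pdivrMr// (mulr_natl y).
by move/lt_trans; apply; rewrite ltrDr.
Qed.

(** g need not be monotone, as [lam] need not decrease along prefixes; the first index at which g is
    below r is a successor. *)
Lemma first_below (g : nat -> R) (r : R) : r <= g 0%N -> (exists n, g n < r) ->
  exists n, r <= g n /\ g n.+1 < r.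
Proof.
move=> r0 ex; case: (ex_minnP ex) => -[|n] hn nmin.
  by move: hn; rewrite ltNge r0.
exists n; split => //; rewrite leNgt; apply/negP => /nmin; rewrite ltnn//.
Qed.

Lemma stopping_time (om : nat -> I) (r : R) : 0 < r <= 1 ->
  exists n, r <= lam (mkseq om n) /\ lam (mkseq om n.+1) < r.
Proof.
move=> /andP[r0 r1].
apply: (@first_below (fun n => lam (mkseq om n))).
  by rewrite /mkseq/= (ig_lam_nil H).
have [n hn] := expn_ratio_lt r0; exists n.
by apply: le_lt_trans (ig_lam_le H _) _; rewrite size_mkseq.
Qed.

Lemma size_word_le (u : R) w : expR (- u) <= lam w -> (size w)%:R <= u / L.
Proof.
move=> h; have /andP[x0 x1] := ig_xi H.
rewrite ler_pdivlMr// -lerN2 -ler_expR; apply: le_trans h _.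
apply: le_trans (ig_lam_le H w) _.
by rewrite mulrC -mulNr expRM_natr /L opprK lnK.
Qed.

(** Since [lam w] <= xi ^ size w, only lengths up to u / L with L = - ln xi can occur. *)
Lemma words_of_all_sizes (Q : seq I -> Prop) (f : seq I -> R) (u m : R) :
  0 <= u -> 0 <= m ->
  (forall n, exists W : seq (seq I), \sum_(w <- W) f w <= m /\
     forall w, w \in W <-> [/\ size w = n, expR (- u) <= lam w & Q w]) ->
  exists W : seq (seq I), \sum_(w <- W) f w <= (u / L + 1) * m /\
     forall w, w \in W <-> expR (- u) <= lam w /\ Q w.
Proof.
move=> u0 m0 /choice[W hW].
have uL : 0 <= u / L by rewrite divr_ge0// ltW.
exists (flatten [seq W n | n <- iota 0 (Num.truncn (u / L)).+1]); split.
  rewrite big_flatten big_map; apply: (@le_trans _ _ (\sum_(i <- iota 0 (Num.truncn (u / L)).+1) m)).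
    by apply: ler_sum => n _; have [] := hW n.
  rewrite big_const_seq count_predT size_iota iter_addr_0 -[leLHS]mulr_natl.
  by rewrite ler_wpM2r// -natr1 lerD2r truncn_le.
move=> w; split; first by move=> /flattenP[_ /mapP[n _ ->]] /(hW n).2[].
move=> [lw Qw]; apply/flattenP; exists (W (size w)); last exact/(hW _).2.
apply: map_f; rewrite mem_iota/= add0n ltnS truncn_ge_nat//.
exact: size_word_le.
Qed.

Lemma count_words (e : R) : 0 < e -> exists2 C : R, 0 < C &
  forall u z, 0 <= u -> exists W : seq (seq I), (size W)%:R <= C * expR (e * u) /\
    forall w, w \in W <-> expR (- u) <= lam w /\
      (word_map S w @` X) `&` eball z (expR (- u)) !=set0.
Proof.
move=> e0; exists (((L * e)^-1 + 1) * (M%:R + 1)).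
  by rewrite mulr_gt0// ltr_wpDl// invr_ge0 mulr_ge0// ltW.
move=> u z u0.
have [//|n|W [W1 W2]] := @words_of_all_sizes (fun w =>
  (word_map S w @` X) `&` eball z (expR (- u)) !=set0) (fun=> 1) u M%:R u0.
  have [|W [uW sW WP]] := @finite_set_of_bound _ [set w | [/\ size w = n, expR (- u) <= lam w &
    (word_map S w @` X) `&` eball z (expR (- u)) !=set0]] M.
    move=> s us hs; apply: (ig_count H (expR_gt0 (- u)) us (n := n) (z := z)).
    by move=> w /hs.
  exists W; split; first by rewrite big_const_seq count_predT iter_addr_0 ler_nat.
  by move=> w; rewrite -WP.
exists W; split => //; move: W1; rewrite big_const_seq count_predT iter_addr_0.
move=> /le_trans; apply; rewrite mulrAC; apply: ler_pM => //.
- by rewrite addr_ge0// divr_ge0// ltW.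
- exact: linear_le_expR.
- by rewrite lerDl.
Qed.

(* If the weights lam w ^ t over a finite family of words of equal length sum to
   more than K ^ t, the normalised weights define a Bernoulli measure on the
   sequences of such words whose cylinder masses are at most lam ^ t; by the
   counting bound a ball of radius r then has mass at most r ^ (t - e). *)
Lemma sum_same_size (t : R) n (J : seq (seq I)) : dimH F < t -> uniq J ->
  {in J, forall w, size w = n} -> \sum_(w <- J) lam w `^ t <= K `^ t.
Proof.
move=> ht uJ sJ; have t0 : 0 < t.
  by apply: le_lt_trans ht; apply: dimH_ge0; [exact: limit_set0|exact: limit_set_bounded].
(* For n = 0 the family contains at most the empty word; the decomposition into blocks below needs
   positive length. *)
case: n sJ => [|n] sJ.
  apply: (@le_trans _ _ (\sum_(w <- [:: [::]] : seq (seq I)) lam w `^ t)).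
    case: J uJ sJ => [|w [|w' J]] uJ sJ; rewrite ?big_nil ?big_seq1 ?powR_ge0//.
      by have /size0nil-> := sJ w (mem_head _ _).
    have /size0nil w0 := sJ w (mem_head _ _).
    have /size0nil w'0 : size w' = 0%N by apply: sJ; rewrite !inE eqxx orbT.
    by move: uJ; rewrite w0 w'0.
  rewrite big_seq1 (ig_lam_nil H); apply: ge0_ler_powR; rewrite ?nnegrE//; exact: ltW.
rewrite leNgt; apply/negP => KJ.
have [s /andP[s0 st] Hs] := dimH_lt limit_set0 limit_set_bounded ht.
(* F is null in some dimension s < t' < t; the gap e = t - t' pays for the number of words counted
   near a ball. *)
pose t' := (s + t) / 2; pose e := t - t'.
have e0 : 0 < e by rewrite /e /t'; lra.
have [C C0 hC] := count_words e0.
pose Z := \sum_(w <- J) lam w `^ t.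
have Z0 : 0 < Z by apply: lt_trans KJ; exact: powR_gt0.
have J0 : (0 < size J)%N.
  by rewrite lt0n; apply: contraTneq Z0 => /size0nil J0; rewrite /Z J0 big_nil ltxx.
pose D := C * (size J)%:R.
have D0 : 0 < D by rewrite mulr_gt0// ltr0n.
have [||u [u0 Fu us]] := @hausdorff_null_balls _ _ _ s t' (2 * D)^-1 _ _ Hs.
- by rewrite /t'; apply/andP; split; lra.
- by rewrite invr_gt0 mulr_gt0.
pose q w : R := lam w `^ t / Z.
have q0 w : 0 <= q w by rewrite divr_ge0 ?powR_ge0 ?ltW.
have q1 : \sum_(w <- J) q w = 1 by rewrite -mulr_suml mulfV ?gt_eqF.
(* The normalisation by Z > K^t absorbs the factor K lost in each concatenation. *)
have qle a : \prod_(j <- a) q j <= lam (flatten a) `^ t.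
  elim: a => [|w a ih]; first by rewrite big_nil/= (ig_lam_nil H) powR1.
  rewrite big_cons/=; apply: (@le_trans _ _ ((lam w `^ t / K `^ t) * lam (flatten a) `^ t)).
    apply: ler_pM => //; first exact: prodr_ge0.
    by rewrite ler_wpM2l ?powR_ge0// lef_pV2 ?posrE ?powR_gt0// ltW.
  rewrite mulrAC ler_pdivrMr ?powR_gt0// -!powRM ?(ltW K0) ?(ltW (lam0 _))//.
  apply: ge0_ler_powR; rewrite ?nnegrE ?mulr_ge0 ?(ltW (lam0 _)) ?(ltW K0) ?(ltW t0)//.
  by rewrite mulrC (mulrC (lam _) K) mulrC; exact: (ig_lam_cat_ge H).
have /choice[W hW] := fun k => hC (u k).2 (u k).1 (u0 k).
(* Inverse of [flatten] on words made of blocks of length n.+1. *)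
pose chop (w : seq I) := reshape (nseq (size w %/ n.+1) n.+1) w.
(* Block words below the radius of the k-th ball whose parent is still above it and meets the ball.
   Their total mass is at most 1/2, so some sequence of blocks avoids them all; but its point of F
   lies in one of the balls, a contradiction. *)
pose A k := [seq a <- [seq rcons (chop w) j | w <- W k, j <- J] |
   lam (flatten a) < expR (- (u k).2)].
have [|w wJ wA] := @avoid_cylinders _ _ J q uJ q0 q1 A.
  apply: (@le_lt_trans _ _ (\sum_(0 <= k <oo) (D%:E * (expR (- (t' * (u k).2)))%:E))%E).
    apply: lee_nneseries => [k _ _|k _].
      by rewrite lee_fin sumr_ge0// => a _; exact: prodr_ge0.
    rewrite -EFinM lee_fin; apply: (@le_trans _ _ (\sum_(a <- A k) expR (- (t * (u k).2)))).
      rewrite big_seq [leRHS]big_seq; apply: ler_sum => a; rewrite mem_filter => /andP[la _].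
      apply: le_trans (qle a) _; rewrite -powR_expRN; apply: ge0_ler_powR; rewrite ?nnegrE ?expR_ge0 ?(ltW t0) ?(ltW (lam0 _)) ?(ltW la)//.
    rewrite big_const_seq count_predT iter_addr_0 -mulr_natl.
    apply: (@le_trans _ _ ((size (W k))%:R * (size J)%:R * expR (- (t * (u k).2)))).
      rewrite ler_wpM2r ?expR_ge0// -natrM ler_nat -(size_allpairs (fun w j => rcons (chop w) j)).
      by rewrite size_filter count_size.
    apply: (@le_trans _ _ (C * expR (e * (u k).2) * (size J)%:R * expR (- (t * (u k).2)))).
      by rewrite !ler_wpM2r ?expR_ge0//; have [] := hW k.
    have -> : - (t' * (u k).2) = e * (u k).2 + - (t * (u k).2) by rewrite /e; ring.
    by rewrite expRD /D le_eqVlt; apply/orP; left; apply/eqP; ring.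
  rewrite nneseriesZl; last by move=> k _; rewrite lee_fin expR_ge0.
  apply: (@le_lt_trans _ _ (D%:E * ((2 * D)^-1)%:E)%E).
    by apply: lee_wpmul2l => //; rewrite lee_fin ltW.
  by rewrite -EFinM lte_fin invfM mulrCA mulfV ?gt_eqF//; lra.
pose om (k : nat) : I := nth i0 (w (k %/ n.+1)%N : seq I) (k %% n.+1)%N.
have omE m : mkseq om (m * n.+1)%N = flatten (mkseq w m).
  elim: m => // m ih; rewrite mkseqS flatten_rcons -ih mulSn addnC mkseqD; congr cat.
  apply: (@eq_from_nth _ i0); rewrite size_mkseq ?sJ// => i ij.
  by rewrite nth_mkseq// /om divnMDl// divn_small// addn0 modnMDl modn_small.
have [x hx] := ig_code H om.
have [k _ xk] := Fu x (code_limit_set hx).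
have [m [m1 m2]] : exists m, expR (- (u k).2) <= lam (flatten (mkseq w m)) /\
   lam (flatten (mkseq w m.+1)) < expR (- (u k).2).
  apply: (@first_below (fun m => lam (flatten (mkseq w m)))).
    by rewrite /mkseq/= (ig_lam_nil H) -[leRHS]expR0 ler_expR oppr_le0.
  have [m hm] := expn_ratio_lt (expR_gt0 (- (u k).2)); exists m.
  rewrite -omE; apply: le_lt_trans (ig_lam_le H _) (le_lt_trans _ hm).
  rewrite size_mkseq; have /andP[x0 x1] := ig_xi H.
  by apply: ler_wiXn2l; rewrite ?ltW// leq_pmulr.
have : mkseq w m.+1 \notin A k := wA _ _.
apply/negP; rewrite negbK mem_filter m2/=.
apply/allpairsP; exists (flatten (mkseq w m), w m) => /=; split => //.
  apply/(hW k).2; split => //; exists x; split => //.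
  by rewrite -omE; exact: hx.
rewrite mkseqS /chop -omE size_mkseq mulnK// omE; congr rcons.
rewrite -[LHS]flattenK; congr reshape.
apply: (@eq_from_nth _ 0%N); rewrite ?size_nseq /shape ?size_map ?size_iota// => i im.
by rewrite (nth_map [::]) ?size_mkseq// nth_mkseq// nth_nseq im sJ.
Qed.

End System.

(** * Counting bounds for the limit set *)

Section Dims.
Variables (R : realType) (d : nat) (I : countType) (X : set 'rV[R]_d).
Variables (S : I -> 'rV[R]_d -> 'rV[R]_d) (lam : seq I -> R) (xi K : R) (M : nat).
Hypothesis H : ifs_geometry X S lam xi K M.
Variables (i0 : I) (p : I -> 'rV[R]_d).
Hypothesis pS : forall i, (S i @` X) (p i).

Let F := limit_set X S.
Let P := range p.
Let K1 := ig_K1 H.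
Let K0 : 0 < K := lt_le_trans ltr01 K1.
Let lam0 := ig_lam_gt0 H.
Let L : R := - ln xi.

Let L0 : 0 < L.
Proof. by have /andP[x0 x1] := ig_xi H; rewrite oppr_gt0 ln_lt0// x0. Qed.

Let F0 : F !=set0 := limit_set0 H i0.
Let Fb : ebounded F := limit_set_bounded H.
Let P0 : P !=set0. Proof. by exists (p i0), i0. Qed.

Lemma base_point_sub i : X (p i).
Proof. by have [x Xx <-] := pS i; exact: (ig_SX H). Qed.

Let Pb : ebounded P.
Proof.
have [z Xz] := ig_X0 H; exists z => //; exists (K + 1); first by rewrite addr_gt0.
move=> _ [i _ <-]; apply: le_lt_trans (ig_diam H (base_point_sub i) Xz) _.
by rewrite ltrDl.
Qed.

Lemma dist_base_point i x : X x -> enorm (S i x - p i) <= K ^+ 2 * lam [:: i].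
Proof. by move=> Xx; have [y Xy <-] := pS i; exact: (word_map_diam H [:: i]). Qed.

(** The factor paid for replacing balls of radius k r by balls of radius r. *)
Definition cimg (k : R) := (packc R d * k) ^+ d.

Lemma cimg_gt0 k : 1 <= k -> 0 < cimg k.
Proof. by move=> k1; apply: lt_le_trans (packck_ge1 _ k1). Qed.

Lemma cimg2_gt0 : 0 < cimg 2.
Proof. by apply: cimg_gt0; rewrite ler1n. Qed.

Lemma covby_word_image w E (rho k r m : R) : E `<=` X -> 1 <= k -> 0 < r ->
  2 * (K * lam w) * rho <= k * r -> covby E rho m ->
  covby (word_map S w @` E) r (cimg k * m).
Proof.
move=> EX k1 r0 kr h; apply: covby_refine => //.
have h' := @covby_image R d E (word_map S w) (K * lam w) rho m (mulr_gt0 K0 (lam0 w)) _ h.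
by apply: covby_sub (h' _) => // x y Ex Ey; apply: (ig_lip H); exact: EX.
Qed.

Lemma sum_large_words (t e : R) : dimH F < t -> 0 < e -> exists2 C : R, 0 < C &
  forall u, 0 <= u -> exists W : seq (seq I),
    \sum_(w <- W) lam w `^ t <= C * expR (e * u) /\
    forall w, w \in W <-> expR (- u) <= lam w.
Proof.
move=> ht e0; have t0 : 0 < t by apply: le_lt_trans ht; exact: dimH_ge0.
exists (((L * e)^-1 + 1) * K `^ t).
  by rewrite mulr_gt0 ?powR_gt0// ltr_wpDl// invr_ge0 mulr_ge0// ltW.
move=> u u0; have [|n|W [W1 W2]] := @words_of_all_sizes _ _ _ _ _ _ _ _ _ H
  (fun=> True) (fun w => lam w `^ t) u (K `^ t) u0; first exact: powR_ge0.
(* Finiteness follows from the sum bound: each such word contributes at least expR (- t u) to a sum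
   that is at most K^t. *)
- have [|W [uW sW WP]] := @finite_set_of_bound _ [set w | size w = n /\ expR (- u) <= lam w]
     (Num.truncn (K `^ t * expR (t * u))).
    move=> s us hs; rewrite truncn_ge_nat ?mulr_ge0 ?powR_ge0 ?expR_ge0//.
    apply: le_trans (_ : (\sum_(w <- s) lam w `^ t) * expR (t * u) <= _); last first.
      rewrite ler_wpM2r ?expR_ge0//; apply: (@sum_same_size _ _ _ _ _ _ _ _ _ H i0 t n) => //.
      by move=> w /hs[].
    rewrite -ler_pdivrMr ?expR_gt0// -expRN -powR_expRN mulr_natl.
    rewrite -iter_addr_0 -count_predT -big_const_seq big_seq [leRHS]big_seq.
    apply: ler_sum => w /hs[_ h]; apply: ge0_ler_powR; rewrite ?nnegrE ?expR_ge0 ?(ltW (lam0 w)) ?(ltW t0)//.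
  exists W; split.
    apply: (@sum_same_size _ _ _ _ _ _ _ _ _ H i0 t n) => //.
    by move=> w /WP[].
  by move=> w; split=> [/WP[]|[? ? _]]; last exact/WP.
exists W; split; last by move=> w; split=> [/W2[]|?]; last exact/W2.
apply: le_trans W1 _; rewrite [leRHS]mulrAC; apply: ler_pM => //.
- by rewrite addr_ge0// divr_ge0// ltW.
- exact: powR_ge0.
- exact: linear_le_expR.
Qed.

Lemma lam_child w i r : lam (w ++ [:: i]) < r -> lam [:: i] < K * (r / lam w).
Proof.
move=> h; rewrite mulrA ltr_pdivlMr// mulrC; apply: le_lt_trans (ig_lam_cat_ge H _ _) _.
by rewrite ltr_pM2l.
Qed.

(** The parent w is recorded apart from the last letter: there are finitely many parents of size at
    least r, whereas one parent may have infinitely many children below r. *)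
Lemma limit_set_stop x (r : R) : F x -> 0 < r <= 1 -> exists w i f,
  [/\ r <= lam w, lam (w ++ [:: i]) < r, F f & x = word_map S w (S i f)].
Proof.
move=> /limit_set_code-/(_ _ _ _ _ H)[om h] r01.
have [n [n1 n2]] := stopping_time H om r01.
have [f Ff xf] := limit_set_shift H n.+1 h.
rewrite mkseqS -cats1 in n2 xf; exists (mkseq om n), (om n), f; split => //.
by rewrite xf word_map_cat.
Qed.

(* F is covered by the sets S_w (U_(i | lam (w i) < r) S_i X) with lam w >= r;
   the inner union is r / lam w-close to P. *)
Lemma boxbnd_limit_set (t e : R) : dimH F < t -> 0 < e -> boxbnd P t ->
  boxbnd F (t + e).
Proof.
move=> ht e0 [C C0 hC]; have [D D0 hD] := sum_large_words ht e0.
have t0 : 0 < t by apply: le_lt_trans ht; exact: dimH_ge0.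
(* With l = - ln (lam w), a child has relative size at most K expR (- (u - l)), hence diameter at
   most K^3 expR (- (u - l)); balls of radius (1 + K^3) expR (- (u - l)) around the centres for P
   cover it. Mapping by S_w contributes 2 K [lam w]. *)
pose k := 2 * K * (1 + K ^+ 3).
have K3 : 1 <= K ^+ 3 by rewrite exprn_ege1.
have k1 : 1 <= k by rewrite /k; nra.
exists (cimg k * C * D); first by rewrite !mulr_gt0// cimg_gt0.
move=> u u0; have [W [W1 W2]] := hD u u0.
pose Y w := [set z | exists i f, [/\ F f, lam (w ++ [:: i]) < expR (- u) & z = S i f]].
apply: (@covby_sub _ _ _ [set x | exists2 w, w \in W & (word_map S w @` Y w) x]
  (expR (- u)) (expR (- u)) _ (\sum_(w <- W) (cimg k * C * expR (t * u) * lam w `^ t))) => //.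
- move=> x Fx; have [|w [i [f [w1 w2 Ff ->]]]] := limit_set_stop Fx (r := expR (- u)).
    by rewrite expR_gt0 -[leRHS]expR0 ler_expR oppr_le0.
  by exists w; [exact/W2|exists (S i f) => //; exists i, f].
- rewrite -mulr_sumr; apply: le_trans (ler_wpM2l _ W1) _.
    by rewrite !mulr_ge0 ?expR_ge0 ?(ltW C0) ?(ltW (cimg_gt0 k1)).
  by rewrite mulrDl expRD le_eqVlt; apply/orP; left; apply/eqP; ring.
apply: covby_bigcup => w /W2 lw.
have lw1 := lam_le1 H w.
pose l := - ln (lam w); have l0 : 0 <= l by rewrite oppr_ge0 ln_le0.
have lwE : lam w = expR (- l) by rewrite /l opprK lnK ?posrE.
have ul : l <= u by move: lw; rewrite lwE ler_expR lerN2.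
have rE : expR (- u) / lam w = expR (- (u - l)).
  by rewrite lwE -expRN -expRD; congr expR; ring.
have -> : cimg k * C * expR (t * u) * lam w `^ t = cimg k * (C * expR (t * (u - l))).
  rewrite lwE powR_expRN mulrBr expRD; ring.
apply: (@covby_word_image w _ ((1 + K ^+ 3) * expR (- (u - l)))) => //.
- by move=> z [i [f [Ff _ ->]]]; apply: (ig_SX H); exact: (limit_set_sub H).
- exact: expR_gt0.
- by rewrite -rE /k le_eqVlt; apply/orP; left; apply/eqP; field; rewrite gt_eqF.
have [s sC hs] := hC (u - l) (ltac:(lra)); exists s => // z [i [f [Ff li ->]]].
have [c cs pc] := hs (p i) (ex_intro2 _ _ i Logic.I erefl); exists c => //.
apply: le_lt_trans (enorm_tri _ _ (p i)) _.
have := dist_base_point i (limit_set_sub H Ff).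
have : K ^+ 2 * lam [:: i] <= K ^+ 2 * (K * (expR (- u) / lam w)).
  by rewrite ler_wpM2l ?exprn_ge0 ?(ltW K0)//; apply/ltW/lam_child.
rewrite rE; have -> : K ^+ 2 * (K * expR (- (u - l))) = K ^+ 3 * expR (- (u - l)) by ring.
by rewrite mulrDl mul1r; lra.
Qed.

Lemma dimB_limit_set_le : dimB F <= Num.max (dimH F) (dimB P).
Proof.
apply: ler_of_forall_gt => s; rewrite gt_max => /andP[hs Ps].
pose t := (Num.max (dimH F) (dimB P) + s) / 2.
have ms : Num.max (dimH F) (dimB P) < s by rewrite gt_max hs.
have h1 : dimH F <= Num.max (dimH F) (dimB P) by rewrite le_max lexx.
have h2 : dimB P <= Num.max (dimH F) (dimB P) by rewrite le_max lexx orbT.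
apply: dimB_le => // t' st'.
have -> : t' = t + (t' - t) by ring.
by apply: boxbnd_limit_set; [rewrite /t; lra|rewrite /t; lra|apply: dimB_lt => //; rewrite /t; lra].
Qed.


Lemma expbnd_enlarge (E : set 'rV[R]_d) (k a b : R) : 1 <= k -> expbnd E a b -> forall e : R, 0 < e ->
  exists2 C : R, 0 < C & forall x u v, E x -> 0 <= v <= u ->
    covby (eball x (k * expR (- v)) `&` E) (expR (- u)) (C * expR ((a + e) * u + b * v)).
Proof.
move=> k1 hE e /hE[C C0 h].
exists (cimg 2 * cimg k * C).
  by rewrite !mulr_gt0 ?cimg2_gt0 ?cimg_gt0.
move=> x u v Ex uv; rewrite -mulrA.
apply: (@covby_localize R d _ (fun=> E) (expR (- v))); rewrite ?expR_gt0//.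
- by rewrite mulr_ge0 ?expR_ge0 ?ltW.
- apply: (@covby_sub _ _ _ (eball x (k * expR (- v))) (expR (- v)) (expR (- v)) _ (cimg k)) => //.
  have := @covby_bounded R d (eball x (k * expR (- v))) x (k * expR (- v)) (expR (- v)).
  rewrite mulfK ?gt_eqF ?expR_gt0//; apply => //.
  by rewrite ler_peMl ?expR_ge0// expR_gt0.
move=> c [_ Ec]; apply: covby_sub (h c u v Ec uv) => // y [yc [_ Ey]].
by split.
Qed.

(** What the part of F in a ball becomes after pulling back by a parent word: first-level pieces of
    size at most about expR (- v) that come close to a base point y. *)
Definition near_pieces (k : R) y (v : R) : set 'rV[R]_d :=
  [set z | exists i f, [/\ lam [:: i] < K * expR (- v), F f, z = S i f &
     exists2 x, (S i @` X) x & enorm (x - y) < k * expR (- v)]].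

(** [ig_count] for words of length 1: at most M letters of size at least r have their base point in
    a given r-ball. *)
Lemma words1_near (Q : I -> Prop) (s : seq 'rV[R]_d) (r : R) : 0 < r ->
  (forall i, Q i -> r <= lam [:: i] /\ exists2 c, c \in s & enorm (p i - c) < r) ->
  exists2 W : seq I, (size W <= M * size s)%N & forall i, Q i -> i \in W.
Proof.
move=> r0 hQ.
have fin c : exists W : seq I, (size W <= M)%N /\
    forall i, r <= lam [:: i] -> enorm (p i - c) < r -> i \in W.
  have [|W [uW sW WP]] := @finite_set_of_bound _ [set i | r <= lam [:: i] /\ enorm (p i - c) < r] M.
    move=> W uW hW; rewrite -(size_map (fun i => [:: i])).
    apply: (ig_count H r0 (n := 1%N) (z := c)); first by rewrite map_inj_uniq// => i j [].
    move=> _ /mapP[i /hW[h1 h2] ->]; split => //.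
    by exists (p i); split => //; exact: pS.
  by exists W; split => // i h1 h2; apply/WP.
have /choice[W hW] := fin.
exists (flatten [seq W c | c <- s]).
  rewrite size_flatten sumnE big_map big_map -iter_addn_0 -(count_predT s) -big_const_seq.
  by apply: leq_sum => c _; exact: (hW c).1.
move=> i /hQ[ri [c cs pc]]; apply/flattenP; exists (W c); first exact: map_f.
exact: (hW c).2.
Qed.

(** * Pieces of the limit set near a base point *)

Section LocalPieces.
Variables (a b k : R).
Hypotheses (k0 : 0 < k) (Pab : expbnd P a b) (Fa : dimB F <= a).

(** The distance k expR (- v) to a piece plus its diameter, at most K^2 times K expR (- v), reaches
    its base point. *)
Let kk : R := k + K ^+ 3.
Let K3 : 1 <= K ^+ 3. Proof. by rewrite exprn_ege1. Qed.
Let kk1 : 1 <= kk. Proof. by apply: le_trans K3 _; rewrite lerDr ltW. Qed.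

Let piece_base y v i x : lam [:: i] < K * expR (- v) -> (S i @` X) x ->
  enorm (x - y) < k * expR (- v) -> eball y (kk * expR (- v)) (p i).
Proof.
move=> li [x' Xx' <-] xy; rewrite /eball/=.
apply: le_lt_trans (enorm_tri _ _ (S i x')) _; rewrite enormBC.
have := dist_base_point i Xx'.
have : K ^+ 2 * lam [:: i] <= K ^+ 2 * (K * expR (- v)).
  by rewrite ler_wpM2l ?exprn_ge0 ?(ltW K0)// ltW.
rewrite /kk mulrDl; have -> : K ^+ 2 * (K * expR (- v)) = K ^+ 3 * expR (- v) by ring.
lra.
Qed.

(** Pieces below the target scale lie within K^2 expR (- u) of their base points, so a cover of P at
    scale u suffices after enlarging the radii. *)
Lemma near_small_pieces e : 0 < e -> exists2 C : R, 0 < C &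
  forall y u v, P y -> 0 <= v <= u ->
   covby (near_pieces k y v `&` [set z | exists i f, [/\ lam [:: i] < expR (- u), F f & z = S i f]
      /\ (exists2 x, (S i @` X) x & enorm (x - y) < k * expR (- v)) /\ lam [:: i] < K * expR (- v)])
    (expR (- u)) (C * expR ((a + e) * u + b * v)).
Proof.
move=> e0; have [C C0 hC] := expbnd_enlarge kk1 Pab e0.
pose k' := 1 + K ^+ 2; have k'1 : 1 <= k' by rewrite lerDl exprn_ge0 ?ltW.
exists (cimg k' * C); first by rewrite mulr_gt0 ?cimg_gt0.
move=> y u v Py uv; rewrite -mulrA; apply: covby_refine => //; first exact: expR_gt0.
have [s sC hs] := hC y u v Py uv; exists s => // z [_ [i [f [[li Ff ->] [[x Sx xy] liv]]]]].
have [|c cs pc] := hs (p i); first by split; [exact: (piece_base liv Sx xy)|exists i].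
exists c => //; apply: le_lt_trans (enorm_tri _ _ (p i)) _.
have := dist_base_point i (limit_set_sub H Ff).
have : K ^+ 2 * lam [:: i] <= K ^+ 2 * expR (- u).
  by rewrite ler_wpM2l ?exprn_ge0 ?(ltW K0)// ltW.
by rewrite /k' mulrDl mul1r; lra.
Qed.

(** Pieces of size about expR (- s) are counted by covering P at scale s; each is a copy of F,
    covered with exponent a + e thanks to dim_B F <= a. The exponents (a + e) s + b v and (a + e) (u
    - s) add up to (a + e) u + b v. *)
Lemma near_medium_pieces e : 0 < e -> exists2 C : R, 0 < C &
  forall y u v s, P y -> 0 <= v <= s -> s <= u ->
   covby [set z | exists i f, [/\ expR (- s) <= lam [:: i], lam [:: i] < K * expR (1 - s), F f & z = S i f]
      /\ (exists2 x, (S i @` X) x & enorm (x - y) < k * expR (- v)) /\ lam [:: i] < K * expR (- v)]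
    (expR (- u)) (C * expR ((a + e) * u + b * v)).
Proof.
move=> e0; have [C C0 hC] := expbnd_enlarge kk1 Pab e0.
have [|D D0 hD] := @dimB_lt _ _ F F0 Fb (a + e); first by apply: le_lt_trans Fa _; rewrite ltrDl.
have a0 : 0 <= a by apply: le_trans Fa; exact: dimB_ge0.
have k21 : 1 <= 2 * K by have := K1; lra.
have Ke0 : 0 < K * expR 1 by rewrite mulr_gt0 ?expR_gt0.
exists ((M%:R + 1) * C * (cimg (2 * K) * D * expR ((a + e) * ln (K * expR 1)))).
  by rewrite !mulr_gt0 ?expR_gt0 ?cimg_gt0// ltr_wpDl.
move=> y u v s Py vs su; have /andP[v0 vs'] := vs.
have [sq [sqC hsq]] := hC y s v Py vs.
have [|W sW WP] := @words1_near (fun i => [/\ expR (- s) <= lam [:: i], lam [:: i] < K * expR (1 - s) &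
   (exists2 x, (S i @` X) x & enorm (x - y) < k * expR (- v)) /\ lam [:: i] < K * expR (- v)]) sq (expR (- s)) (expR_gt0 _).
  move=> i [h1 _ [[x Sx xy] h2]]; split => //; apply: hsq.
  by split; [exact: (piece_base h2 Sx xy)|exists i].
pose m := cimg (2 * K) * (D * expR ((a + e) * (u - s + ln (K * expR 1)))).
pose Wf := [seq i <- W | (expR (- s) <= lam [:: i]) && (lam [:: i] < K * expR (1 - s))].
pose Z := [set z | exists2 i, i \in Wf & (word_map S [:: i] @` F) z].
apply: (@covby_sub _ _ _ Z
   (expR (- u)) (expR (- u)) _ ((M * size sq)%:R * m)) => //.
- move=> z [i [f [[h1 h2 Ff ->] h3]]]; exists i; last by exists f.
  by rewrite mem_filter h1 h2/=; exact: WP.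
- rewrite /m natrM; apply: (@le_trans _ _ ((M%:R + 1) * (C * expR ((a + e) * s + b * v)) *
    (cimg (2 * K) * (D * expR ((a + e) * (u - s + ln (K * expR 1))))))).
    rewrite ler_wpM2r ?mulr_ge0 ?expR_ge0 ?(ltW D0) ?(ltW (cimg_gt0 k21))//.
    by apply: ler_pM => //; rewrite lerDl.
  have -> : (a + e) * u + b * v = ((a + e) * s + b * v) + (a + e) * (u - s) by ring.
  by rewrite mulrDr !expRD le_eqVlt; apply/orP; left; apply/eqP; ring.
apply: (@covby_sub _ _ _ Z (expR (- u)) (expR (- u)) _ ((size Wf)%:R * m)) => //.
  rewrite ler_wpM2r ?mulr_ge0 ?expR_ge0 ?(ltW D0) ?(ltW (cimg_gt0 k21))//.
  by rewrite ler_nat size_filter (leq_trans (count_size _ _)).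
apply: covby_bigcup_const => i; rewrite mem_filter => /andP[/andP[h1 h2] _].
pose s' := u + ln (lam [:: i]).
have lE : lam [:: i] = expR (ln (lam [:: i])) by rewrite lnK ?posrE.
have s'0 : 0 <= s' by move: h1; rewrite lE ler_expR /s'; lra.
apply: (@covby_word_image _ _ (expR (- s')) (2 * K)) => //.
- by move=> f /(limit_set_sub H).
- exact: expR_gt0.
- have -> : expR (- s') = expR (- u) / lam [:: i].
    by rewrite /s' opprD expRD (expRN (ln _)) -lE.
  by rewrite le_eqVlt; apply/orP; left; apply/eqP; field; rewrite gt_eqF.
apply: covby_sub (hD s' s'0) => //; rewrite ler_wpM2l ?(ltW D0)// ler_expR.
rewrite ler_wpM2l//; first by lra.
rewrite /s' -addrA lerD2l; have : ln (lam [:: i]) <= - s + ln (K * expR 1); last by lra.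
rewrite -ler_expR -lE expRD lnK ?posrE//; apply: le_trans (ltW h2) _.
by rewrite (addrC 1) expRD; rewrite le_eqVlt; apply/orP; left; apply/eqP; ring.
Qed.

(** The sizes between expR (- u) and expR (- v) fall into about u - v classes s = u - j; half of the
    loss e pays for their number. *)
Lemma near_pieces_covby e : 0 < e -> exists2 C : R, 0 < C &
  forall y u v, P y -> 0 <= v <= u ->
    covby (near_pieces k y v) (expR (- u)) (C * expR ((a + e) * u + b * v)).
Proof.
move=> e0; have e20 : 0 < e / 2 by rewrite divr_gt0.
have [C C0 hC] := near_small_pieces e20; have [D D0 hD] := near_medium_pieces e20.
pose c1 := (1 * (e / 2))^-1 + 1.
have c10 : 0 < c1 by rewrite ltr_wpDl// invr_ge0 mulr_ge0// ltW.
exists (C + c1 * D); first by rewrite addr_gt0 ?mulr_gt0.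
move=> y u v Py uv; have /andP[v0 vu] := uv; have u0 := le_trans v0 vu.
pose N := Num.truncn (u - v).
have uv0 : 0 <= u - v by rewrite subr_ge0.
have /andP[N1 N2] := truncn_itv uv0; rewrite -/N in N1 N2.
pose m := D * expR ((a + e / 2) * u + b * v).
pose G j := [set z | exists i f, [/\ expR (- (u - j%:R)) <= lam [:: i], lam [:: i] < K * expR (1 - (u - j%:R)), F f & z = S i f]
      /\ (exists2 x, (S i @` X) x & enorm (x - y) < k * expR (- v)) /\ lam [:: i] < K * expR (- v)].
have hG : covby [set z | exists2 j, j \in iota 0 N.+1 & G j z] (expR (- u)) ((size (iota 0 N.+1))%:R * m).
  apply: covby_bigcup_const => j; rewrite mem_iota/= add0n ltnS => jN.
  have jN' : j%:R <= u - v by apply: le_trans N1; rewrite ler_nat.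
  by apply: hD => //; first (apply/andP; split; lra); rewrite gerBl.
apply: covby_sub (covbyU (hC y u v Py uv) hG) => //.
  move=> z zN; have [i [f [li Ff zf xS]]] := zN.
  have [small|large] := ltP (lam [:: i]) (expR (- u)).
    by left; split => //; exists i, f.
  right; have lE : lam [:: i] = expR (ln (lam [:: i])) by rewrite lnK ?posrE.
  have t0 : 0 <= u + ln (lam [:: i]) by rewrite -(opprK u) addrC subr_ge0 -ler_expR -lE.
  have /andP[T1 T2] := truncn_itv t0; set T := Num.truncn _ in T1 T2.
  have [TN|NT] := leqP T N.
    exists T; first by rewrite mem_iota/= add0n ltnS.
    exists i, f; split; last by [].
    split => //; first by rewrite lE ler_expR; lra.
    apply: lt_le_trans (_ : 1 * expR (1 - (u - T%:R)) <= _); last first.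
      by rewrite ler_wpM2r ?expR_ge0.
    by rewrite mul1r lE ltr_expR; move: T2; rewrite -natr1; lra.
  (* The largest pieces, up to K expR (- v), go into the last class, whose upper bound carries the
     factor K. *)
  exists N; first by rewrite mem_iota/= add0n.
  exists i, f; split; last by [].
  have NT' : N%:R + 1 <= T%:R :> R by rewrite natr1 ler_nat.
  split => //; first by rewrite lE ler_expR; lra.
  apply: lt_le_trans li _; rewrite ler_wpM2l ?(ltW K0)// ler_expR.
  by move: N2; rewrite -natr1; lra.
rewrite size_iota [leRHS]mulrDl.
have eu : expR ((a + e / 2) * u + b * v) <= expR ((a + e) * u + b * v) by rewrite ler_expR; nra.
apply: lerD; first by rewrite ler_wpM2l ?(ltW C0).
have -> : (a + e) * u + b * v = (e / 2) * u + ((a + e / 2) * u + b * v).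
  by field.
rewrite expRD /m mulrCA -[leRHS]mulrA.
have -> : c1 * (D * (expR (e / 2 * u) * expR ((a + e / 2) * u + b * v))) =
  D * ((c1 * expR (e / 2 * u)) * expR ((a + e / 2) * u + b * v)) by ring.
rewrite ler_wpM2l ?(ltW D0)// ler_wpM2r ?expR_ge0//.
apply: le_trans (linear_le_expR e20 ltr01 u0); rewrite divr1 -natr1 lerD2r; lra.
Qed.

End LocalPieces.

(** The ball meets few parent cylinders by [count_words]. Each is pulled back to the scales u - l
    and v - l with l = - ln (lam w), where the pieces around one base point are covered by
    [near_pieces_covby]; the shift changes the exponent by - l (a + b + e / 2) <= 0. *)
Lemma expbnd_limit_set (a b : R) : 0 <= a + b -> dimB F <= a -> expbnd P a b ->
  expbnd F a b.
Proof.
move=> ab Fa Pab e e0; have e20 : 0 < e / 2 by rewrite divr_gt0.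
(* Two points of the pulled-back part are less than 2 K expR (- (v - l)) apart by the lower
   Lipschitz bound, and a base point is within K^3 expR (- (v - l)) of the points of its piece. *)
pose k := 2 * K + K ^+ 3.
have k0 : 0 < k by rewrite addr_gt0 ?mulr_gt0 ?exprn_gt0.
have [C C0 hC] := near_pieces_covby k0 Pab Fa e20.
have [D D0 hD] := count_words H e20.
have k21 : 1 <= 2 * K by have := K1; lra.
exists (D * (cimg (2 * K) * C)); first by rewrite !mulr_gt0// cimg_gt0.
move=> x u v Fx uv; have /andP[v0 vu] := uv.
have [W [W1 W2]] := hD v x v0.
pose Y w := [set z | exists i f, [/\ F f, lam (w ++ [:: i]) < expR (- v), z = S i f & enorm (word_map S w z - x) < expR (- v)]].
apply: (@covby_sub _ _ _ [set z | exists2 w, w \in W & (word_map S w @` Y w) z]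
  (expR (- u)) (expR (- u)) _ ((size W)%:R * (cimg (2 * K) * (C * expR ((a + e / 2) * u + b * v))))) => //.
- move=> z [xz Fz]; have [|w [i [f [w1 w2 Ff zf]]]] := limit_set_stop Fz (r := expR (- v)).
    by rewrite expR_gt0 -[leRHS]expR0 ler_expR oppr_le0.
  exists w; last by exists (S i f) => //; exists i, f; split => //; rewrite -zf.
  apply/W2; split => //; exists z; split => //.
  by exists (S i f) => //; apply: (ig_SX H); exact: (limit_set_sub H).
- have -> : (a + e) * u + b * v = (e / 2) * u + ((a + e / 2) * u + b * v).
    by field.
  rewrite [in leRHS]expRD.
  apply: (@le_trans _ _ (D * expR (e / 2 * v) * (cimg (2 * K) * (C * expR ((a + e / 2) * u + b * v))))).
    by rewrite ler_wpM2r ?mulr_ge0 ?expR_ge0 ?(ltW C0) ?(ltW (cimg_gt0 k21)).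
  have -> : D * (cimg (2 * K) * C) * (expR (e / 2 * u) * expR ((a + e / 2) * u + b * v)) =
    D * expR (e / 2 * u) * (cimg (2 * K) * (C * expR ((a + e / 2) * u + b * v))) by ring.
  rewrite ler_wpM2r ?mulr_ge0 ?expR_ge0 ?(ltW C0) ?(ltW (cimg_gt0 k21))//.
  by rewrite ler_wpM2l ?(ltW D0)// ler_expR ler_wpM2l// ltW.
apply: covby_bigcup_const => w /W2[lw _].
have [[z0 [j [g [Fg lj z0E z0x]]]]|Y0] := pselect (Y w !=set0); last first.
  exists [::]; first by rewrite !mulr_ge0 ?expR_ge0 ?(ltW C0) ?(ltW (cimg_gt0 k21)).
  by move=> ? [z Yz _]; exfalso; apply: Y0; exists z.
have lw1 := lam_le1 H w.
pose l := - ln (lam w); have l0 : 0 <= l by rewrite oppr_ge0 ln_le0.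
have lwE : lam w = expR (- l) by rewrite /l opprK lnK ?posrE.
have vl : l <= v by move: lw; rewrite lwE ler_expR lerN2.
have rE t : expR (- t) / lam w = expR (- (t - l)).
  by rewrite lwE -expRN -expRD; congr expR; ring.
have Xf f : F f -> X f := limit_set_sub H (x := f).
have XS i f : F f -> X (S i f) by move=> /Xf; exact: (ig_SX H).
apply: (@covby_word_image w _ (expR (- (u - l))) (2 * K)) => //.
- by move=> z [i [f [Ff _ -> _]]]; exact: XS.
- exact: expR_gt0.
- by rewrite -rE le_eqVlt; apply/orP; left; apply/eqP; field; rewrite gt_eqF.
have uvl : 0 <= v - l <= u - l by apply/andP; split; lra.
have Pj : P (p j) by exists j.
apply: covby_sub (hC (p j) (u - l) (v - l) Pj uvl) => //; last first.
  rewrite ler_wpM2l ?(ltW C0)// ler_expR.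
  have : 0 <= l * (a + b + e / 2) by rewrite mulr_ge0//; lra.
  lra.
move=> z [i [f [Ff li zE zx]]]; exists i, f; split => //.
  by have := lam_child li; rewrite rE.
exists z; first by exists f => //; exact: Xf.
apply: le_lt_trans (enorm_tri _ _ z0) _.
have h1 : enorm (z0 - p j) <= K ^+ 2 * lam [:: j] by rewrite z0E; apply: dist_base_point; exact: Xf.
have h2 : K ^+ 2 * lam [:: j] <= K ^+ 3 * expR (- (v - l)).
  have := lam_child lj; rewrite rE => /ltW h.
  by rewrite (exprSr K 2) -mulrA ler_wpM2l// exprn_ge0 ?ltW.
suff h3 : enorm (z - z0) < 2 * K * expR (- (v - l)) by rewrite /k mulrDl; lra.
rewrite -rE mulrA ltr_pdivlMr// mulrC.
apply: le_lt_trans (ig_colip H w _ _) _; rewrite ?zE ?z0E; [exact: XS|exact: XS|].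
rewrite -zE -z0E (mulrC 2) -mulrA ltr_pM2l//.
by apply: le_lt_trans (enorm_tri _ _ x) _; rewrite (enormBC x); lra.
Qed.

(** * From the limit set back to the base points *)

(** Points of P need not lie in F, so p i is compared with S_i f0 for one fixed f0 in F. Pieces at
    least as large as a scale number at most M near a ball of that scale; for smaller pieces p i is
    within K^2 times the scale of S_i f0. *)
Lemma covby_base_points : exists2 C : R, 0 < C & forall x u v m, P x -> 0 <= v <= u ->
  (forall y, F y -> covby (eball y (C * expR (- v)) `&` F) (expR (- u)) m) ->
  covby (eball x (expR (- v)) `&` P) (expR (- u)) (C * m).
Proof.
pose kF := 2 * K ^+ 2 + 2; pose k' := 1 + K ^+ 2.
have K2 : 1 <= K ^+ 2 by rewrite exprn_ege1.
have k'1 : 1 <= k' by rewrite /k'; lra.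
have ck := cimg_gt0 k'1.
exists (2 * M%:R + cimg k' + kF); first by have := ler0n R M; rewrite /kF; lra.
move=> x u v m Px uv hm; have /andP[v0 vu] := uv.
have euv : expR (- u) <= expR (- v) by rewrite ler_expR lerN2.
have m1 : 1 <= m.
  have [y Fy] := F0; apply: covby_ge1 (hm y Fy); exists y; split => //.
  rewrite /eball/= subrr enorm0 mulr_gt0 ?expR_gt0//.
  by have := ler0n R M; rewrite /kF; lra.
have mM : M%:R <= M%:R * m by rewrite ler_peMr.
have covl (Q : I -> Prop) (W : seq I) : (forall i, Q i -> i \in W) ->
    covby [set z | exists2 i, Q i & z = p i] (expR (- u)) (size W)%:R.
  move=> QW; exists (map p W); first by rewrite size_map.
  move=> z [i /QW iW ->]; exists (p i); first exact: map_f.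
  by rewrite subrr enorm0 expR_gt0.
pose Q1 i := expR (- v) <= lam [:: i] /\ enorm (p i - x) < expR (- v).
have [|W1 sW1 hW1] := @words1_near Q1 [:: x] _ (expR_gt0 (- v)).
  by move=> i [h1 h2]; split => //; exists x => //; exact: mem_head.
have c1 := covl _ _ hW1.
pose Q2 i := lam [:: i] < expR (- v) /\ enorm (p i - x) < expR (- v).
have [[j [lj jx]]|noQ2] := pselect (exists j, Q2 j); last first.
  apply: covby_sub c1 => //.
    move=> z [xz [i _ iz]]; exists i; last by [].
    split; last by rewrite iz.
    by rewrite leNgt; apply/negP => h; apply: noQ2; exists i; split => //; rewrite iz.
  apply: le_trans (_ : M%:R <= _); first by rewrite ler_nat; move: sW1; rewrite muln1.
  apply: le_trans mM _; rewrite ler_wpM2r//; first by lra.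
  by have := ler0n R M; rewrite /kF; lra.
have [f0 Ff0] := F0.
(* All small pieces with base point near x have their point S_i f0 near this one point of F, so a
   single use of the bound for F covers them. *)
have [s sm hs] := hm (S j f0) (limit_set_map H j Ff0).
have fi i : Q2 i -> exists2 c, c \in s & enorm (S i f0 - c) < expR (- u).
  move=> [li ix]; apply: hs; split; last exact: (limit_set_map H).
  rewrite /eball/=; apply: le_lt_trans (enorm_tri _ _ (p i)) _.
  have d1 := dist_base_point i (limit_set_sub H Ff0).
  have d2 := dist_base_point j (limit_set_sub H Ff0).
  have d3 := enorm_tri (p i) (S j f0) x; have d4 := enorm_tri x (S j f0) (p j).
  have e1 : K ^+ 2 * lam [:: i] <= K ^+ 2 * expR (- v) by rewrite ler_wpM2l ?ltW//; lra.
  have e2 : K ^+ 2 * lam [:: j] <= K ^+ 2 * expR (- v) by rewrite ler_wpM2l ?ltW//; lra.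
  rewrite (enormBC x (p j)) (enormBC (p j) (S j f0)) in d4.
  have : kF * expR (- v) <= (2 * M%:R + cimg k' + kF) * expR (- v).
    by rewrite ler_wpM2r ?expR_ge0//; have := ler0n R M; lra.
  have -> : kF * expR (- v) = 2 * (K ^+ 2 * expR (- v)) + 2 * expR (- v) by rewrite /kF; ring.
  lra.
pose Q3 i := Q2 i /\ expR (- u) <= lam [:: i].
pose Q4 i := Q2 i /\ lam [:: i] < expR (- u).
have c4 : covby [set z | exists2 i, Q4 i & z = p i] (expR (- u)) (cimg k' * m).
  apply: covby_refine => //; first exact: expR_gt0.
  exists s => // z [i [/fi[c cs ic] li] ->]; exists c => //.
  apply: le_lt_trans (enorm_tri _ _ (S i f0)) _; rewrite enormBC.
  have d1 := dist_base_point i (limit_set_sub H Ff0).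
  have e1 : K ^+ 2 * lam [:: i] <= K ^+ 2 * expR (- u) by rewrite ler_wpM2l ?ltW//; lra.
  by rewrite /k' mulrDl mul1r; lra.
have c3 : covby [set z | exists2 i, Q3 i & z = p i] (expR (- u)) (M%:R * m).
  have fin c : exists W : seq I, (size W <= M)%N /\
      forall i, expR (- u) <= lam [:: i] -> enorm (S i f0 - c) < expR (- u) -> i \in W.
    have [|W [uW sW WP]] := @finite_set_of_bound _
        [set i | expR (- u) <= lam [:: i] /\ enorm (S i f0 - c) < expR (- u)] M.
      move=> W uW hW; rewrite -(size_map (fun i => [:: i])).
      apply: (ig_count H (expR_gt0 (- u)) (n := 1%N) (z := c)).
        by rewrite map_inj_uniq// => i i' [].
      move=> _ /mapP[i /hW[h1 h2] ->]; split => //.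
      by exists (S i f0); split => //; exists f0 => //; exact: (limit_set_sub H).
    by exists W; split => // i h1 h2; apply/WP.
  have /choice[W hW] := fin.
  apply: (@covby_sub _ _ _ [set z | exists2 c, c \in s & [set z | exists2 i, i \in W c & z = p i] z]
    (expR (- u)) (expR (- u)) _ ((size s)%:R * M%:R)) => //.
  - by move=> z [i [/fi[c cs ic] li] ->]; exists c => //; exists i => //; exact: (hW c).2.
  - by rewrite mulrC ler_wpM2l.
  apply: covby_bigcup_const => c cs; apply: covby_sub (covl (fun i => i \in W c) (W c) _) => //.
  by rewrite ler_nat; exact: (hW c).1.
apply: covby_sub (covbyU c1 (covbyU c3 c4)) => //.
  move=> z [xz [i _ iz]].
  have [h|h] := leP (expR (- v)) (lam [:: i]); [left|right].
    by exists i => //; split => //; rewrite iz.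
  have q2 : Q2 i by split => //; rewrite iz.
  by have [h'|h'] := leP (expR (- u)) (lam [:: i]); [left|right]; exists i.
have : (size W1)%:R <= M%:R :> R by rewrite ler_nat; move: sW1; rewrite muln1.
have : 0 <= kF * m by rewrite mulr_ge0 /kF//; lra.
have -> : (2 * M%:R + cimg k' + kF) * m = M%:R * m + M%:R * m + cimg k' * m + kF * m by ring.
lra.
Qed.

Lemma spec_base_le (theta : R) : 0 < theta < 1 ->
  assouad_spec theta P <= assouad_spec theta F.
Proof.
move=> th; have /andP[t0 t1] := th; apply: ler_of_forall_gt => s /(spec_lt th F0)[C C0 hC].
apply: (spec_le th P0).
have [D D0 hD] := covby_base_points.
have k1 : 1 <= 1 + D by lra.
exists (D * (cimg 2 * cimg (1 + D) * C)).
  by rewrite !mulr_gt0 ?cimg2_gt0 ?cimg_gt0.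
move=> x v Px v0; rewrite -mulrA; apply: hD => //.
  by rewrite v0/= ler_peMl// invf_ge1// ltW.
move=> y Fy; rewrite -mulrA.
apply: (@covby_localize R d _ (fun=> F) (expR (- v))); rewrite ?expR_gt0//.
- by rewrite mulr_ge0 ?expR_ge0 ?ltW.
- apply: (@covby_sub _ _ _ (eball y ((1 + D) * expR (- v))) (expR (- v)) (expR (- v)) _ (cimg (1 + D))) => //.
    move=> z [+ _]; rewrite /eball/= mulrDl mul1r => h.
    by apply: lt_trans h _; rewrite ltrDr expR_gt0.
  have := @covby_bounded R d (eball y ((1 + D) * expR (- v))) y ((1 + D) * expR (- v)) (expR (- v)).
  rewrite mulfK ?gt_eqF ?expR_gt0//; apply => //.
  by rewrite ler_peMl ?expR_ge0// expR_gt0.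
move=> c [_ Fc]; apply: covby_sub (hC c v Fc v0) => // z [zc [_ Fz]].
by split.
Qed.

Lemma dimB_base_le : dimB P <= dimB F.
Proof.
apply: ler_of_forall_gt => s /(dimB_lt F0 Fb)[C C0 hC].
apply: (dimB_le P0 Pb) => t st; apply: boxbnd_mono (ltW st) _.
have [D D0 hD] := covby_base_points.
have [C' C'0 hC'] := ebounded_box Pb.
exists (cimg 2 * C' * (D * C)).
  by rewrite !mulr_gt0 ?cimg2_gt0.
move=> u u0.
(* P is covered by boundedly many unit balls, and the comparison with F is applied at v = 0. *)
have := hC' 0 (lexx _); rewrite mulr0 oppr0 expR0 mulr1 => h0.
rewrite -[_ * _ * expR _]mulrA; apply: (@covby_localize R d _ (fun=> P) 1); rewrite ?ltr01//.
  by rewrite !mulr_ge0 ?expR_ge0 ?ltW.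
move=> c Pc; have := hD c u 0 (C * expR (s * u)) Pc.
rewrite oppr0 expR0 lexx u0/= mulrA => /(_ isT); apply.
by move=> y Fy; apply: covby_sub (hC u u0) => // z [].
Qed.

Lemma dimH_limit_set_le : dimH F <= dimB F.
Proof. exact: dimH_le_dimB. Qed.

Lemma dimB_limit_set : dimB F = Num.max (dimH F) (dimB P).
Proof.
apply/eqP; rewrite eq_le dimB_limit_set_le ge_max dimB_base_le dimH_limit_set_le//.
Qed.

End Dims.

(** * The geometry of a CIFS *)

Section Topology.
Variables (R : realType) (d : nat).
Implicit Types (x y z v : 'rV[R]_d) (A B U : set 'rV[R]_d).

Lemma coord_le_norm v j : `|v ord0 j| <= `|v|.
Proof.
rewrite [leRHS]/Num.Def.normr/= mx_normrE.
exact: (le_bigmax _ (fun i => `|v i.1 i.2|) (ord0, j)).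
Qed.

Lemma enorm_le_norm v : enorm v <= d%:R * `|v|.
Proof. by apply: enorm_le_coord => j; exact: coord_le_norm. Qed.

Lemma norm_le_enorm v : `|v| <= enorm v.
Proof.
rewrite [leLHS]/Num.Def.normr/= mx_normrE (bigmax_le _ (enorm_ge0 v))//= => -[i j] _.
by rewrite /= ord1; exact: coord_le_enorm.
Qed.

Lemma nbhs_eballP x A : nbhs x A <-> exists2 r : R, 0 < r & eball x r `<=` A.
Proof.
split.
  move=> /nbhs_ballP[r /= r0 rA]; exists r => // y xy; apply: rA.
  rewrite -ball_normE /ball_/=; apply: le_lt_trans (norm_le_enorm _) _.
  by rewrite enormBC.
move=> [r r0 rA]; apply/nbhs_ballP; exists (r / d.+1%:R); first by rewrite /= divr_gt0.
move=> y; rewrite -ball_normE /ball_/= => xy; apply: rA; rewrite /eball/= enormBC.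
apply: le_lt_trans (enorm_le_norm _) _.
apply: le_lt_trans (_ : d%:R * (r / d.+1%:R) < _); first by rewrite ler_wpM2l// ltW.
by rewrite mulrCA gtr_pMr// ltr_pdivrMr// mul1r ltr_nat.
Qed.

Lemma open_eball x (r : R) : open (eball x r).
Proof.
rewrite openE => y /= xy; apply/nbhs_eballP; exists (r - enorm (y - x)).
  by rewrite subr_gt0.
move=> z; rewrite /eball/= => yz; apply: le_lt_trans (enorm_tri _ _ y) _; lra.
Qed.

Lemma open_eballP A : open A <-> forall x, A x -> exists2 r : R, 0 < r & eball x r `<=` A.
Proof.
rewrite openE; split => h x Ax; first by apply/nbhs_eballP; exact: h.
by apply/nbhs_eballP; exact: h.
Qed.

Definition ceball x (r : R) := [set y | enorm (y - x) <= r].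

Lemma closed_ceball x (r : R) : closed (ceball x r).
Proof.
rewrite -openC; apply/open_eballP => y /negP; rewrite -ltNge => ry.
exists (enorm (y - x) - r); first by rewrite subr_gt0.
move=> z; rewrite /eball/= => zy; apply/negP; rewrite -ltNge.
have := enorm_tri y x z; rewrite (enormBC y z); lra.
Qed.

Lemma bounded_setP A : bounded_set A <-> exists M : R, forall x, A x -> enorm x <= M.
Proof.
split.
  move=> [M [_ hM]]; exists (d%:R * (M + 1)) => x Ax.
  apply: le_trans (enorm_le_norm x) _; rewrite ler_wpM2l//.
  by apply: hM => //; rewrite ltrDl.
move=> [M hM]; exists M; split; first exact: num_real.
by move=> N MN x Ax; apply: le_trans (norm_le_enorm x) (le_trans (hM x Ax) (ltW MN)).
Qed.

Lemma compact_ceball x (r : R) : compact (ceball x r).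
Proof.
apply: bounded_closed_compact; last exact: closed_ceball.
apply/bounded_setP; exists (enorm x + r) => y; rewrite /ceball/= => h.
by have := ler_enormD (y - x) x; rewrite subrK; lra.
Qed.

Lemma compact_uniform_nbhd A U : compact A -> open U -> A `<=` U ->
  exists2 r : R, 0 < r & forall x, A x -> eball x r `<=` U.
Proof.
move=> cA oU AU.
have /(compact_near_coveringP A).1 := cA.
move=> /(_ R (0^'+ : set_system R) (fun r x => eball x r `<=` U) _)[].
  move=> x Ax; have /open_eballP/(_ _ (AU _ Ax))[r r0 rU] := oU.
  exists (eball x (r / 2), [set s : R | 0 < s < r / 2]) => /=.
    split; first by apply/nbhs_eballP; exists (r / 2) => //; rewrite divr_gt0.
    near=> s; apply/andP; split; near: s; first exact: nbhs_right_gt.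
    by apply: nbhs_right_lt; rewrite divr_gt0.
  move=> [x' s] /= [xx' /andP[s0 sr]] y; rewrite /eball/= => yx'; apply: rU.
  rewrite /eball/=; apply: le_lt_trans (enorm_tri _ _ x') _.
  by move: xx'; rewrite /eball/=; lra.
move=> e /= e0 he; exists (e / 2); first by rewrite divr_gt0.
move=> x Ax; apply: he => //=; last by rewrite divr_gt0.
by rewrite sub0r normrN gtr0_norm ?divr_gt0//; lra.
Unshelve. all: by end_near.
Qed.

(* x0 is joined to every point of X by a chain in X with steps shorter than r;
   by total boundedness the length of the chain can be chosen uniformly. *)
Lemma connected_chains A (r : R) x0 : connected A -> ebounded A -> A x0 -> 0 < r ->
  exists N : nat, forall Q : nat -> set 'rV[R]_d, Q 0%N x0 ->
    (forall n x y, A x -> A y -> Q n x -> enorm (y - x) < r -> Q n.+1 y) ->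
    (forall n, Q n `<=` Q n.+1) -> A `<=` Q N.
Proof.
move=> cA [z _ [rho rho0 Az]] Ax0 r0.
pose Rch := fix Rch n := if n is n'.+1 then
  [set y | A y /\ exists2 x, Rch n' x & enorm (y - x) < r] else [set x0].
have RA n y : Rch n y -> A y by case: n => [->|n []].
pose B := \bigcup_n Rch n.
have step x y : B x -> A y -> enorm (y - x) < r -> B y.
  by move=> [n _ Rx] Ay yx; exists n.+1 => //; split => //; exists x.
(* The reachable set is non-empty, relatively open and relatively closed. *)
have BA : B = A.
  apply: cA.
  - by exists x0; exists 0%N.
  - exists (\bigcup_(x in B) eball x r); first by apply: bigcup_open => x _; exact: open_eball.
    apply/seteqP; split=> [y By|y [Ay [x Bx yx]]]; last exact: step yx.
    split; first by have [n _ /RA] := By.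
    by exists y => //; rewrite /eball/= subrr enorm0.
  - exists (~` \bigcup_(x in A `\` B) eball x r).
      by apply: open_closedC; apply: bigcup_open => x _; exact: open_eball.
    apply/seteqP; split=> [y By|y [Ay h]].
      have [n _ /RA Ay] := By; split => // -[x [Ax Bx] yx].
      by apply: Bx; apply: step Ax _; [exact: By|rewrite enormBC].
    apply: contrapT => By; apply: h; exists y => //.
    by rewrite /eball/= subrr enorm0.
have er : 0 < Num.min r rho <= rho by rewrite lt_min r0 rho0/= ge_min lexx orbT.
have [Y [_ _ YA hY _]] := separated_net er Az.
have [f hf] : exists f : 'rV[R]_d -> nat, forall y, y \in Y -> Rch (f y) y.
  have h y : exists n, y \in Y -> Rch n y.
    have [yY|] := boolP (y \in Y); last by exists 0%N.
    by have := YA _ yY; rewrite -BA => -[n _ Rn]; exists n.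
  by have [f hf] := choice h; exists f.
exists (\max_(y <- Y) f y).+1 => Q Q0 Qstep Qmono.
have RQ n : Rch n `<=` Q n.
  elim: n => [x ->//|n ih y [Ay [x Rx yx]]].
  by apply: (Qstep n x) => //; [exact: RA Rx|exact: ih].
have Qle m n : (m <= n)%N -> Q m `<=` Q n.
  by move=> /subnK <-; elim: (n - m)%N => // k ih x /ih; exact: Qmono.
move=> x Ax; have [y yY xy] := hY x Ax.
apply: (Qstep _ y) => //; first exact: YA.
  apply: (Qle (f y)); last exact/RQ/hf.
  exact: leq_bigmax_seq.
by apply: lt_le_trans xy _; rewrite ge_min lexx.
Qed.

Lemma is_diff_line x v (t : R) :
  is_diff t (fun s : R => x + s *: v) (fun h : R => h *: v).
Proof.
by apply: is_diff_eq; rewrite add0r.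
Qed.

(** The mean value theorem for the scalar function t -> dot (f (x + t v)) e with e = f (x + v) - f
    x, followed by Cauchy-Schwarz. *)
Lemma enorm_mvt (f : 'rV[R]_d -> 'rV[R]_d) x v (A : R) : 0 <= A ->
  (forall t : R, 0 <= t <= 1 -> differentiable f (x + t *: v) /\
     enorm ('d f (x + t *: v) v) <= A * enorm v) ->
  enorm (f (x + v) - f x) <= A * enorm v.
Proof.
move=> A0 hf; set e := f (x + v) - f x.
pose g (t : R) := f (x + t *: v).
have dg (t : R) : 0 <= t <= 1 -> is_derive t 1 g ('d f (x + t *: v) v).
  move=> /hf[df _].
  have df' : is_diff (x + t *: v) f ('d f (x + t *: v)) by exact: DiffDef.
  have dc := is_diff_line x v t.
  have dd : is_diff t g ('d f (x + t *: v) \o (fun h : R => h *: v)).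
    exact: is_diff_comp.
  have gd : differentiable g t by exact: ex_diff.
  apply: DeriveDef; first exact: diff_derivable.
  by case: dd => _ dE; rewrite deriveE// dE/= scale1r.
pose phi (t : R) := dot (g t) e.
have dphi (t : R) : 0 <= t <= 1 -> is_derive t 1 phi (dot ('d f (x + t *: v) v) e).
  move=> /dg [g1 g2].
  have gj j : is_derive t 1 (fun s => g s ord0 j) ('d f (x + t *: v) v ord0 j).
    apply: DeriveDef; first exact: (derivable_mxP g t 1).1.
    by rewrite -g2 derive_mx// mxE.
  rewrite /phi /dot.
  have -> : (fun s => \sum_(j < d) g s ord0 j * e ord0 j) =
     \sum_(j < d) (fun s => e ord0 j *: (g s ord0 j : R^o)).
    by apply/funext => s; rewrite fct_sumE; apply: eq_bigr => j _; rewrite mulrC.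
  apply: is_derive_eq; apply: eq_bigr => j _; exact: mulrC.
have [||c c01] := @MVT R phi (fun t => dot ('d f (x + t *: v) v) e) 0 1 ltr01.
- by move=> t; rewrite in_itv/= => /andP[t0 t1]; apply: dphi; rewrite !ltW.
- apply: derivable_within_continuous => t; rewrite in_itv/= => t01.
  by have [] := dphi t t01.
rewrite subr0 mulr1 /phi /g scale1r scale0r addr0.
have -> : dot (f (x + v)) e - dot (f x) e = enorm e ^+ 2.
  rewrite -dotvv /dot -sumrB; apply: eq_bigr => j _.
  by rewrite -mulrBl; congr (_ * _); rewrite /e !mxE.
move=> he; move: c01; rewrite in_itv/= => /andP[c0 c1].
have c01 : 0 <= c <= 1 by rewrite !ltW.
have [_ hc] := hf c c01.
have [e0|e0] := eqVneq (enorm e) 0; first by rewrite e0 mulr_ge0 ?enorm_ge0.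
have e1 : 0 < enorm e by rewrite lt_neqAle eq_sym e0 enorm_ge0.
rewrite -(ler_pM2r e1) -expr2 he; apply: le_trans (dot_le_enorm _ _) _.
by rewrite ler_wpM2r ?enorm_ge0.
Qed.

End Topology.

(** * Packing an open set by dyadic cells *)

Section Dyadic.
Variables (R : realType) (d : nat).
Hypothesis d_gt0 : (0 < d)%N.

Let j0 : 'I_d := Ordinal d_gt0.

Lemma box_vol_ge0 (a b : 'rV[R]_d) : 0 <= box_vol a b.
Proof. by apply: prodr_ge0 => j _; rewrite le_max lexx. Qed.

Lemma box_vol0 : box_vol (0 : 'rV[R]_d) 0 = 0.
Proof.
rewrite /box_vol; apply/eqP/prodf_eq0; exists j0 => //.
by rewrite mxE subrr maxxx.
Qed.

Lemma lebesgue_d_le_lists (A : set 'rV[R]_d) (l : nat -> seq ('rV[R]_d * 'rV[R]_d))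
    (V : R) :
  (forall x, A x -> exists n, exists2 b, b \in l n & box b.1 b.2 x) ->
  (forall n, \sum_(m < n) \sum_(b <- l m) box_vol b.1 b.2 <= V) ->
  (lebesgue_d A <= V%:E)%E.
Proof.
move=> Al lV; pose e : 'rV[R]_d * 'rV[R]_d := (0, 0).
(* The degenerate box e, of volume 0, in front of each list makes [L n] at least n long, so entry m
   of [L m.+1] is genuine and never changes later. *)
pose L n := flatten [seq e :: l m | m <- iota 0 n].
have LS n : L n.+1 = L n ++ (e :: l n).
  rewrite /L; have -> : iota 0 n.+1 = iota 0 n ++ [:: n] by rewrite -[n.+1]addn1 iotaD.
  by rewrite map_cat flatten_cat/= cats0.
have Lsize n : (n <= size (L n))%N.
  by elim: n => // n ih; rewrite LS size_cat/= addnS ltnS (leq_trans ih)// leq_addr.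
have Lpre m n : (m <= n)%N -> forall i, (i < size (L m))%N ->
    (i < size (L n))%N /\ nth e (L n) i = nth e (L m) i.
  move=> /subnK <-; elim: (n - m)%N => // k ih i im; have [h1 h2] := ih i im.
  by rewrite addSn LS size_cat nth_cat h1 ltn_addr.
pose ab m := nth e (L m.+1) m.
apply: le_trans (_ : (\sum_(0 <= k <oo) (box_vol (ab k).1 (ab k).2)%:E <= _)%E).
  apply: ereal_inf_lbound; exists ab => // x /Al[n [b bl bx]].
  have bL : b \in L n.+1 by rewrite LS mem_cat inE bl !orbT.
  exists (index b (L n.+1)) => //.
  have iL : (index b (L n.+1) < size (L n.+1))%N by rewrite index_mem.
  have -> : ab (index b (L n.+1)) = b; last exact: bx.
  rewrite /ab; set i := index _ _ in iL *.
  have [ni|/ltnW ni] := leqP n.+1 i.+1.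
    by rewrite (Lpre _ _ ni i iL).2 nth_index.
  by rewrite -(Lpre _ _ ni i (Lsize _)).2 nth_index.
apply: lime_le; first by apply: is_cvg_nneseries => n _ _; rewrite lee_fin box_vol_ge0.
apply: nearW => M; rewrite sumEFin lee_fin.
pose f (b : 'rV[R]_d * 'rV[R]_d) := box_vol b.1 b.2.
have f0 b : 0 <= f b by exact: box_vol_ge0.
have -> : \sum_(0 <= k < M) box_vol (ab k).1 (ab k).2 = \sum_(0 <= k < M) f (nth e (L M) k).
  rewrite big_nat [RHS]big_nat; apply: eq_bigr => k /andP[_ kM].
  by rewrite (Lpre _ _ kM k (Lsize _)).2.
apply: (@le_trans _ _ (\sum_(b <- L M) f b)).
  rewrite [leRHS](big_nth e) (big_cat_nat (leq0n M) (Lsize M)).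
  by rewrite lerDl sumr_ge0.
apply: le_trans (lV M); rewrite /L big_flatten big_map -[in iota 0 M](subn0 M).
rewrite -/(index_iota 0 M) big_mkord; apply: ler_sum => m _.
by rewrite big_cons /f/= box_vol0 add0r.
Qed.

Section Grid.
Variable Om : set 'rV[R]_d.
Hypotheses (Om_open : open Om) (Om_bounded : ebounded Om).
Implicit Types (k : 'rV[int]_d) (n : nat).

Let h n : R := (2 ^+ n)^-1.

Let h_gt0 n : 0 < h n.
Proof. by rewrite invr_gt0 exprn_gt0. Qed.

Let hS n : h n = 2 * h n.+1.
Proof. by rewrite /h exprS invfM mulrA mulfV// mul1r. Qed.

Definition grid_point n k : 'rV[R]_d := \row_j ((k ord0 j)%:~R * h n).
Definition grid_next n k : 'rV[R]_d := \row_j (((k ord0 j)%:~R + 1) * h n).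

(* The factor d makes interior cells stable under subdivision. *)
Definition interior_cell n k := eball (grid_point n k) (d%:R * h n) `<=` Om.

Let d1 : 1 <= d%:R :> R.
Proof. by rewrite ler1n. Qed.

Let grid_sep n k k' : k != k' -> h n <= enorm (grid_point n k - grid_point n k').
Proof.
move=> kk'; have [j kj] : exists j, k ord0 j != k' ord0 j.
  apply/existsP; apply: contraNT kk' => /existsPn H; apply/eqP/rowP => j.
  by have := H j; rewrite negbK => /eqP.
apply: le_trans (coord_le_enorm _ j); rewrite !mxE -mulrBl normrM (gtr0_norm (h_gt0 n)).
rewrite ler_peMl ?(ltW (h_gt0 n))// -rmorphB/= -intr_norm (ler_int _ 1).
by rewrite -gtz0_ge1 normr_gt0 subr_eq0.
Qed.

Let cells_ex n : exists s : seq 'rV[int]_d, uniq s /\ forall k, interior_cell n k <-> k \in s.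
Proof.
have [z _ [rho rho0 Oz]] := Om_bounded.
pose rho' := rho + h n.
have [|s [us _ sP]] := @finite_set_of_bound _ [set k | interior_cell n k]
   (Num.truncn ((packc R d * (rho' / h n)) ^+ d)); last by exists s.
move=> s us sk; rewrite truncn_ge_nat; last first.
  rewrite exprn_ge0// mulr_ge0//; first by have := packc_ge1 R d; lra.
  by rewrite divr_ge0 ?addr_ge0 ?ltW.
have ginj : {in s &, injective (grid_point n)}.
  move=> k k' _ _ e; apply/eqP/negPn/negP => /(@grid_sep n).
  by rewrite e subrr enorm0 leNgt h_gt0.
rewrite -(size_map (grid_point n)); apply: (@separated_card _ _ z) => //.
- by rewrite h_gt0/= lerDr ltW.
- by rewrite map_inj_in_uniq.
- move=> _ /mapP[k /sk kO ->]; apply: lt_trans (_ : rho < _); last by rewrite ltrDl.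
  apply: Oz; apply: kO; rewrite /eball/= subrr enorm0.
  by rewrite mulr_gt0// (lt_le_trans ltr01 d1).
- move=> _ _ /mapP[k ks ->] /mapP[k' k's ->] kk'; apply: grid_sep.
  by apply: contra_neq kk' => ->.
Qed.

Let cells n := sval (cid (cells_ex n)).
Let cells_uniq n : uniq (cells n). Proof. exact: (svalP (cid (cells_ex n))).1. Qed.
Let cellsP n k : interior_cell n k <-> k \in cells n.
Proof. exact: (svalP (cid (cells_ex n))).2. Qed.

Let par k : 'rV[int]_d := \row_j ((k ord0 j) %/ 2)%Z.
Let child k (e : {ffun 'I_d -> bool}) : 'rV[int]_d := \row_j (k ord0 j * 2 + (e j : nat)%:Z).

Let par_child k e : par (child k e) = k.
Proof.
apply/rowP => j; rewrite !mxE divzMDl//; by case: (e j); rewrite addr0.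
Qed.

Let interior_child n k : interior_cell n (par k) -> interior_cell n.+1 k.
Proof.
move=> H x xk; apply: H; rewrite /eball/= in xk *.
apply: le_lt_trans (enorm_tri _ _ (grid_point n.+1 k)) _.
suff : enorm (grid_point n.+1 k - grid_point n (par k)) <= d%:R * h n.+1.
  by rewrite (hS n); lra.
apply: enorm_le_coord => j; rewrite !mxE (hS n) mulrA -mulrBl normrM (gtr0_norm (h_gt0 _)).
rewrite ler_piMl ?(ltW (h_gt0 _))//.
have -> : (k ord0 j)%:~R - ((k ord0 j %/ 2)%Z)%:~R * 2 = ((k ord0 j %% 2)%Z)%:~R :> R.
  by rewrite [X in X%:~R - _](divz_eq (k ord0 j) 2) rmorphD rmorphM/= addrAC subrr add0r.
by rewrite -intr_norm (ler_int _ _ 1); lia.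
Qed.

(** The maximal interior cells: a Whitney-type decomposition of Om. *)
Let news n := if n is n'.+1 then [seq k <- cells n | par k \notin cells n'] else cells 0.

(** All 2^d children of an interior cell are interior, and they differ from the cells without
    interior parent. Hence [vol] is non-decreasing and bounds the volume of the maximal cells. *)
Let size_step n : (size (news n.+1) + size (cells n) * 2 ^ d <= size (cells n.+1))%N.
Proof.
pose ch := [seq child k e | k <- cells n, e <- enum {: {ffun 'I_d -> bool}}].
have sch : size ch = (size (cells n) * 2 ^ d)%N.
  by rewrite size_allpairs -cardE card_ffun card_bool card_ord.
have uch : uniq ch.
  apply: allpairs_uniq => //; first exact: enum_uniq.
  move=> [k e] [k' e'] _ _ /= kk'.
  have ek : k = k' by rewrite -(par_child k e) kk' par_child.
  rewrite ek in kk' *; congr pair; apply/ffunP => j.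
  move: kk' => /rowP/(_ j); rewrite !mxE => /addrI.
  by case: (e j); case: (e' j).
rewrite -sch -size_cat; apply: uniq_leq_size.
  rewrite cat_uniq uch andbT filter_uniq//=.
  apply/hasPn => _ /allpairsP[[k e] [/= kn _ ->]].
  by rewrite /news mem_filter par_child kn.
move=> k; rewrite mem_cat => /orP[|/allpairsP[[k' e] [/= kn _ ->]]].
  by rewrite mem_filter => /andP[].
by apply/cellsP/interior_child; rewrite par_child; apply/cellsP.
Qed.

Let vol n : R := (size (cells n))%:R * h n ^+ d.

Let vol_step n : (size (news n.+1))%:R * h n.+1 ^+ d + vol n <= vol n.+1.
Proof.
have -> : vol n = ((size (cells n) * 2 ^ d)%N)%:R * h n.+1 ^+ d.
  by rewrite /vol hS exprMn natrM natrX; ring.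
by rewrite -mulrDl -natrD ler_wpM2r ?exprn_ge0 ?(ltW (h_gt0 _))// ler_nat size_step.
Qed.

Let vol_news n : \sum_(m < n.+1) (size (news m))%:R * h m ^+ d <= vol n.
Proof.
elim: n => [|n ih]; first by rewrite big_ord1.
by rewrite big_ord_recr/= addrC; apply: le_trans (vol_step n); rewrite lerD2l.
Qed.

Let vol_mono m n : (m <= n)%N -> vol m <= vol n.
Proof.
move=> /subnK <-; elim: (n - m)%N => // k ih; apply: le_trans ih _.
rewrite addSn; apply: le_trans (vol_step _); rewrite lerDr.
by rewrite mulr_ge0 ?exprn_ge0 ?(ltW (h_gt0 _)).
Qed.

Let grid_box n k x : box (grid_point n k) (grid_next n k) x ->
  enorm (x - grid_point n k) <= d%:R * h n.
Proof.
move=> kx; apply: enorm_le_coord => j; have := kx j; rewrite !mxE mulrDl mul1r => /andP[h1 h2].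
by rewrite ger0_norm ?subr_ge0 ?(ltW h1)//; lra.
Qed.

Let news_cover x : Om x -> exists n, exists2 k, k \in news n & box (grid_point n k) (grid_next n k) x.
Proof.
move=> Ox; have [r r0 rO] := (open_eballP Om).1 Om_open x Ox.
pose P n := `[< exists2 k, k \in cells n & box (grid_point n k) (grid_next n k) x >].
have exP : exists n, P n.
  (* Every point within d h of the corner of the cell of x is within 2 d h of x. *)
  have [n hn] : exists n, 2 * d%:R * h n < r.
    pose q := r^-1 * (2 * d%:R); pose n := (Num.truncn q).+1; exists n.
    rewrite ltr_pdivrMr ?exprn_gt0// -ltr_pdivrMl//.
    apply: lt_le_trans (truncnS_gt _) _.
    by rewrite -natrX ler_nat ltnW// ltn_expl.
  pose k : 'rV[int]_d := \row_j (Num.ceil (x ord0 j * 2 ^+ n) - 1).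
  have kx : box (grid_point n k) (grid_next n k) x.
    move=> j; rewrite !mxE; have /andP[c1 c2] := ceil_itv (x ord0 j * 2 ^+ n).
    rewrite ltr_pdivrMr ?exprn_gt0// c1/= ler_pdivlMr ?exprn_gt0//.
    by rewrite rmorphB/= subrK.
  exists n; apply/asboolP; exists k => //.
  apply/cellsP => y yk; apply: rO; rewrite /eball/= in yk *.
  have := grid_box kx; have := enorm_tri y x (grid_point n k).
  by rewrite (enormBC (grid_point n k) x); lra.
have [n /asboolP[k kn kx] nmin] := ex_minnP exP.
exists n, k => //; case: n kn kx nmin => [//|n] kn kx nmin.
rewrite mem_filter kn andbT; apply/negP => pk.
have : P n; last by move=> /nmin; rewrite ltnn.
apply/asboolP; exists (par k) => // j; have := kx j; rewrite !mxE (hS n).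
have : ((k ord0 j)%:~R : R) = ((k ord0 j %/ 2)%Z)%:~R * 2 + ((k ord0 j %% 2)%Z)%:~R.
  by rewrite {1}(divz_eq (k ord0 j) 2) rmorphD rmorphM.
move=> ->; set q := (_ %/ _)%Z; set t := (_ %% _)%Z.
have t0 : 0 <= t%:~R :> R by rewrite ler0z /t; lia.
have t1 : t%:~R <= 1 :> R by rewrite (ler_int _ _ 1) /t; lia.
have := h_gt0 n.+1; nra.
Qed.

(** If every level had interior volume at most V / 2, the maximal cells would cover Om with total
    volume at most V / 2. From a good level on, the corners of the interior cells of side h, where
    eta <= h < 2 eta, are the required points; the 2^d in the constant comes from h < 2 eta. *)
Lemma interior_packing (V : R) : 0 < V -> (V%:E <= lebesgue_d Om)%E ->
  exists2 eta0 : R, 0 < eta0 & forall eta, 0 < eta <= eta0 ->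
    exists Y : seq 'rV[R]_d, [/\ uniq Y, eseparated eta Y,
      forall y, y \in Y -> eball y eta `<=` Om &
      V / (2 * 2 ^+ d) <= (size Y)%:R * eta ^+ d].
Proof.
move=> V0 VO.
have [n0 hn0] : exists n, V / 2 <= vol n.
  apply: contrapT => H.
  have volV n : vol n <= V / 2 by rewrite leNgt; apply/negP => /ltW h'; apply: H; exists n.
  have : (lebesgue_d Om <= (V / 2)%:E)%E.
    apply: (@lebesgue_d_le_lists _ (fun n => [seq (grid_point n k, grid_next n k) | k <- news n])).
      move=> x /news_cover[n [k kn kx]]; exists n, (grid_point n k, grid_next n k) => //.
      exact: map_f.
    have bv n k : box_vol (grid_point n k) (grid_next n k) = h n ^+ d.
      rewrite /box_vol (eq_bigr (fun=> h n)) ?prodr_const ?card_ord// => j _.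
      rewrite !mxE mulrDl mul1r addrAC subrr add0r max_r//; exact: ltW.
    have E n : \sum_(b <- [seq (grid_point n k, grid_next n k) | k <- news n]) box_vol b.1 b.2
       = (size (news n))%:R * h n ^+ d.
      rewrite big_map (eq_bigr (fun=> h n ^+ d)); last by move=> k _; rewrite /= bv.
      by rewrite big_const_seq count_predT iter_addr_0 mulr_natl.
    move=> [|n]; first by rewrite big_ord0 divr_ge0 ?ltW.
    rewrite (eq_bigr (fun m : 'I_n.+1 => (size (news m))%:R * h m ^+ d)); last by move=> m _; rewrite E.
    exact: le_trans (vol_news n) (volV n).
  by move=> /(le_trans VO); rewrite lee_fin; lra.
exists (h n0) => // eta /andP[eta0 etah].
have ex : exists n, h n.+1 < eta.
  pose n := (Num.truncn eta^-1); exists n.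
  rewrite -[ltRHS]invrK ltf_pV2 ?posrE ?invr_gt0 ?exprn_gt0//.
  apply: lt_le_trans (truncnS_gt _) _; rewrite -natrX ler_nat.
  by rewrite -/n ltnW// ltn_expl.
have [n hn nmin] := ex_minnP ex.
have etan : eta <= h n.
  case: n hn nmin => [|n] hn nmin.
    apply: le_trans etah _; rewrite /h expr0 invr1 invf_le1 ?exprn_gt0//.
    by rewrite exprn_ege1// ler1n.
  by rewrite leNgt; apply/negP => /nmin; rewrite ltnn.
have n0n : (n0 <= n)%N.
  rewrite leqNgt; apply/negP => nn0.
  have : h n0 <= h n.+1.
    by rewrite lef_pV2 ?posrE ?exprn_gt0// ler_weXn2l// ler1n.
  by move=> /(le_trans etah); rewrite leNgt hn.
have ginj : {in cells n &, injective (grid_point n)}.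
  move=> k k' _ _ e; apply/eqP/negPn/negP => /(@grid_sep n).
  by rewrite e subrr enorm0 leNgt h_gt0.
exists (map (grid_point n) (cells n)); split.
- by rewrite map_inj_in_uniq.
- move=> _ _ /mapP[k ks ->] /mapP[k' k's ->] kk'; apply: le_trans etan _; apply: grid_sep.
  by apply: contra_neq kk' => ->.
- move=> _ /mapP[k /cellsP kn ->] y yk; apply: kn; apply: lt_le_trans yk _.
  by apply: le_trans etan _; rewrite ler_peMl ?(ltW (h_gt0 n)).
- rewrite size_map; apply: (@le_trans _ _ ((size (cells n))%:R * h n.+1 ^+ d)); last first.
    by rewrite ler_wpM2l// lerXn2r ?nnegrE ?(ltW (h_gt0 _)) ?(ltW eta0)// ltW.
  have := le_trans hn0 (vol_mono n0n); rewrite /vol hS exprMn mulrA => h'.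
  rewrite invfM (mulrA V) ler_pdivrMr ?exprn_gt0//; apply: le_trans h' _.
  by rewrite le_eqVlt; apply/orP; left; apply/eqP; ring.
Qed.

End Grid.
End Dyadic.

(** * Conformal embeddings and images of balls *)

Section Conformal.
Variables (R : realType) (d : nat).
Hypothesis d_gt0 : (0 < d)%N.
Implicit Types (x y z v u : 'rV[R]_d) (f g : 'rV[R]_d -> 'rV[R]_d).

Lemma unit_vector : exists v : 'rV[R]_d, enorm v = 1.
Proof.
exists (delta_mx ord0 (Ordinal d_gt0)).
rewrite /enorm (bigD1 (Ordinal d_gt0))//= mxE !eqxx/= expr1n big1 ?addr0 ?sqrtr1//.
by move=> j jd; rewrite mxE eqxx/= (negPf jd) expr0n.
Qed.

Lemma opnorm_similarity f (a : R) : 0 <= a -> (forall v, enorm (f v) = a * enorm v) ->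
  opnorm f = a.
Proof.
move=> a0 fa; have [e e1] := unit_vector.
apply/eqP; rewrite eq_le; apply/andP; split.
  apply: ge_sup; first by exists (enorm (f e)), e => //=; rewrite e1.
  by move=> _ [v /= v1 <-]; rewrite fa ler_piMr.
apply: ub_le_sup; last by exists e; [rewrite /= e1|rewrite fa e1 mulr1].
by exists a => _ [v /= v1 <-]; rewrite fa ler_piMr.
Qed.

(** The properties of the generators that pass to compositions, hence to every [word_map T w];
    differentiability of the inverse serves the ball inclusion. *)
Definition conformal_embedding (V : set 'rV[R]_d) f :=
  [/\ f @` V `<=` V, open (f @` V), forall x, V x -> differentiable f x,
      forall x, V x -> 0 < opnorm ('d f x) /\
        forall v, enorm ('d f x v) = opnorm ('d f x) * enorm v &
      exists2 g, forall x, V x -> g (f x) = x &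
        forall y, (f @` V) y -> differentiable g y].

Lemma diff_opnorm_id x : opnorm ('d (@id 'rV[R]_d) x) = 1.
Proof.
by apply: opnorm_similarity => // v; rewrite diff_val mul1r.
Qed.

Lemma conformal_embedding_id V : open V -> conformal_embedding V id.
Proof.
move=> oV; split; rewrite ?image_id//.
  by move=> x _; rewrite diff_opnorm_id; split => // v; rewrite mul1r diff_val.
by exists id => // y _; exact: ex_diff.
Qed.

Lemma diff_comp_apply f g x v : differentiable g x -> differentiable f (g x) ->
  'd (f \o g) x v = 'd f (g x) ('d g x v).
Proof.
by move=> dg df; have := @diff_comp R _ _ _ g f x dg df => /(congr1 (fun h => h v)).
Qed.

Lemma opnorm_diff_comp V f g x : conformal_embedding V f -> conformal_embedding V g ->
  V x -> opnorm ('d (f \o g) x) = opnorm ('d f (g x)) * opnorm ('d g x) /\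
    forall v, enorm ('d (f \o g) x v) = opnorm ('d f (g x)) * opnorm ('d g x) * enorm v.
Proof.
move=> [_ _ df sf _] [gV _ dg sg _] Vx.
have Vgx : V (g x) by apply: gV; exists x.
have E v : enorm ('d (f \o g) x v) = opnorm ('d f (g x)) * opnorm ('d g x) * enorm v.
  have [sf1 sf2] := sf _ Vgx; have [sg1 sg2] := sg _ Vx.
  by rewrite (diff_comp_apply v (dg _ Vx) (df _ Vgx)) sf2 sg2 mulrA.
split => //; apply: opnorm_similarity => //.
exact: mulr_ge0 (ltW (sf _ Vgx).1) (ltW (sg _ Vx).1).
Qed.

Lemma conformal_embedding_comp V f g : open V ->
  conformal_embedding V f -> conformal_embedding V g -> conformal_embedding V (f \o g).
Proof.
move=> oV cf cg; have comp := opnorm_diff_comp cf cg.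
have [fV ofV df sf [f' f'K df']] := cf; have [gV ogV dg sg [g' g'K dg']] := cg.
have gVx x : V x -> V (g x) by move=> Vx; apply: gV; exists x.
split.
- by move=> _ [x Vx <-]; apply: fV; exists (g x) => //; exact: gVx.
- rewrite openE => _ [x Vx <-] /=.
  have fg : (f @` V) (f (g x)) by exists (g x) => //; exact: gVx.
  have n1 : nbhs (f (g x)) (f' @^-1` (g @` V)).
    apply: (differentiable_continuous (df' _ fg)).
    rewrite f'K; last exact: gVx.
    by apply: open_nbhs_nbhs; split => //; exists x.
  have n2 : nbhs (f (g x)) (f @` V) by apply: open_nbhs_nbhs.
  apply: filterS (filterI n1 n2) => y [/= [z Vz gz] [w Vw wy]].
  by exists z => //=; rewrite gz -wy f'K.
- move=> x Vx; apply: differentiable_comp; first exact: dg.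
  by apply: df; exact: gVx.
- move=> x Vx; have [E1 E2] := comp x Vx; split; last by rewrite E1.
  have [sf1 _] := sf _ (gVx _ Vx); have [sg1 _] := sg _ Vx.
  by rewrite E1; exact: mulr_gt0 sf1 sg1.
- exists (g' \o f'); first by move=> x Vx; rewrite /= f'K ?g'K//; exact: gVx.
  move=> _ [x Vx <-]; apply: differentiable_comp.
    by apply: df'; exists (g x) => //; exact: gVx.
  by rewrite /= f'K; [apply: dg'; exists x|exact: gVx].
Qed.

Lemma enorm_diff_inverse V f g x v : conformal_embedding V f ->
  (forall x, V x -> g (f x) = x) -> (forall y, (f @` V) y -> differentiable g y) ->
  V x -> opnorm ('d f x) * enorm ('d g (f x) v) = enorm v.
Proof.
move=> [_ ofV df sf _] gK dg Vx.
have fVx : (f @` V) (f x) by exists x.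
have E : 'd f x ('d g (f x) v) = v.
  have dgx := dg _ fVx.
  have dfx : differentiable f (g (f x)) by rewrite gK//; exact: df.
  have dc : differentiable (f \o g) (f x) by exact: differentiable_comp.
  have -> : 'd f x ('d g (f x) v) = 'd (f \o g) (f x) v.
    exact: (etrans (congr1 (fun z => 'd f z ('d g (f x) v)) (esym (gK x Vx)))
      (esym (diff_comp_apply v dgx dfx))).
  rewrite -deriveE//.
  have near_id : \forall y \near f x, (f \o g) y = id y.
    near=> y.
    have : (f @` V) y by near: y; exact: open_nbhs_nbhs.
    by move=> [z Vz <-] /=; rewrite gK.
  rewrite (near_eq_derive v near_id) deriveE; last exact: ex_diff.
  by rewrite diff_val.
have [_ sf2] := sf _ Vx; by rewrite -sf2 E.
Unshelve. all: by end_near.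
Qed.

(* The inverse is A-Lipschitz along segments inside f(V), and the segment from
   f x in any direction cannot leave the compact image of ceball x (A |v|). *)
Lemma image_contains_eball V f x (A eta : R) : conformal_embedding V f ->
  0 < A -> (forall y, V y -> 1 <= A * opnorm ('d f y)) -> V x ->
  eball x eta `<=` V -> eball (f x) (eta / A) `<=` f @` eball x eta.
Proof.
move=> cf A0 hA Vx xV y; have [fV ofV df sf [g gK dg]] := cf.
rewrite /eball/= ltr_pdivlMr// => yA.
pose v := y - f x; pose rho := A * enorm v.
have rho_eta : rho < eta by rewrite /rho mulrC.
have rho0 : 0 <= rho by rewrite mulr_ge0 ?enorm_ge0 ?ltW.
have eta0 : 0 < eta by exact: le_lt_trans rho_eta.
pose O := f @` V; pose D := f @` ceball x rho.
have DV : ceball x rho `<=` V by move=> z zx; apply: xV; exact: le_lt_trans rho_eta.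
have DO : D `<=` O by move=> _ [z /DV Vz <-]; exists z.
have cD : closed D.
  apply: compact_closed; first exact: norm_hausdorff.
  apply: continuous_compact; last exact: compact_ceball.
  apply: continuous_in_subspaceT => z; rewrite inE => /DV Vz.
  exact/differentiable_continuous/df.
have gb z u : O z -> enorm ('d g z u) <= A * enorm u.
  move=> [w Vw <-]; have [s0 _] := sf _ Vw.
  rewrite -(ler_pM2l s0) (enorm_diff_inverse _ cf gK dg Vw) mulrA.
  by rewrite ler_peMl ?enorm_ge0// mulrC; exact: hA.
(* Continuity method: Z collects the times up to which the segment from f x stays in f(V). The
   supremum belongs to Z because the segment stays in the compact set D, and it is 1 because f(V) is
   open. *)
pose Z := [set s : R | 0 <= s <= 1 /\ forall t, 0 <= t <= s -> O (f x + t *: v)].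
have ZD s : Z s -> D (f x + s *: v).
  move=> [/andP[s0 s1] hs]; have [z Vz zE] := hs s (ltac:(by rewrite s0 lexx)).
  exists z => //; rewrite /ceball/= -(gK z Vz) zE -{2}(gK x Vx).
  apply: le_trans (_ : A * enorm (s *: v) <= _); last first.
    by rewrite /rho ler_wpM2l ?(ltW A0)// enormZ ger0_norm// ler_piMl ?enorm_ge0.
  apply: enorm_mvt; first exact: ltW.
  move=> t /andP[t0 t1]; rewrite scalerA.
  have Ot : O (f x + (t * s) *: v).
    by apply: hs; rewrite mulr_ge0//= ler_piMl.
  by split; [exact: dg|exact: gb].
have Z0 : Z 0.
  split; first by rewrite lexx ler01.
  by move=> t /le_anti <-; rewrite scale0r addr0; exists x.
have supZ : has_sup Z by split; [exists 0|exists 1 => s [/andP[]]].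
pose s := sup Z.
have s0 : 0 <= s by apply: sup_upper_bound.
have s1 : s <= 1 by apply: ge_sup; [exists 0|move=> t [/andP[]]].
have vpos : 0 < enorm v + 1 by rewrite ltr_wpDl ?enorm_ge0.
have Ds : D (f x + s *: v).
  apply: cD => B /nbhs_eballP[r r0 rB].
  have [|t Zt st] := @sup_adherent _ Z (r / (enorm v + 1)) _ supZ; first by rewrite divr_gt0.
  exists (f x + t *: v); split; first exact: ZD.
  apply: rB; rewrite /eball/=.
  have -> : f x + t *: v - (f x + s *: v) = (t - s) *: v.
    by rewrite scalerBl opprD addrACA subrr add0r.
  have ts : t <= s by apply: sup_upper_bound.
  rewrite enormZ ler0_norm ?subr_le0//.
  have h : - (t - s) < r / (enorm v + 1) by rewrite /s; lra.
  apply: (@le_lt_trans _ _ (- (t - s) * (enorm v + 1))); last by rewrite -ltr_pdivlMr.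
  by rewrite ler_wpM2l ?oppr_ge0 ?subr_le0// lerDl.
have Zs : Z s.
  split; first by rewrite s0.
  move=> t /andP[t0 ts]; have [->|tns] := eqVneq t s; first exact: DO.
  have [t' [_ ht'] tt'] := sup_gt (ltac:(by exists 0) : Z !=set0) (ltac:(by rewrite lt_neqAle tns) : t < sup Z).
  by apply: ht'; rewrite t0 ltW.
have s_eq1 : s = 1.
  apply/eqP; rewrite eq_le s1 leNgt; apply/negP => slt1.
  have [r r0 rO] := (open_eballP _).1 ofV _ (DO _ Ds).
  pose t := Num.min 1 (s + r / (enorm v + 1) / 2).
  have rr : 0 < r / (enorm v + 1) / 2 by rewrite !divr_gt0.
  have st : s < t by rewrite lt_min slt1/= ltrDl.
  have : Z t.
    split; first by rewrite (le_trans s0 (ltW st)) ge_min lexx.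
    move=> t' /andP[t'0 t't]; have [ts|st'] := leP t' s; first by apply: Zs.2; rewrite t'0.
    apply: rO; rewrite /eball/=.
    have -> : f x + t' *: v - (f x + s *: v) = (t' - s) *: v.
      by rewrite scalerBl opprD addrACA subrr add0r.
    rewrite enormZ gtr0_norm ?subr_gt0//.
    have h : t' - s <= r / (enorm v + 1) / 2.
      by move: t't; rewrite /t le_min => /andP[_]; lra.
    apply: (@le_lt_trans _ _ ((t' - s) * (enorm v + 1))).
      by rewrite ler_wpM2l ?lerDl// subr_ge0 ltW.
    by rewrite -ltr_pdivlMr//; lra.
  by move=> /(sup_upper_bound supZ); rewrite leNgt st.
have := ZD _ Zs; rewrite s_eq1 scale1r /v addrC subrK => -[z zx zy].
by exists z => //; exact: le_lt_trans rho_eta.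
Qed.

End Conformal.

(** * Derivatives of the composed maps *)

Section Geometry.
Variables (R : realType) (d : nat) (I : countType) (X V : set 'rV[R]_d).
Variables (S T : I -> 'rV[R]_d -> 'rV[R]_d).
Hypotheses (d_gt0 : (0 < d)%N) (X_conformal : conformality X S V T).
Hypothesis T_distortion : bounded_distortion V T.
Hypothesis S_stable : forall i x, X x -> X (S i x).

Let oV : open V. Proof. by have [[]] := X_conformal. Qed.
Let XV : X `<=` V. Proof. by have [[]] := X_conformal. Qed.

Lemma conformal_embedding_branch i : conformal_embedding V (T i).
Proof.
have [_ _ [eps eps0 /(_ i)[[TV oTV [dT _] [g gK [dg _]]] [_ nz sim _]]] _] := X_conformal.
split => //; last by exists g.
move=> x Vx; split=> [|v]; last exact: sim.
have [v v0] := nz x Vx; have Ev := sim x v Vx.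
have : 0 < opnorm ('d (T i) x) * enorm v.
  rewrite -Ev lt_neqAle enorm_ge0 andbT eq_sym; apply: contra v0.
  by move=> /eqP/enorm_eq0->.
move=> h; rewrite ltNge; apply/negP => h0.
by have := mulr_le0_ge0 h0 (enorm_ge0 v); rewrite leNgt h.
Qed.

Lemma conformal_embedding_word w : conformal_embedding V (word_map T w).
Proof.
elim: w => [|i w ih]; first exact: conformal_embedding_id.
exact: conformal_embedding_comp oV (conformal_embedding_branch i) ih.
Qed.

Lemma word_map_extension w x : X x -> word_map T w x = word_map S w x /\ X (word_map S w x).
Proof.
have [_ TS _ _] := X_conformal; move=> Xx; elim: w => //= i w [-> Xw].
by split; [exact: TS|exact: S_stable].
Qed.

Lemma word_map_V w x : V x -> V (word_map T w x).
Proof. by have [h _ _ _ _] := conformal_embedding_word w => Vx; apply: h; exists x. Qed.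

(** [D w x] is the norm of the derivative of S_w at x; behind the existential only its algebraic
    properties and the ball inclusion remain visible. *)
Lemma word_dilation : exists (D : seq I -> 'rV[R]_d -> R) (xi K : R), [/\
  0 < xi < 1, 1 <= K,
  forall w x y, V x -> V y -> 0 < D w x /\ D w y <= K * D w x,
  forall x, D [::] x = 1 &
  [/\ forall u v x, V x -> D (u ++ v) x = D u (word_map T v x) * D v x,
      forall i w x, V x -> D (i :: w) x <= xi * D w x,
      forall w x v, V x -> differentiable (word_map T w) x /\
        enorm ('d (word_map T w) x v) = D w x * enorm v &
      forall w x A eta, 0 < A -> (forall y, V y -> 1 <= A * D w y) -> V x ->
        eball x eta `<=` V ->
        eball (word_map T w x) (eta / A) `<=` word_map T w @` eball x eta]].
Proof.
have [_ _ _ [xi xi01 Txi]] := X_conformal; have [Kb Kb0 hKb] := T_distortion.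
(* The distortion hypothesis concerns non-empty words; the maximum with 1 includes the empty word,
   whose derivative has norm 1. *)
exists (fun w x => opnorm ('d (word_map T w) x)), xi, (Num.max 1 Kb).
have pos w x : V x -> 0 < opnorm ('d (word_map T w) x).
  by have [_ _ _ h _] := conformal_embedding_word w => /h[].
have comp u v x : V x -> opnorm ('d (word_map T (u ++ v)) x) =
    opnorm ('d (word_map T u) (word_map T v x)) * opnorm ('d (word_map T v) x).
  move=> Vx; have -> : word_map T (u ++ v) = word_map T u \o word_map T v.
    by apply/funext => y; exact: word_map_cat.
  exact: (opnorm_diff_comp d_gt0 (conformal_embedding_word u) (conformal_embedding_word v) Vx).1.
split => //.
- by rewrite le_max lexx.
- move=> w x y Vx Vy; split; first exact: pos.
  case: w => [|i w].
    have h (a b : R) : a = 1 -> b = 1 -> b <= Num.max 1 Kb * a.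
      by move=> -> ->; rewrite mulr1 le_max lexx.
    exact: h (diff_opnorm_id d_gt0 x) (diff_opnorm_id d_gt0 y).
  apply: le_trans (hKb (i :: w) x y _ Vx Vy) _ => //.
  by apply: ler_wpM2r; [exact/ltW/pos|rewrite le_max lexx orbT].
- by move=> x; exact: diff_opnorm_id.
split => //.
- move=> i w x Vx.
  have h (a b c : R) : a = b * c -> b <= xi -> 0 <= c -> a <= xi * c.
    by move=> -> bx c0; exact: ler_wpM2r.
  have Txi' y : V y -> opnorm ('d (T i) y) <= xi.
    move=> Vy; apply/ltW; rewrite -lte_fin.
    by apply: le_lt_trans (Txi i); apply: ereal_sup_ubound; exists y.
  exact: h (comp [:: i] w x Vx) (Txi' _ (word_map_V w Vx)) (ltW (pos w x Vx)).
- move=> w x v Vx; have [_ _ h1 h2 _] := conformal_embedding_word w.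
  by split; [exact: h1|have [_ h] := h2 x Vx; exact: h].
- by move=> w x A eta A0 hA Vx xV; exact: (image_contains_eball (conformal_embedding_word w) A0 hA Vx xV).
Qed.

End Geometry.

Lemma positive_minorant (T : eqType) (R : realType) (s : seq T) (f : T -> R) :
  {in s, forall i, 0 < f i} -> exists2 e : R, 0 < e & {in s, forall i, e <= f i}.
Proof.
elim: s => [|i s ih] h; first by exists 1.
have [j js|e e0 he] := ih; first by apply: h; rewrite inE js orbT.
exists (Num.min (f i) e); first by rewrite lt_min e0 h ?mem_head.
move=> j; rewrite inE => /predU1P[->|/he ej]; rewrite ge_min ?lexx//.
by rewrite ej orbT.
Qed.

Lemma cone_condition_vol (R : realType) d (X : set 'rV[R]_d) : cone_condition X ->
  exists2 c : R, 0 < c & forall x r, X x -> 0 < r < 1 ->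
    ((c * r ^+ d)%:E <= lebesgue_d (eball x r `&` X°))%E.
Proof.
rewrite /cone_condition; set A := ereal_inf _ => A0.
have [c c0 cA] : exists2 c : R, 0 < c & (c%:E <= A)%E.
  move: A0; case: (A) => [a| |] //; rewrite ?lte_fin => a0; first by exists a.
  by exists 1 => //; rewrite leey.
exists c => // x r Xx r01; have /andP[r0 r1] := r01.
have : (c%:E <= lebesgue_d (eball x r `&` X°) * ((r ^+ d)^-1)%:E)%E.
  by apply: le_trans cA _; apply: ereal_inf_lbound; exists (x, r).
have rd : 0 < r ^+ d by rewrite exprn_gt0.
move=> h; rewrite EFinM -[leRHS]mule1 -[1%E](_ : ((r ^+ d)^-1 * r ^+ d)%:E = 1%E); last first.
  by rewrite mulVf ?gt_eqF.
by rewrite EFinM muleA; apply: lee_pmul => //; rewrite lee_fin ltW.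
Qed.

(** X need not be convex: the Lipschitz bound holds along short segments, which stay in V, and is
    chained through X. The lower bound comes from the ball inclusion. For the count, each cylinder
    is filled with about (r / eta)^d points; by the open set condition those of different cylinders
    stay eta / K apart, and all lie in a ball of radius 2 K r. *)
Lemma cifs_geometry (R : realType) (d : nat) (I : countType) (X : set 'rV[R]_d)
    (S : I -> 'rV[R]_d -> 'rV[R]_d) : (0 < d)%N -> cifs X S ->
  exists lam xi K M, ifs_geometry X S lam xi K M.
Proof.
move=> d0 [[cX conX] SX [U0 SU Sdisj] cone [V [T [conf dist]]]].
have [[oV bV _ XV] TS _ _] := conf.
have [D [xi [K0 [xi01 K01 hD D_nil [D_cat D_cons dD ballD]]]]] :=
  word_dilation d0 conf dist.
have ext w x : X x -> word_map T w x = word_map S w x /\ X (word_map S w x).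
  by move=> Xx; exact: (word_map_extension conf SX).
have Tw_X w x : X x -> X (word_map T w x).
  by move=> Xx; have [-> h] := ext w x Xx.
have Tw_V w x : V x -> V (word_map T w x).
  by move=> Vx; exact: (word_map_V d0 conf).
have [x0 Ux0] := U0; have UX : X° `<=` X := @interior_subset _ X.
have Xx0 := UX _ Ux0; have Vx0 := XV _ Xx0.
have K00 : 0 < K0 by exact: lt_le_trans K01.
pose lam w := D w x0.
have lam0 w : 0 < lam w by have [] := hD w x0 x0 Vx0 Vx0.
have D_le w x : V x -> D w x <= K0 * lam w by move=> Vx; have [] := hD w x0 x Vx0 Vx.
have D_ge w x : V x -> lam w <= K0 * D w x by move=> Vx; have [] := hD w x x0 Vx Vx0.
have D_gt0 w x : V x -> 0 < D w x by move=> Vx; have [] := hD w x x Vx Vx.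
have [del del0 Xdel] := compact_uniform_nbhd cX oV XV.
have [Dm Dm0 hDm] : exists2 Dm : R, 0 < Dm & forall x y, X x -> X y -> enorm (x - y) <= Dm.
  have [B hB] := (bounded_setP V).1 bV; exists (2 * B + 1).
    by have := enorm_ge0 x0; have := hB x0 Vx0; lra.
  move=> x y /XV Vx /XV Vy; apply: le_trans (ler_enormD _ _) _; rewrite enormN.
  by have := hB x Vx; have := hB y Vy; lra.
have Xb : ebounded X.
  exists x0 => //; exists (Dm + 1); first by rewrite addr_gt0.
  by move=> x Xx; apply: le_lt_trans (hDm x x0 Xx Xx0) _; rewrite ltrDl.
have lip_near w x y : X x -> X y -> enorm (y - x) < del ->
    enorm (word_map T w y - word_map T w x) <= K0 * lam w * enorm (y - x).
  move=> Xx Xy xy; have := @enorm_mvt _ _ (word_map T w) x (y - x) (K0 * lam w).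
  rewrite subrKC => -> //; first by rewrite mulr_ge0 ?ltW.
  move=> t /andP[t0 t1]; have Vt : V (x + t *: (y - x)).
    apply: (Xdel x Xx); rewrite /eball/= addrAC subrr add0r enormZ ger0_norm//.
    by apply: le_lt_trans xy; rewrite ler_piMl ?enorm_ge0.
  have [d1 ->] := dD w _ (y - x) Vt; split => //.
  by rewrite ler_wpM2r ?enorm_ge0// D_le.
have [N hN] := connected_chains conX Xb Xx0 del0.
have lip_far w x : X x -> enorm (word_map T w x - word_map T w x0) <= N%:R * (K0 * lam w * del).
  have kl : 0 <= K0 * lam w * del by rewrite !mulr_ge0 ?ltW.
  apply: (hN (fun n => [set x | enorm (word_map T w x - word_map T w x0) <= n%:R * (K0 * lam w * del)])).
  - by rewrite /= subrr enorm0 mul0r.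
  - move=> n y z Xy Xz /= hy zy; apply: le_trans (enorm_tri _ _ (word_map T w y)) _.
    rewrite -natr1 mulrDl mul1r addrC; apply: lerD => //.
    apply: le_trans (lip_near w y z Xy Xz zy) _.
    by rewrite ler_wpM2l ?mulr_ge0 ?ltW.
  - by move=> n y /= h; apply: le_trans h _; rewrite ler_wpM2r// ler_nat.
(* Points at distance at least del are joined through x0 by two chains of N steps, each costing K0
   [lam w] del; the extra 1 is for close points. *)
pose Kl := (2 * N%:R + 1) * K0.
have N0 : 0 <= N%:R :> R by [].
have lip w x y : X x -> X y ->
    enorm (word_map T w x - word_map T w y) <= Kl * lam w * enorm (x - y).
  move=> Xx Xy; have kl : 0 <= K0 * lam w by rewrite mulr_ge0 ?ltW.
  have [xy|xy] := ltP (enorm (x - y)) del.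
    apply: le_trans (lip_near w y x Xy Xx xy) _.
    rewrite ler_wpM2r ?enorm_ge0// ler_wpM2r ?(ltW (lam0 w))// /Kl.
    by rewrite ler_peMl ?(ltW K00)//; lra.
  apply: le_trans (enorm_tri _ _ (word_map T w x0)) _.
  have h1 := lip_far w x Xx; have h2 := lip_far w y Xy; rewrite enormBC in h2.
  have h3 : K0 * lam w * del <= K0 * lam w * enorm (x - y) by rewrite ler_wpM2l.
  have -> : Kl * lam w * enorm (x - y) = 2 * (N%:R * (K0 * lam w * enorm (x - y))) + K0 * lam w * enorm (x - y).
    by rewrite /Kl; ring.
  have h4 : N%:R * (K0 * lam w * del) <= N%:R * (K0 * lam w * enorm (x - y)) by rewrite ler_wpM2l.
  have h5 : 0 <= K0 * lam w * enorm (x - y) by rewrite mulr_ge0 ?enorm_ge0.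
  lra.
have ballA w x eta : V x -> eball x eta `<=` V ->
    eball (word_map T w x) (eta * lam w / K0) `<=` word_map T w @` eball x eta.
  move=> Vx xV; have -> : eta * lam w / K0 = eta / (K0 / lam w) by rewrite invf_div mulrA.
  apply: ballD => //; first by rewrite divr_gt0.
  by move=> y Vy; rewrite mulrAC ler_pdivlMr// mul1r; exact: D_ge.
have inj w x y : V x -> V y -> word_map T w x = word_map T w y -> x = y.
  have [_ _ _ _ [g gK _]] := conformal_embedding_word d0 conf w.
  by move=> Vx Vy e; rewrite -(gK x Vx) -(gK y Vy) e.
(* If the images are closer than del [lam w] / K0, the ball inclusion gives the constant K0;
   otherwise the bound Dm on distances in X gives K0 Dm / del. *)
pose Kc := K0 * (1 + Dm / del).
have colip w x y : X x -> X y ->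
    lam w * enorm (x - y) <= Kc * enorm (word_map T w x - word_map T w y).
  move=> Xx Xy; set e := enorm (word_map T w x - word_map T w y).
  have e0 : 0 <= e by exact: enorm_ge0.
  have q0 : 0 <= Dm / del by rewrite divr_ge0 ?ltW.
  have [ed|ed] := ltP e (del * lam w / K0).
    apply: (@le_trans _ _ (K0 * e)); last first.
      by rewrite ler_wpM2r// /Kc ler_peMr ?(ltW K00)// lerDl.
    rewrite leNgt; apply/negP => ex.
    pose eta := Num.min del (enorm (x - y)).
    have e_eta : e < eta * lam w / K0.
      rewrite /eta ltr_pdivlMr// mulrC minr_pMl ?(ltW (lam0 w))// lt_min.
      by rewrite [enorm _ * _]mulrC ex andbT; move: ed; rewrite ltr_pdivlMr// mulrC.
    have [y' xy' yE] : (word_map T w @` eball x eta) (word_map T w y).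
      apply: ballA; first exact: XV.
        move=> z zx; apply: (Xdel x Xx); apply: lt_le_trans zx _.
        by rewrite /eta ge_min lexx.
      by rewrite /eball/= enormBC.
    have Vy' : V y' by apply: (Xdel x Xx); apply: lt_le_trans xy' _; rewrite /eta ge_min lexx.
    have y'y : y' = y by apply: (inj w) => //; exact: XV.
    move: xy'; rewrite y'y /eball/= enormBC /eta lt_min ltxx andbF.
    by [].
  apply: (@le_trans _ _ (lam w * Dm)); first by rewrite ler_wpM2l ?hDm// ltW.
  apply: (@le_trans _ _ (K0 * (Dm / del) * e)); last first.
    by rewrite ler_wpM2r// /Kc ler_wpM2l ?(ltW K00)//; lra.
  have -> : lam w * Dm = K0 * (Dm / del) * (del * lam w / K0) by field; rewrite !gt_eqF.
  by rewrite ler_wpM2l// mulr_ge0// ltW.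
have TU w x : X° x -> X° (word_map T w x).
  move=> Ux; elim: w => //= i w ih; apply: (SU i); exists (word_map T w x) => //.
  by rewrite TS//; exact: UX.
have Tdisj w w' x y : size w = size w' -> w != w' -> X° x -> X° y ->
    word_map T w x <> word_map T w' y.
  elim: w w' => [|i w ih] [|j w'] //= [sw] ww' Ux Uy e.
  have Uw := TU w x Ux; have Uw' := TU w' y Uy.
  have [ij|/eqP ij] := eqVneq i j.
    move: ww'; rewrite -ij eqseq_cons eqxx/= => ww'.
    apply: (ih w' sw ww' Ux Uy); apply: (inj [:: i]).
    - exact/XV/UX.
    - exact/XV/UX.
    - by rewrite /= e ij.
  have : (S i @` X° `&` S j @` X°) (T i (word_map T w x)).
    split; first by exists (word_map T w x) => //; rewrite TS//; exact: UX.
    by rewrite e; exists (word_map T w' y) => //; rewrite TS//; exact: UX.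
  by rewrite Sdisj.
have [c c0 hc] := cone_condition_vol cone.
pose K := Kl + Kc + K0 + Dm.
have Kl0 : 0 <= Kl by rewrite /Kl mulr_ge0// ?ltW//; lra.
have Kc0 : 0 <= Kc by rewrite /Kc mulr_ge0 ?(ltW K00)// addr_ge0// divr_ge0 ?ltW.
have K1 : 1 <= K by rewrite /K; lra.
have KKl : Kl <= K by rewrite /K; lra.
have KKc : Kc <= K by rewrite /K; lra.
have KK0 : K0 <= K by rewrite /K; lra.
have KDm : Dm <= K by rewrite /K; lra.
have K0' : 0 < K by lra.
(* The number of eta / K-separated points in a ball of radius 2 K r, divided by the c r^d / (2 4^d
   eta^d) points found in each cylinder; eta cancels. *)
pose Mr := (packc R d * (2 * K ^+ 2)) ^+ d * (2 * 2 ^+ d * 2 ^+ d) / c.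
have count n z r (W : seq (seq I)) : 0 < r -> uniq W ->
   {in W, forall w, [/\ size w = n, r <= lam w & (word_map S w @` X) `&` eball z r !=set0]} ->
   (size W)%:R <= Mr.
  move=> r0 uW hW.
  have /choice[xw hxw] : forall w, exists x, w \in W -> X x /\ eball z r (word_map T w x).
    move=> w; have [wW|] := boolP (w \in W); last by exists x0.
    have [_ _ [_ [[x Xx <-] xz]]] := hW w wW; exists x => _; split => //.
    by have [-> _] := ext w x Xx.
  (* Since r <= [lam w], the factor 2 keeps this radius below 1, as the cone condition requires; S_w
     maps such a ball to a set of size about r. *)
  pose sw w := r / (2 * lam w).
  have sw01 w : w \in W -> 0 < sw w < 1.
    move=> wW; have [_ rl _] := hW w wW; have l0 := lam0 w.
    by rewrite divr_gt0 ?mulr_gt0//= ltr_pdivrMr ?mulr_gt0// mul1r; lra.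
  pose Om w := eball (xw w) (sw w) `&` X°.
  have Om_open w : open (Om w) by apply: openI; [exact: open_eball|exact: open_interior].
  have Om_bounded w : w \in W -> ebounded (Om w).
    move=> wW; exists (xw w) => //; exists (sw w); first by have /andP[] := sw01 w wW.
    by move=> y [].
  have /choice[ew hew] : forall w, exists e : R, w \in W -> 0 < e /\ forall eta, 0 < eta <= e ->
      exists Y : seq 'rV[R]_d, [/\ uniq Y, eseparated eta Y,
      forall y, y \in Y -> eball y eta `<=` Om w &
      c * sw w ^+ d / (2 * 2 ^+ d) <= (size Y)%:R * eta ^+ d].
    move=> w; have [wW|] := boolP (w \in W); last by exists 1.
    have /andP[s0 s1] := sw01 w wW; have [Xx _] := hxw w wW.
    have cs0 : 0 < c * sw w ^+ d by rewrite mulr_gt0// exprn_gt0.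
    have [e e0 he] := interior_packing d0 (Om_open w) (Om_bounded w wW) cs0
      (hc (xw w) (sw w) Xx (sw01 w wW)).
    by exists e.
  (* The packing threshold depends on w, but the list W is finite, so one eta serves all words, used
     at scale eta / [lam w] before mapping. *)
  have [eta1 eta10 heta1] : exists2 e : R, 0 < e & {in W, forall w, e <= ew w * lam w}.
    by apply: positive_minorant => w wW; rewrite mulr_gt0//; have [] := hew w wW.
  pose eta := Num.min r eta1; have eta0 : 0 < eta by rewrite lt_min r0.
  have /choice[Y hY] : forall w, exists Y : seq 'rV[R]_d, w \in W ->
      [/\ uniq Y, eseparated (eta / lam w) Y,
      forall y, y \in Y -> eball y (eta / lam w) `<=` Om w &
      c * sw w ^+ d / (2 * 2 ^+ d) <= (size Y)%:R * (eta / lam w) ^+ d].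
    move=> w; have [wW|] := boolP (w \in W); last by exists [::].
    have [_ h] := hew w wW; have [|Y hY] := h (eta / lam w); last by exists Y.
    rewrite divr_gt0//= ler_pdivrMr//; apply: le_trans (heta1 w wW).
    by rewrite ge_min lexx orbT.
  have YX w y : w \in W -> y \in Y w -> X° y /\ eball (xw w) (sw w) y.
    move=> wW yY; have [_ _ h _] := hY w wW.
    have [] := h y yY y; last by [].
    by rewrite /eball/= subrr enorm0 divr_gt0.
  have card_Y w : w \in W -> c * r ^+ d / (2 * 2 ^+ d * 2 ^+ d) / eta ^+ d <= (size (Y w))%:R.
    move=> wW; have [_ _ _ h] := hY w wW.
    rewrite ler_pdivrMr ?exprn_gt0//.
    have ld : 0 < lam w ^+ d by rewrite exprn_gt0.
    move: h; rewrite /sw !expr_div_n exprMn [leRHS]mulrA ler_pdivlMr//.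
    apply: le_trans; rewrite le_eqVlt; apply/orP; left; apply/eqP.
    by field; rewrite !expf_neq0 ?pnatr_eq0// gt_eqF.
  pose P := [seq (w, y) | w <- W, y <- Y w].
  pose g (a : seq I * 'rV[R]_d) := word_map T a.1 a.2.
  have PP a : a \in P -> a.1 \in W /\ a.2 \in Y a.1.
    by move=> /allpairsPdep[w [y [wW yY ->]]].
  have gsep : {in P &, forall a b, a != b -> eta / K <= enorm (g a - g b)}.
    move=> [w y] [w' y'] /PP[/= wW yY] /PP[/= w'W y'Y] ab; rewrite /g/=.
    have [Uy _] := YX w y wW yY; have [Uy' _] := YX w' y' w'W y'Y.
    have [ww'|ww'] := eqVneq w w'.
      rewrite -ww' in y'Y *; have yy' : y != y' by apply: contra ab => /eqP ->; rewrite ww'.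
      have [_ ysep _ _] := hY w wW; have := ysep y y' yY y'Y yy'.
      rewrite ler_pdivrMr// => h; rewrite ler_pdivrMr// mulrC.
      apply: le_trans h _; rewrite [enorm _ * _]mulrC; apply: le_trans (colip w y y' (UX _ Uy) (UX _ Uy')) _.
      by rewrite ler_wpM2r ?enorm_ge0.
    (* The image under w of the ball around y contains a ball of radius eta / K0. Were the other
       point inside, two distinct words of equal length would have overlapping images of the
       interior of X. *)
    rewrite leNgt; apply/negP => h.
    have [sz _ _] := hW w wW; have [sz' _ _] := hW w' w'W.
    have [_ _ hO _] := hY w wW.
    have : (word_map T w @` eball y (eta / lam w)) (word_map T w' y').
      apply: ballA; first exact/XV/UX.
        by move=> v /(hO y yY)[_ /UX/XV].
      rewrite /eball/= divfK ?gt_eqF// enormBC; apply: lt_le_trans h _.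
      by rewrite ler_wpM2l ?(ltW eta0)// lef_pV2 ?posrE.
    move=> [v /(hO y yY)[_ Uv] vE]; apply: (Tdisj w w' v y') => //.
    by rewrite sz sz'.
  have uP : uniq P.
    apply: allpairs_uniq_dep => //; first by move=> w wW; have [] := hY w wW.
    by move=> [? ?] [? ?] _ _ /= [-> ->].
  have ek0 : 0 < eta / K by rewrite divr_gt0.
  have ginj : {in P &, injective g}.
    move=> a b aP bP gab; apply/eqP/negPn/negP => /(gsep a b aP bP).
    by rewrite gab subrr enorm0 leNgt ek0.
  have := @separated_card R d z (2 * K * r) (eta / K) (map g P).
  rewrite size_map map_inj_in_uniq// ek0 => /(_ _ uP _ _) h.
  have {h} hP : (size P)%:R <= (packc R d * (2 * K * r / (eta / K))) ^+ d.
    apply: h.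
    - apply: (@le_trans _ _ r); last by rewrite ler_peMl ?(ltW r0)//; lra.
      rewrite ler_pdivrMr//; apply: (@le_trans _ _ r); first by rewrite ge_min lexx.
      by rewrite ler_peMr ?(ltW r0).
    - move=> _ /mapP[[w y] /PP[/= wW yY] ->]; rewrite /g/=.
      have [Uy yx] := YX w y wW yY; have [Xx xz] := hxw w wW.
      apply: le_lt_trans (enorm_tri _ _ (word_map T w (xw w))) _.
      have h1 := lip w y (xw w) (UX _ Uy) Xx.
      have h2 : Kl * lam w * enorm (y - xw w) <= K * (r / 2).
        apply: (@le_trans _ _ (Kl * lam w * sw w)).
          by rewrite ler_wpM2l ?mulr_ge0 ?(ltW (lam0 w))// ltW.
        have -> : Kl * lam w * sw w = Kl * (r / 2) by rewrite /sw; field; rewrite gt_eqF.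
        by rewrite ler_wpM2r// divr_ge0 ?ltW.
      have h3 : r <= K * r by rewrite ler_peMl ?(ltW r0).
      move: xz; rewrite /eball/=; lra.
    - move=> _ _ /mapP[a aP ->] /mapP[b bP ->] ab; apply: gsep => //.
      by apply: contra_neq ab => ->.
  have hS : (size W)%:R * (c * r ^+ d / (2 * 2 ^+ d * 2 ^+ d) / eta ^+ d) <= (size P)%:R.
    have -> : (size P)%:R = \sum_(w <- W) (size (Y w))%:R :> R.
      by rewrite size_allpairs_dep sumnE big_map natr_sum.
    rewrite mulr_natl -iter_addr_0 -[X in iter X](count_predT W) -big_const_seq.
    by rewrite big_seq [leRHS]big_seq; apply: ler_sum => w; exact: card_Y.
  have cc : 0 < c * r ^+ d / (2 * 2 ^+ d * 2 ^+ d) / eta ^+ d.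
    by rewrite !divr_gt0 ?mulr_gt0 ?exprn_gt0.
  have := le_trans hS hP; rewrite -ler_pdivlMr// => /le_trans; apply.
  rewrite /Mr le_eqVlt; apply/orP; left; apply/eqP.
  have -> : packc R d * (2 * K * r / (eta / K)) = packc R d * (2 * K ^+ 2) * (r / eta).
    by field; rewrite !gt_eqF.
  rewrite (exprMn _ _ (r / eta)) expr_div_n.
  by field; rewrite !expf_neq0 ?pnatr_eq0 ?gt_eqF.
exists lam, xi, K, (Num.truncn Mr); split => //.
- by exists x0.
- by move=> x y Xx Xy; apply: le_trans (hDm x y Xx Xy) KDm.
- exact: D_nil.
- elim=> [|i w ih]; first by rewrite /lam D_nil expr0.
  rewrite /= exprS; apply: le_trans (D_cons i w x0 Vx0) _.
  by rewrite ler_wpM2l//; case/andP: xi01 => /ltW.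
- move=> u v; rewrite /lam D_cat// mulrA; apply: ler_wpM2r; first exact: (ltW (lam0 v)).
  apply: le_trans (D_ge u _ (Tw_V v _ Vx0)) _.
  by rewrite ler_wpM2r// ltW// D_gt0//; exact: Tw_V.
- move=> w x y Xx Xy; have [<- _] := ext w x Xx; have [<- _] := ext w y Xy.
  apply: le_trans (lip w x y Xx Xy) _.
  by rewrite ler_wpM2r ?enorm_ge0// ler_wpM2r// ltW.
- move=> w x y Xx Xy; have [<- _] := ext w x Xx; have [<- _] := ext w y Xy.
  apply: le_trans (colip w x y Xx Xy) _.
  by rewrite ler_wpM2r ?enorm_ge0.
- move=> n z r W r0 uW hW; rewrite truncn_ge_nat; first exact: count hW.
  by apply: le_trans (count n z r [::] r0 _ _).
- move=> om.
  pose q n := word_map S (mkseq om n) x0.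
  have Xq n : X (q n) by exact: (ext _ _ Xx0).2.
  have qX : \forall n \near \oo, X (q n) by exact: nearW.
  (* A cluster point of the sequence q: the n-th cylinder is closed and contains q m for all m >=
     n. *)
  have [p [Xp pq]] := cX (q @ \oo) _ qX.
  exists p => n; have cn : compact (word_map S (mkseq om n) @` X).
    have -> : word_map S (mkseq om n) @` X = word_map T (mkseq om n) @` X.
      by apply/seteqP; split=> _ [x Xx <-]; exists x => //; have [] := ext (mkseq om n) x Xx.
    apply: continuous_compact cX; apply: continuous_in_subspaceT => x; rewrite inE => Xx.
    by have [dx _] := dD (mkseq om n) x 0 (XV _ Xx); exact: differentiable_continuous.
  apply: (compact_closed (@norm_hausdorff _ _) cn) => B pB.
  apply: (pq (word_map S (mkseq om n) @` X)) => //.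
  suff : \forall m \near \oo, (word_map S (mkseq om n) @` X) (q m) by [].
  near=> m; have nm : (n <= m)%N by near: m; exact: nbhs_infty_ge.
  rewrite /q -(subnKC nm) mkseqD word_map_cat.
  by exists (word_map S (mkseq (fun k => om (n + k)%N) (m - n)) x0) => //; exact: (ext _ _ Xx0).2.
Unshelve. all: by end_near.
Qed.

(** * The three-parameter form *)

Lemma dimqA_eventually (R : realType) (d : nat) (E : set 'rV[R]_d) (t q : R) :
  t < 1 -> (forall theta, t <= theta < 1 -> assouad_spec theta E = q) -> dimqA E = q.
Proof.
move=> t1 Eq; apply: cvg_lim => //; apply: cvg_near_cst.
near=> theta; apply/Eq/andP; split; near: theta.
- exact: nbhs_left_ge.
- exact: nbhs_left_lt.
Unshelve. all: by end_near.
Qed.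

Lemma three_param_coef (R : realType) (theta rh : R) : 0 < theta < 1 -> 0 < rh ->
  (1 - rh) * theta / ((1 - theta) * rh) = (rh^-1 - 1) / (theta^-1 - 1).
Proof.
move=> /andP[t0 t1] r0; field.
by rewrite !gt_eqF//; lra.
Qed.

(** The three-parameter formula, with kappa = 1 / rho - 1. Multiplied by theta^-1 - 1, both entries
    of the minimum are affine in theta^-1, like the bounds in [spec_le_expbnd]. *)
Definition threshold (R : realType) (kappa a q theta : R) : R :=
  Num.min (a + kappa / (theta^-1 - 1) * (q - a)) q.

Lemma rho_bounds (R : realType) (d : nat) (E : set 'rV[R]_d) : 0 <= rho E <= 1.
Proof.
have dim1 : dimA 1 E = dimqA E by rewrite /dimA oner_eq0 eqxx.
apply/andP; split.
  by apply: lb_le_inf => [|t [/andP[]]//]; exists 1; rewrite /= ler01 lexx.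
by apply: ge_inf; [exists 0 => t [/andP[]]|rewrite /= ler01 lexx].
Qed.

Lemma rho_le (R : realType) (d : nat) (theta : R) (E : set 'rV[R]_d) :
  0 <= theta <= 1 -> dimA theta E = dimqA E -> rho E <= theta.
Proof. by move=> t01 tE; apply: ge_inf; first by exists 0 => t [/andP[]]. Qed.

Lemma rho_ge (R : realType) (d : nat) (t : R) (E : set 'rV[R]_d) :
  (forall theta, 0 <= theta <= 1 -> dimA theta E = dimqA E -> t <= theta) -> t <= rho E.
Proof.
move=> h; apply: lb_le_inf => [|theta [t01 tE]]; last exact: h.
by exists 1; split; [rewrite ler01 lexx|rewrite /dimA oner_eq0 eqxx].
Qed.

Lemma dimA_assouad_spec (R : realType) (d : nat) (theta : R) (E : set 'rV[R]_d) :
  0 < theta < 1 -> dimA theta E = assouad_spec theta E.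
Proof. by move=> /andP[t0 t1]; rewrite /dimA gt_eqF// lt_eqF. Qed.

Lemma upper_dimA_upper_assouad_spec (R : realType) (d : nat) (theta : R) (E : set 'rV[R]_d) :
  0 < theta < 1 -> upper_dimA theta E = upper_assouad_spec theta E.
Proof. by move=> /andP[t0 t1]; rewrite /upper_dimA gt_eqF// lt_eqF. Qed.

Local Opaque rho dimB dimqA dimH assouad_spec upper_assouad_spec.

Lemma inv_sub1_gt0 (R : realType) (theta : R) : 0 < theta < 1 -> 0 < theta^-1 - 1.
Proof. by move=> /andP[t0 t1]; rewrite subr_gt0 invf_gt1. Qed.

Lemma dimA_cases (R : realType) (theta : R) : 0 <= theta <= 1 ->
  [\/ theta = 0, theta = 1 | 0 < theta < 1].
Proof.
move=> /andP[]; rewrite le_eqVlt => /predU1P[<-|t0]; first by constructor 1.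
by rewrite le_eqVlt => /predU1P[->|t1]; [constructor 2|constructor 3; rewrite t0].
Qed.

(** Excludes the degenerate cases: the spectrum lies between dim_B and dim_qA, so equality of these
    would make it constant. *)
Lemma nonconstant_three_param (R : realType) (d : nat) (E : set 'rV[R]_d) :
  E !=set0 -> ebounded E -> three_param_form E ->
  (exists theta1 theta2 : R,
    [/\ 0 <= theta1 <= 1, 0 <= theta2 <= 1 & dimA theta1 E <> dimA theta2 E]) ->
  [/\ dimB E < dimqA E, 0 < rho E < 1 & forall theta, 0 < theta < 1 ->
   assouad_spec theta E = threshold ((rho E)^-1 - 1) (dimB E) (dimqA E) theta].
Proof.
move=> E0 Eb form [t1 [t2 [t1' t2' t12]]].
have BQ : dimB E <> dimqA E.
  move=> BQ; apply: t12.
  have h t : 0 <= t <= 1 -> dimA t E = dimqA E.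
    move=> /dimA_cases[->|->|t01]; rewrite /dimA ?eqxx// ?oner_eq0//.
    have /andP[t0 tlt1] := t01; rewrite gt_eqF// lt_eqF//; apply/eqP; rewrite eq_le.
    by rewrite spec_le_dimqA//= -BQ dimB_le_spec.
  by rewrite !h.
have {form} [//|form] := form.
have BQ' : dimB E < dimqA E.
  have := form 0; rewrite lexx ltr01 => /(_ isT).
  rewrite /dimA eqxx /three_param mulr0 mul0r mul0r addr0 => h.
  rewrite lt_neqAle; apply/andP; split; first exact/eqP.
  by rewrite h ge_min lexx orbT.
have spec t : 0 < t < 1 -> assouad_spec t E = three_param t E.
  move=> t01; rewrite -dimA_assouad_spec// form//.
  by move: t01 => /andP[/ltW-> ->].
have /andP[r0 r1] := rho_bounds E.
have rho01 : 0 < rho E < 1.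
  (* Both rho = 0, where the inverse is 0 by convention, and rho = 1 make this coefficient vanish;
     the spectrum would then equal dim_B near 1, and so would its limit dim_qA. *)
  have nz : (1 - rho E) / rho E <> 0.
    move=> z; apply: BQ; symmetry; apply: (@dimqA_eventually _ _ _ 2^-1); first by lra.
    move=> t t12'; have t01 : 0 < t < 1 by lra.
    have c0 : (1 - rho E) * t / ((1 - t) * rho E) = (1 - rho E) / rho E * (t / (1 - t)).
      by rewrite invfM; ring.
    by rewrite spec// /three_param c0 z !mul0r addr0; apply/min_idPl/ltW.
  rewrite !lt_neqAle r0 r1 !andbT eq_sym; apply/andP; split.
    by apply: contra_notN nz => /eqP ->; rewrite invr0 mulr0.
  by apply: contra_notN nz => /eqP ->; rewrite subrr mul0r.
split => // t t01; have /andP[rho0 _] := rho01.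
by rewrite spec// /three_param three_param_coef.
Qed.

(** * The maximum of f and the spectrum of the limit set *)

Section ThreeParam.
Variables (R : realType) (d : nat) (P F : set 'rV[R]_d).
Variables h bP qP r bF kappa Q : R.
Hypotheses (P0 : P !=set0) (Pb : ebounded P) (F0 : F !=set0) (Fb : ebounded F).
Hypotheses (bPE : dimB P = bP) (qPE : dimqA P = qP) (bFE : dimB F = bF).
Hypotheses (kappaE : kappa = r^-1 - 1) (QE : Q = Num.max bF qP).
Hypotheses (BQ : bP < qP) (rho01 : 0 < r < 1) (dimBF : bF = Num.max h bP).
Hypothesis specP : forall theta : R, 0 < theta < 1 ->
  assouad_spec theta P = threshold kappa bP qP theta.
Hypothesis expbndF : forall a b : R,
  0 <= a + b -> bF <= a -> expbnd P a b -> expbnd F a b.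
Hypothesis spec_le_F : forall theta : R, 0 < theta < 1 ->
  assouad_spec theta P <= assouad_spec theta F.

Let BF : bP <= bF. Proof. by rewrite dimBF le_max lexx orbT. Qed.
Let FQ : bF <= Q. Proof. by rewrite QE le_max lexx. Qed.
Let PQ : qP <= Q. Proof. by rewrite QE le_max lexx orbT. Qed.
Let kappa0 : 0 < kappa. Proof. by rewrite kappaE inv_sub1_gt0. Qed.
Let kF : 0 <= kappa * (Q - bF).
Proof. by rewrite mulr_ge0 ?(ltW kappa0)// subr_ge0. Qed.

Lemma expbnd_qA_P : expbnd P (qP) (- qP).
Proof.
apply: expbnd_of_spec => // [t t01|]; last by rewrite bPE ltW.
have s0 := inv_sub1_gt0 t01.
have -> : qP * t^-1 - qP = qP * (t^-1 - 1) by ring.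
by rewrite ler_wpM2r ?(ltW s0)// specP// ge_min lexx orbT.
Qed.

Lemma expbnd_B_P : expbnd P (bP) (kappa * (qP - bP) - bP).
Proof.
apply: expbnd_of_spec => // [t t01|]; last by rewrite bPE.
have s0 := inv_sub1_gt0 t01.
have -> : bP * t^-1 + (kappa * (qP - bP) - bP) =
  (bP + kappa / (t^-1 - 1) * (qP - bP)) * (t^-1 - 1).
  by rewrite [RHS]mulrDl mulrAC divfK ?gt_eqF//; ring.
by rewrite ler_wpM2r ?(ltW s0)// specP// ge_min lexx.
Qed.

Lemma expbnd_Q : expbnd P Q (- Q).
Proof. exact: expbnd_raise PQ expbnd_qA_P. Qed.

Lemma expbnd_BF : expbnd P (bF) (kappa * (Q - bF) - bF).
Proof.
have [QF|FQ'] := leP (qP) (bF).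
  have -> : Q = bF by rewrite QE; apply/max_idPl.
  rewrite subrr mulr0 add0r; exact: expbnd_raise QF expbnd_qA_P.
have -> : Q = qP by rewrite QE; apply/max_idPr/ltW.
have BQ0 : 0 < qP - bP by rewrite subr_gt0.
(* The weight with t qP + (1 - t) bP = bF; the second parameter then comes out as kappa (qP - bF) -
   bF. *)
pose t := (bF - bP) / (qP - bP).
have t01 : 0 <= t <= 1.
  rewrite divr_ge0 ?(ltW BQ0) ?subr_ge0//= ler_pdivrMr// mul1r lerB// ltW//.
have := expbnd_convex t01 expbnd_qA_P expbnd_B_P.
have tE : t * (qP - bP) = bF - bP by rewrite divfK ?gt_eqF.
have -> : t * qP + (1 - t) * bP = t * (qP - bP) + bP by ring.
have -> : t * - qP + (1 - t) * (kappa * (qP - bP) - bP) =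
  kappa * (qP - bP) - kappa * (t * (qP - bP))
  - t * (qP - bP) - bP by ring.
rewrite tE subrK; congr expbnd; ring.
Qed.

Let maxf := threshold kappa bF Q.

Let Qsum0 : 0 <= Q + - Q. Proof. by rewrite subrr. Qed.
Let Fsum0 : 0 <= bF + (kappa * (Q - bF) - bF).
Proof. by rewrite addrC subrK. Qed.

Let lineE (theta a b : R) : 0 < theta < 1 ->
  (a * theta^-1 + (kappa * (b - a) - a)) / (theta^-1 - 1) =
  a + kappa / (theta^-1 - 1) * (b - a).
Proof. by move=> /andP[t0 t1]; field; rewrite !gt_eqF//; lra. Qed.

Let constE (theta a : R) : 0 < theta < 1 ->
  (a * theta^-1 - a) / (theta^-1 - 1) = a.
Proof. by move=> /inv_sub1_gt0 s0; rewrite -{2}[a]mulr1 -mulrBr mulfK ?gt_eqF. Qed.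

Lemma spec_F_le theta : 0 < theta < 1 -> assouad_spec theta F <= maxf theta.
Proof.
move=> t01; rewrite le_min; apply/andP; split.
  rewrite -lineE//; apply: spec_le_expbnd => //.
  by apply: expbndF => //; exact: expbnd_BF.
rewrite -[leRHS](constE _ t01); apply: spec_le_expbnd => //.
by apply: expbndF => //; exact: expbnd_Q.
Qed.

Lemma upper_dimA_le phi : 0 < phi < 1 -> upper_dimA phi P <= maxf phi.
Proof.
move=> t01; rewrite upper_dimA_upper_assouad_spec// le_min; apply/andP; split.
  rewrite -lineE//; apply: upspec_le_expbnd => //; exact: expbnd_BF.
rewrite -[leRHS](constE _ t01); apply: upspec_le_expbnd => //; exact: expbnd_Q.
Qed.

(** The two [expbnd] lines of P control all u >= v / phi at once, so they bound the upper spectrum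
    by the same threshold as the spectrum. *)
Lemma upper_dimA_spec phi : 0 < phi < 1 -> upper_dimA phi P = assouad_spec phi P.
Proof.
move=> t01; rewrite upper_dimA_upper_assouad_spec//; apply/eqP.
rewrite eq_le spec_le_upspec// andbT specP// le_min; apply/andP; split.
  rewrite -lineE//; apply: upspec_le_expbnd expbnd_B_P => //.
  by rewrite addrC subrK mulr_ge0 ?(ltW kappa0)// subr_ge0 ltW.
rewrite -[leRHS](constE _ t01); apply: upspec_le_expbnd expbnd_qA_P => //.
by rewrite subrr.
Qed.

Lemma upper_dimA_P1 : upper_dimA 1 P = qP.
Proof. by rewrite -qPE; rewrite /upper_dimA oner_eq0 eqxx. Qed.

Let coef_ge1 theta : r <= theta < 1 -> 1 <= kappa / (theta^-1 - 1).
Proof.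
have /andP[r0 r1] := rho01; move=> /andP[rt t1].
have t0 : 0 < theta by exact: lt_le_trans rt.
rewrite ler_pdivlMr ?mul1r ?inv_sub1_gt0 ?t0// kappaE lerD2r lef_pV2 ?posrE//.
Qed.

Let coef_lt1 theta : 0 < theta < r -> kappa / (theta^-1 - 1) < 1.
Proof.
have /andP[r0 r1] := rho01; move=> /andP[t0 tr].
have t1 : theta < 1 by exact: lt_trans r1.
rewrite ltr_pdivrMr ?mul1r ?inv_sub1_gt0 ?t0// kappaE ltrD2r ltf_pV2 ?posrE//.
Qed.

Let minE_ge1 (c a b : R) : 1 <= c -> a <= b -> Num.min (a + c * (b - a)) b = b.
Proof.
move=> c1 ab; apply/min_idPr; have : 0 <= (c - 1) * (b - a) by rewrite mulr_ge0 ?subr_ge0.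
lra.
Qed.

Let minE_lt1 (c a b : R) : c < 1 -> a <= b -> Num.min (a + c * (b - a)) b = a + c * (b - a).
Proof.
move=> c1 ab; apply/min_idPl; have : 0 <= (1 - c) * (b - a) by rewrite mulr_ge0 ?subr_ge0 ?(ltW c1).
lra.
Qed.

(** With t = phi^-1 - 1, s = theta^-1 - 1 and u the upper spectrum of P at phi, s f = t u + (s - t)
    bF. The bounds t u <= t bF + kappa (Q - bF) and u <= Q yield the two entries of the
    threshold. *)
Lemma maxf_is_max theta : 0 < theta < 1 ->
  is_max [set f_bound P F theta phi | phi in [set phi : R | theta <= phi <= 1]] (maxf theta).
Proof.
move=> t01; have s0 := inv_sub1_gt0 t01; have /andP[t0 t1] := t01.
have /andP[r0 r1] := rho01.
split.
  have [QF|FQ'] := leP (qP) (bF).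
    (* Here Q = bF, and f(theta, 1) = bF. *)
    exists 1; first by rewrite /= lexx ltW.
    rewrite /f_bound bFE invr1 subrr mul0r add0r mulrAC divff ?gt_eqF// mul1r.
    have QF' : Q = bF by rewrite QE; apply/max_idPl.
    by rewrite /maxf /threshold QF' subrr mulr0 addr0 minxx.
  have QP : Q = qP by rewrite QE; apply/max_idPr/ltW.
  have [rt|tr] := leP (r) theta.
    have c1 : 1 <= kappa / (theta^-1 - 1) by apply: coef_ge1; rewrite rt.
    exists theta; first by rewrite /= lexx ltW.
    rewrite /f_bound subrr mul0r addr0 mulrAC divff ?gt_eqF// mul1r.
    rewrite upper_dimA_spec// specP// /maxf /threshold QP.
    by rewrite (minE_ge1 c1 (ltW BQ)) (minE_ge1 c1 (ltW FQ')).
  have c1 : kappa / (theta^-1 - 1) < 1 by apply: coef_lt1; rewrite t0.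
  exists (r); first by rewrite /= !ltW.
  rewrite /f_bound bFE upper_dimA_spec// specP//.
  rewrite [threshold _ _ _ _]minE_ge1 ?(ltW BQ)//; last by apply: coef_ge1; rewrite lexx.
  rewrite /maxf /threshold QP (minE_lt1 c1 (ltW FQ')) kappaE.
  by field; rewrite !gt_eqF//; lra.
move=> _ [phi /andP[tp p1] <-]; rewrite /f_bound bFE ler_pdivrMr//.
have p0 : 0 < phi by exact: lt_le_trans tp.
set t := phi^-1 - 1; have t0' : 0 <= t by rewrite subr_ge0 invf_ge1.
have ts : t <= theta^-1 - 1 by rewrite lerB// lef_pV2.
have -> : theta^-1 - phi^-1 = (theta^-1 - 1) - t by rewrite /t; ring.
set s := theta^-1 - 1 in s0 ts *; set u := upper_dimA phi P.
have [uQ ut] : u <= Q /\ t * u <= t * bF + kappa * (Q - bF).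
  move: p1; rewrite le_eqVlt => /predU1P[p1|p1].
    by rewrite /u p1 upper_dimA_P1 /t p1 invr1 subrr !mul0r add0r.
  have p01 : 0 < phi < 1 by rewrite p0.
  have tp0 : 0 < t by exact: inv_sub1_gt0.
  have := upper_dimA_le p01; rewrite -/u le_min => /andP[u1 u2]; split => //.
  apply: le_trans (_ : t * (bF + kappa / t * (Q - bF)) <= _).
    by rewrite ler_wpM2l.
  by rewrite le_eqVlt; apply/orP; left; apply/eqP; field; rewrite gt_eqF.
rewrite /maxf /threshold -/s minr_pMl ?(ltW s0)// le_min; apply/andP; split.
  have -> : (bF + kappa / s * (Q - bF)) * s = bF * s + kappa * (Q - bF).
    by field; rewrite gt_eqF.
  lra.
have h1 : t * u <= t * Q by rewrite ler_wpM2l.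
have h2 : (s - t) * bF <= (s - t) * Q by rewrite ler_wpM2l// subr_ge0.
lra.
Qed.

(** The threshold is at most Q; from below there are dim_B F and the spectrum of P, which equals qP
    from rho_P on. This identifies dim_qA F. *)
Lemma spec_F_eq theta : r <= theta < 1 -> assouad_spec theta F = Q.
Proof.
have /andP[r0 r1] := rho01; move=> rt; have /andP[rt' t1] := rt.
have t01 : 0 < theta < 1 by rewrite t1 (lt_le_trans r0).
apply/eqP; rewrite eq_le; apply/andP; split.
  by apply: le_trans (spec_F_le t01) _; rewrite ge_min lexx orbT.
rewrite QE ge_max -{1}bFE dimB_le_spec//=; apply: le_trans (spec_le_F t01).
by rewrite specP// /threshold minE_ge1 ?(ltW BQ)//; exact: coef_ge1.
Qed.

Lemma dimqA_F : dimqA F = Q.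
Proof. by have /andP[_ r1] := rho01; exact: dimqA_eventually r1 spec_F_eq. Qed.

(** What is to be seen is rho_F = rho_P: the value Q is taken from rho_P on, and before rho_P the
    threshold, hence the spectrum, is strictly below Q. *)
Lemma maxf_three_param theta : 0 < theta < 1 -> bF <> dimqA F ->
  maxf theta = three_param theta F.
Proof.
have /andP[r0 r1] := rho01; rewrite dimqA_F => t01 FneQ.
have FltQ : bF < Q by rewrite lt_neqAle FQ andbT; exact/eqP.
have rhoF : rho F = r.
  apply/eqP; rewrite eq_le; apply/andP; split.
    apply: rho_le; first by rewrite !ltW.
    by rewrite dimA_assouad_spec// dimqA_F spec_F_eq// lexx.
  apply: rho_ge => t /dimA_cases tc tQ; rewrite leNgt; apply/negP => tr.
  case: tc tQ => [->|t1|t01'] ; rewrite dimqA_F.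
  - by rewrite /dimA eqxx bFE.
  - by move: tr; rewrite t1 ltNge ltW.
  rewrite dimA_assouad_spec// => tQ; have := spec_F_le t01'; rewrite tQ /maxf /threshold.
  have c1 : kappa / (t^-1 - 1) < 1 by apply: coef_lt1; rewrite tr andbT; case/andP: t01'.
  rewrite minE_lt1//.
  have : 0 < (1 - kappa / (t^-1 - 1)) * (Q - bF) by rewrite mulr_gt0 ?subr_gt0.
  lra.
by rewrite /three_param rhoF three_param_coef// dimqA_F bFE -kappaE.
Qed.

Lemma maxf_const theta : bF = dimqA F -> maxf theta = dimqA F.
Proof. by rewrite /maxf /threshold dimqA_F => ->; rewrite subrr mulr0 addr0 minxx. Qed.

Lemma maxf_spec theta : h <= bP -> 0 < theta < 1 -> maxf theta = assouad_spec theta P.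
Proof.
move=> hB t01; have FB : bF = bP by rewrite dimBF; apply/max_idPr.
have QP : Q = qP by rewrite QE FB; apply/max_idPr/ltW.
by rewrite specP// /maxf QP FB.
Qed.

Lemma max_upper_dimA theta : h <= bP -> 0 < theta < 1 ->
  Num.max h (upper_dimA theta P) = maxf theta.
Proof.
move=> hB t01; rewrite maxf_spec// upper_dimA_spec//; apply/max_idPr.
by apply: le_trans hB _; rewrite -bPE dimB_le_spec.
Qed.

Lemma dimA_F theta : h <= bP -> 0 <= theta <= 1 -> dimA theta F = dimA theta P.
Proof.
move=> hB /dimA_cases; have FB : bF = bP by rewrite dimBF; apply/max_idPr.
case=> [->|->|t01].
- by rewrite /dimA eqxx bFE bPE.
- by rewrite /dimA oner_eq0 eqxx dimqA_F qPE QE FB; apply/max_idPr/ltW.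
- rewrite !dimA_assouad_spec//; apply/eqP; rewrite eq_le spec_le_F// andbT.
  by rewrite -maxf_spec//; exact: spec_F_le.
Qed.

(** For theta < rho_P the factor c = kappa / (theta^-1 - 1) is below 1; the threshold of F exceeds h
    by c (qP - h) and that of P by (1 - c) (h - bP). *)
Lemma max_upper_dimA_lt theta : bP < h < qP -> 0 < theta < r ->
  Num.max h (upper_dimA theta P) < maxf theta.
Proof.
move=> /andP[Bh hQ] tr; have /andP[t0 t_rho] := tr.
have c1 := coef_lt1 tr.
have t01 : 0 < theta < 1 by rewrite t0; have /andP[_] := rho01; exact: lt_trans.
have FB : bF = h by rewrite dimBF; apply/max_idPl/ltW.
have QP : Q = qP by rewrite QE FB; apply/max_idPr/ltW.
rewrite /maxf /threshold upper_dimA_spec// specP// QP FB.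
rewrite (minE_lt1 c1 (ltW hQ)) [threshold _ _ _ _](minE_lt1 c1 (ltW (lt_trans Bh hQ))) gt_max.
set c := kappa / _ in c1 *.
have c0 : 0 < c by rewrite divr_gt0// inv_sub1_gt0.
have h1 : 0 < c * (qP - h) by rewrite mulr_gt0// subr_gt0.
have h2 : 0 < (1 - c) * (h - bP) by rewrite mulr_gt0// subr_gt0.
by apply/andP; split; lra.
Qed.

End ThreeParam.

Theorem corollary4p11 (R : realType) (d : nat) (I : countType)
    (X P : set 'rV[R]_d) (S : I -> 'rV[R]_d -> 'rV[R]_d)
    (d_gt0 : (0 < d)%N) (I_nonempty : [set: I] !=set0)
    (S_cifs : cifs X S)
    (P_sub : P `<=` \bigcup_i (S i @` X))
    (P_one : forall i, exists! p, (P `&` (S i @` X)) p)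
    (P_nonconstant : exists theta1 theta2 : R,
      [/\ 0 <= theta1 <= 1, 0 <= theta2 <= 1 & dimA theta1 P <> dimA theta2 P])
    (P_three_param : three_param_form P) :
  let F := limit_set X S in
  let h := dimH F in
  exists maxf : R -> R,
    [/\ forall theta : R, 0 < theta < 1 ->
          is_max [set f_bound P F theta phi
                   | phi in [set phi : R | theta <= phi <= 1]] (maxf theta),
        forall theta : R, 0 < theta < 1 ->
          dimA theta F <= maxf theta /\
          (dimB F = dimqA F -> maxf theta = dimqA F) /\
          (dimB F <> dimqA F -> maxf theta = three_param theta F),
        h <= dimB P ->
          (forall theta : R, 0 < theta < 1 ->
             Num.max h (upper_dimA theta P) = maxf theta) /\
          (forall theta : R, 0 <= theta <= 1 -> dimA theta F = dimA theta P) &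
        dimB P < h < dimqA P ->
          forall theta : R, 0 < theta < rho P ->
            Num.max h (upper_dimA theta P) <> maxf theta].
Proof.
move=> F h; have [i0 _] := I_nonempty.
have [lam [xi [K [M H]]]] := cifs_geometry d_gt0 S_cifs.
have /choice[p hp] : forall i, exists x, unique (P `&` (S i @` X)) x by exact: P_one.
have pS i : (S i @` X) (p i) by have [[]] := hp i.
have PE : P = range p.
  apply/seteqP; split=> [x Px|_ [i _ <-]]; last by have [[]] := hp i.
  have [i _ Sx] := P_sub x Px; exists i => //.
  by have [_] := hp i; apply.
have P0 : P !=set0 by exists (p i0); rewrite PE; exists i0.
have Pb : ebounded P.
  have [x0 X0] := ig_X0 H; exists x0 => //; exists (K + 1).
    by have := ig_K1 H; lra.
  rewrite PE => _ [i _ <-]; rewrite /eball/=.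
  apply: le_lt_trans (ig_diam H (base_point_sub H pS i) X0) _; lra.
have F0 : F !=set0 := limit_set0 H i0.
have Fb : ebounded F := limit_set_bounded H.
have dimBF : dimB F = Num.max h (dimB P) by rewrite PE; exact: (dimB_limit_set H i0 pS).
have expbndF (a b : R) : 0 <= a + b -> dimB F <= a -> expbnd P a b -> expbnd F a b.
  by rewrite PE; exact: (expbnd_limit_set H i0 pS).
have specF (theta : R) : 0 < theta < 1 -> assouad_spec theta P <= assouad_spec theta F.
  by rewrite PE; exact: (spec_base_le H i0 pS).
have [BQ rho01 specP] := nonconstant_three_param P0 Pb P_three_param P_nonconstant.
(* Q turns out to be dim_qA F, by [dimqA_F]. *)
set Q := Num.max (dimB F) (dimqA P); set kappa := (rho P)^-1 - 1 in specP.
exists (threshold kappa (dimB F) Q); split.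
- move=> theta t01.
  exact: (maxf_is_max P0 Pb erefl erefl erefl erefl erefl BQ rho01 dimBF specP t01).
- move=> theta t01; split; last split.
  + rewrite dimA_assouad_spec//.
    exact: (spec_F_le P0 Pb F0 erefl erefl erefl BQ rho01 dimBF specP expbndF t01).
  + exact: (maxf_const P0 Pb F0 Fb erefl erefl erefl erefl BQ rho01 dimBF specP expbndF specF).
  + exact: (maxf_three_param P0 Pb F0 Fb erefl erefl erefl erefl BQ rho01 dimBF specP expbndF specF).
- move=> hB; split=> theta t01.
  + exact: (max_upper_dimA P0 Pb erefl erefl erefl BQ rho01 dimBF specP hB).
  + exact: (dimA_F P0 Pb F0 Fb erefl erefl erefl erefl erefl BQ rho01 dimBF specP expbndF specF hB t01).
- move=> hB theta tr; apply/eqP; rewrite lt_eqF//.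
  exact: (max_upper_dimA_lt P0 Pb erefl erefl erefl BQ rho01 dimBF specP).
Qed.
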